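(* Let $G_1=(-1,1)\times(-1,1)$ and, for $j\ge 1$, let $\nu_j$ be the $j$-th strictly positive solution of $\tan\nu+\tanh\nu=0$. For each integer $m\ge 1$ there is a constant $C_m>0$ such that for every $H^1$-harmonic function $h$ on $G_1$, $$|h(0,0)-h_m(0,0)|\le C_m\,e^{-\nu_m}\,\|h\|_{\partial G_1},$$ where $h_m(0,0)$ is the $m$-th Steklov approximation $$h_m(0,0):=\bar h+\sum_{j=1}^m\langle h,\tilde s_{1j}+\tilde s_{2j}\rangle_{\partial G_1}\,\tilde s_{1j}(0,0).$$ Moreover, when $m\ge 3$ the inequality holds with some $C_m<0.41$.
   Context: An $H^1$-harmonic function on $G_1$ is a real function $h\in H^1(G_1)$ satisfying Laplace's equation weakly: $\int_{G_1}\nabla h\cdot\nabla\varphi\,dx\,dy=0$ for all $C^1$ functions $\varphi$ with compact support in $G_1$; $h(0,0)$ is the value of its smooth representative. Boundary values of $h$ are taken in the sense of traces. With $|\partial G_1|=8$ and $\sigma$ arc length, $$\langle u,v\rangle_{\partial G_1}:=|\partial G_1|^{-1}\int_{\partial G_1}u\,v\,d\sigma,\qquad \|h\|_{\partial G_1}:=\langle h,h\rangle_{\partial G_1}^{1/2},\qquad \bar h:=\langle h,1\rangle_{\partial G_1}.$$ The functions $\tilde s_{1j},\tilde s_{2j}$ are the boundary normalized non-constant harmonic Steklov eigenfunctions on $G_1$ that are even in both $x$ and $y$: $$\tilde s_{1j}(x,y):=\sqrt{\tfrac{8}{I(1,\nu_j)}}\,\cosh(\nu_j x)\cos(\nu_j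 y),\qquad \tilde s_{2j}(x,y):=\sqrt{\tfrac{8}{I(1,\nu_j)}}\,\cos(\nu_j x)\cosh(\nu_j y),$$ where $$I(1,\nu):=2\cosh^2\nu\,\bigl[1+\operatorname{sinc}(2\nu)\bigr]+\cos^2\nu\,\bigl[2+\nu^{-1}\sinh(2\nu)\bigr],\qquad \operatorname{sinc}(\theta):=\theta^{-1}\sin\theta .$$ *)

(* Defs.v *)
From HB Require Import structures.
From mathcomp Require Import all_boot all_order all_algebra.
From mathcomp Require Import all_classical all_reals all_analysis.

Set Implicit Arguments.
Unset Strict Implicit.
Unset Printing Implicit Defensive.

Import Order.TTheory GRing.Theory Num.Theory.
Import numFieldNormedType.Exports.

Local Open Scope classical_set_scope.
Local Open Scope ring_scope.

Section SteklovSquare.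
Variable R : realType.

Definition cosh (x : R) : R := (expR x + expR (- x)) / 2.
Definition sinh (x : R) : R := (expR x - expR (- x)) / 2.
Definition tanh (x : R) : R := sinh x / cosh x.
Definition sinc (t : R) : R := t^-1 * sin t.

Local Notation mu := (@lebesgue_measure R).
Local Notation mu2 := (mu \x mu)%E.
Local Notation J := (`[-1, 1]%classic : set (measurableTypeR R)).

Definition G1 : set (R * R) := `]-1, 1[ `*` `]-1, 1[.

Definition dx (f : R * R -> R) (p : R * R) : R :=
  derive1 (fun t : R => f (t, p.2)) p.1.
Definition dy (f : R * R -> R) (p : R * R) : R :=
  derive1 (fun t : R => f (p.1, t)) p.2.

(* C^k on the set U, which is open in every use. *)
Fixpoint Ck (k : nat) (U : set (R * R)) (f : R * R -> R) : Prop :=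
  (forall p, U p -> {for p, continuous f}) /\
  match k with
  | 0%N => True
  | k'.+1 =>
    [/\ forall p, U p -> derivable (fun t : R => f (t, p.2)) p.1 1,
        forall p, U p -> derivable (fun t : R => f (p.1, t)) p.2 1,
        Ck k' U (dx f)
      & Ck k' U (dy f)]
  end.

Definition smooth_on (U : set (R * R)) (f : R * R -> R) : Prop :=
  forall k, Ck k U f.

Definition L2 (f : R * R -> R) : Prop :=
  measurable_fun (G1 : set (measurableTypeR R * measurableTypeR R)) f /\
  (\int[mu2]_(p in G1) ((f p) ^+ 2)%:E < +oo)%E.

Definition test_fun (phi : R * R -> R) : Prop :=
  [/\ Ck 1 setT phi,
      compact (closure [set p | phi p != 0])
    & closure [set p | phi p != 0] `<=` G1].

(* h is in H^1(G1), with weak gradient (hx, hy). *)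
Definition H1_grad (h hx hy : R * R -> R) : Prop :=
  [/\ L2 h, L2 hx, L2 hy &
      forall phi, test_fun phi ->
        Rintegral mu2 G1 (fun p => h p * dx phi p) =
          - Rintegral mu2 G1 (fun p => hx p * phi p) /\
        Rintegral mu2 G1 (fun p => h p * dy phi p) =
          - Rintegral mu2 G1 (fun p => hy p * phi p)].

Definition H1_harmonic (h : R * R -> R) : Prop :=
  exists hx hy : R * R -> R, H1_grad h hx hy /\
    forall phi, test_fun phi ->
      Rintegral mu2 G1 (fun p => hx p * dx phi p + hy p * dy phi p) = 0.

(* As an element of H^1, h only matters up to null sets: its value at a point
   p of G1 is the common value at p of the smooth functions that agree with h
   almost everywhere on G1. *)
Definition smooth_value (h : R * R -> R) (p : R * R) : R :=
  xget 0 [set v | exists hs : R * R -> R,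
    [/\ smooth_on G1 hs, {ae mu2, forall q, G1 q -> h q = hs q} & v = hs p]].

(* Unit-speed parametrizations, over J = [-1, 1], of the four sides of G1. *)
Definition side (k : 'I_4) (t : R) : R * R :=
  nth (0, 0) [:: (1, t); (-1, t); (t, 1); (t, -1)] k.

Definition boundary_integral (u : R * R -> R) : R :=
  \sum_(k < 4) Rintegral mu J (fun t => u (side k t)).

Definition boundary_L2 (u : R * R -> R) : Prop :=
  forall k : 'I_4, measurable_fun J (fun t => u (side k t)) /\
    (\int[mu]_(t in J) ((u (side k t)) ^+ 2)%:E < +oo)%E.

(* The trace operator is the continuous extension to H^1(G1), with values in
   L^2 of the boundary, of the restriction of functions that are C^1 up to the
   boundary: g is the trace of h when some sequence of such functions u_n
   converges to h in H^1(G1) while their boundary restrictions converge to g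
   in L^2.  Only the values of g on the boundary matter. *)
Definition is_trace (h g : R * R -> R) : Prop :=
  boundary_L2 g /\
  exists (hx hy : R * R -> R) (u : nat -> R * R -> R),
    [/\ H1_grad h hx hy,
        forall n, exists U : set (R * R),
          [/\ open U, closure G1 `<=` U & Ck 1 U (u n)],
        (\int[mu2]_(p in G1) ((u n p - h p) ^+ 2 + (dx (u n) p - hx p) ^+ 2
            + (dy (u n) p - hy p) ^+ 2)%:E)%E @[n --> \oo] --> 0%E
      & forall k : 'I_4,
        (\int[mu]_(t in J)
            ((u n (side k t) - g (side k t)) ^+ 2)%:E)%E
          @[n --> \oo] --> 0%E].

Definition trace (h : R * R -> R) : R * R -> R :=
  xget (fun=> 0) [set g | is_trace h g].

Definition boundary_inner (u v : R * R -> R) : R :=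
  8^-1 * boundary_integral (fun p => u p * v p).

Definition boundary_norm (u : R * R -> R) : R :=
  Num.sqrt (boundary_inner u u).

Definition boundary_mean (u : R * R -> R) : R :=
  boundary_inner u (fun=> 1).

(* Where cos vanishes, tan is 0 by convention; as tanh x > 0 for x > 0, such
   points are not mistaken for solutions. *)
Definition pos_solution (x : R) : Prop := 0 < x /\ tan x + tanh x = 0.

(* The j-th strictly positive solution (j >= 1): the solution x such that
   exactly j positive solutions are at most x. *)
Definition nu (j : nat) : R :=
  xget 0 [set x | pos_solution x /\
    ([set y | pos_solution y /\ y <= x] #= `I_j)%card].

Definition I1 (v : R) : R :=
  2 * cosh v ^+ 2 * (1 + sinc (2 * v))
  + cos v ^+ 2 * (2 + v^-1 * sinh (2 * v)).

Definition s1 (j : nat) (p : R * R) : R :=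
  Num.sqrt (8 / I1 (nu j)) * cosh (nu j * p.1) * cos (nu j * p.2).
Definition s2 (j : nat) (p : R * R) : R :=
  Num.sqrt (8 / I1 (nu j)) * cos (nu j * p.1) * cosh (nu j * p.2).

Definition steklov_approx (m : nat) (h : R * R -> R) : R :=
  boundary_mean (trace h) +
  \sum_(1 <= j < m.+1)
    boundary_inner (trace h) (fun p => s1 j p + s2 j p) * s1 j (0, 0).

End SteklovSquare.

(* Main.v *)
(* Green's identity against the products [sn k x * sn m y] of Dirichlet sines expresses the Fourier
   coefficients of a harmonic [h] through the sine coefficients of its trace on the four sides. The
   classical separated series with these boundary coefficients is smooth and has the same Fourier
   coefficients, hence equals [h] almost everywhere; at the centre it gives [h(0,0) = <G, P>], where [G]
   is the sum of the boundary values over the four sides and [P] has the sine coefficients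
   [sn l 0 / (2 cosh (l pi/2))].

   On a side, [s1 j + s2 j] is proportional to [phi_j(t) = cosh v cos(v t) + cos v cosh(v t)], [v = nu j].
   Together with the constant 1 these profiles are orthogonal in [L2(-1,1)], and they are complete among
   even functions: otherwise the quadratic form of the inverse of the fourth derivative would attain a
   positive maximum on the unit ball of their even complement, at a further profile of the same kind.
   Parseval's identity for [<G, P>] is then the full Steklov expansion of [h(0,0)].

   Its [j]-th term is at most [e^(-nu j) |G|], because [<phi_j, P> = 1/2] and
   [|phi_j|^2 = cosh^2 v + cos^2 v]. The roots are nearly [pi]-spaced, so the tail after [m] is at most
   [16/225 e^(-nu m) |G|], and [|G| <= sqrt 32] times the boundary norm; [16/225 sqrt 32 < 81/200]. *)

Require Import Defs.
From mathcomp Require Import all_boot all_order all_algebra.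
From mathcomp Require Import all_classical all_reals all_analysis measurable_realfun.
From mathcomp Require Import ring lra.

Set Implicit Arguments.
Unset Strict Implicit.
Unset Printing Implicit Defensive.

Import Order.TTheory GRing.Theory Num.Theory.
Import numFieldNormedType.Exports.

Local Open Scope classical_set_scope.
Local Open Scope ring_scope.

(** * L2 spaces *)

(** The symmetries of the square fix its centre, so the boundary values enter only through their sum
    over the four sides, and a problem on the boundary becomes one in [L2(-1,1)]: the error is the
    tail of a Parseval series there. Three obstacles shape the development. The Dirichlet sines
    vanish on the boundary but have no compact support, so they enter the weak formulations only
    through cutoffs. The trace is picked by choice, so one has to be constructed; cosine partial
    sums do it, because their gradients are themselves partial sums of expansions of the weak
    gradient. The profiles are eigenvectors of a diagonal operator in the sine basis only modulo
    constants, so the maximisation takes place orthogonally to 1 as well. A single constant,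
    [81/200], serves every [m >= 1]; the margin below [0.41] leaves room for rational bounds on
    [sqrt 32], [pi] and the exponential. *)

Section L2theory.
Context d (T : measurableType d) (R : realType) (mu : {measure set T -> \bar R}).
Variables (D : set T) (mD : measurable D) (muD : (mu D < +oo)%E).
Implicit Types f g : T -> R.

Definition L1on f := mu.-integrable D (EFin \o f).
Definition L2on f := measurable_fun D f /\ (\int[mu]_(x in D) ((f x) ^+ 2)%:E < +oo)%E.
Definition ip f g : R := \int[mu]_(x in D) (f x * g x).
Definition bounded_on f := exists M, forall x, D x -> `|f x| <= M.

Lemma L1on_meas f : L1on f -> measurable_fun D f.
Proof. by move=> /measurable_int /measurable_EFinP. Qed.

Lemma L1on_le f g : measurable_fun D f -> (forall x, D x -> `|f x| <= g x) ->
  L1on g -> L1on f.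
Proof.
move=> mf fg; apply: le_integrable => //; first exact/measurable_EFinP.
by move=> x Dx; rewrite /= lee_fin (le_trans (fg x Dx))// ler_norm.
Qed.

Lemma L1on_cst c : L1on (fun=> c).
Proof.
apply: measurable_bounded_integrable => //.
by exists `|c|; split=> [|x cx y _ /=]; [exact: num_real | exact: ltW].
Qed.

Lemma L1on_bounded f : measurable_fun D f -> bounded_on f -> L1on f.
Proof. by move=> mf [M fM]; apply: (@L1on_le _ (fun=> M)) => //; exact: L1on_cst. Qed.

Lemma L1onD f g : L1on f -> L1on g -> L1on (fun x => f x + g x).
Proof. by move=> lf lg; exact: (integrableD mD lf lg). Qed.

Lemma L1onZ c f : L1on f -> L1on (fun x => c * f x).
Proof. by move=> lf; exact: (integrableZl mD c lf). Qed.

Lemma L1onB f g : L1on f -> L1on g -> L1on (fun x => f x - g x).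
Proof. by move=> lf lg; exact: (integrableB mD lf lg). Qed.

Lemma L1on_norm f : L1on f -> L1on (fun x => `|f x|).
Proof. exact: integrable_abse. Qed.

Lemma L1on_sum (I : Type) (r : seq I) (F : I -> T -> R) :
  (forall i, L1on (F i)) -> L1on (fun x => \sum_(i <- r) F i x).
Proof.
move=> h; elim: r => [|i r IH]; first by under eq_fun do rewrite big_nil; exact: L1on_cst.
by under eq_fun do rewrite big_cons; exact: L1onD.
Qed.

Lemma L1onM f g : L1on f -> measurable_fun D g -> bounded_on g ->
  L1on (fun x => f x * g x).
Proof.
move=> lf mg [M gM].
apply: (@L1on_le _ (fun x => M * `|f x|)).
- by apply: measurable_funM => //; exact: L1on_meas.
- by move=> x Dx; rewrite normrM mulrC ler_wpM2r// gM.
- exact/L1onZ/L1on_norm.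
Qed.

Lemma L2onP f : L2on f <-> measurable_fun D f /\ L1on (fun x => f x ^+ 2).
Proof.
split=> -[mf h]; split=> //.
  apply/integrableP; split; first exact/measurable_EFinP/measurable_funX.
  by under eq_integral do rewrite /= ger0_norm ?sqr_ge0//.
case/integrableP: h => _.
by under eq_integral do rewrite /= ger0_norm ?sqr_ge0//.
Qed.

Lemma L2on_mul f g : L2on f -> L2on g -> L1on (fun x => f x * g x).
Proof.
move=> /L2onP[mf lf] /L2onP[mg lg].
apply: (@L1on_le _ (fun x => f x ^+ 2 + g x ^+ 2)); last exact: L1onD.
  exact: measurable_funM.
move=> x _; rewrite normrM -(real_normK (num_real (f x))) -(real_normK (num_real (g x))).
set a := `|_|; set b := `|_|; have := sqr_ge0 (a - b); have := sqr_ge0 a.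
have := sqr_ge0 b; nra.
Qed.

Lemma L2on_bounded f : measurable_fun D f -> bounded_on f -> L2on f.
Proof.
move=> mf [M fM]; apply/L2onP; split=> //; apply: L1on_bounded; first exact: measurable_funX.
exists (M ^+ 2) => x Dx; rewrite ger0_norm ?sqr_ge0// -real_normK ?num_real//.
by rewrite ler_sqr ?nnegrE ?fM// (le_trans _ (fM x Dx)).
Qed.

Lemma L2on_L1 f : L2on f -> L1on f.
Proof.
move=> lf; have : L1on (fun x => f x * 1).
  apply: L2on_mul => //; apply: L2on_bounded => //.
  by exists 1 => x _; rewrite normr1.
by under eq_fun do rewrite mulr1.
Qed.

Lemma L2onD f g : L2on f -> L2on g -> L2on (fun x => f x + g x).
Proof.
move=> lf lg; have [mf sf] := (L2onP f).1 lf; have [mg sg] := (L2onP g).1 lg.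
apply/L2onP; split; first exact: measurable_funD.
under eq_fun do rewrite sqrrD -mulr_natl.
by do 2 apply: L1onD => //; apply: L1onZ; exact: L2on_mul.
Qed.

Lemma L2onZ c f : L2on f -> L2on (fun x => c * f x).
Proof.
move=> /L2onP[mf sf]; apply/L2onP; split; first exact: measurable_funM.
by under eq_fun do rewrite exprMn; exact: L1onZ.
Qed.

Lemma L2onN f : L2on f -> L2on (fun x => - f x).
Proof. by move=> lf; under eq_fun do rewrite -mulN1r; exact: L2onZ. Qed.

Lemma L2onB f g : L2on f -> L2on g -> L2on (fun x => f x - g x).
Proof. by move=> lf lg; apply: L2onD => //; exact: L2onN. Qed.

Lemma L2on_cst c : L2on (fun=> c).
Proof. by apply: L2on_bounded => //; exists `|c|. Qed.

Lemma L2on_sum (I : Type) (r : seq I) (F : I -> T -> R) :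
  (forall i, L2on (F i)) -> L2on (fun x => \sum_(i <- r) F i x).
Proof.
move=> h; elim: r => [|i r IH]; first by under eq_fun do rewrite big_nil; exact: L2on_cst.
by under eq_fun do rewrite big_cons; exact: L2onD.
Qed.

Lemma Rint_eq f g : (forall x, D x -> f x = g x) ->
  \int[mu]_(x in D) f x = \int[mu]_(x in D) g x.
Proof. by move=> fg; apply: eq_Rintegral => x /set_mem; exact: fg. Qed.

Lemma Rint_sum (I : Type) (r : seq I) (F : I -> T -> R) : (forall i, L1on (F i)) ->
  \int[mu]_(x in D) (\sum_(i <- r) F i x) = \sum_(i <- r) \int[mu]_(x in D) F i x.
Proof.
move=> h; elim: r => [|i r IH].
  under Rint_eq do rewrite big_nil.
  by rewrite big_nil Rintegral_cst// mul0r.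
under Rint_eq do rewrite big_cons.
by rewrite big_cons RintegralD//= ?IH//; [exact: h|exact: L1on_sum].
Qed.

Lemma ipC f g : ip f g = ip g f.
Proof. by apply: Rint_eq => x _; rewrite mulrC. Qed.

Lemma ipDl f g k : L2on f -> L2on g -> L2on k ->
  ip (fun x => f x + g x) k = ip f k + ip g k.
Proof.
move=> lf lg lk; rewrite /ip -RintegralD//; [|exact: L2on_mul|exact: L2on_mul].
by apply: Rint_eq => x _; rewrite mulrDl.
Qed.

Lemma ipZl c f g : L2on f -> L2on g -> ip (fun x => c * f x) g = c * ip f g.
Proof.
move=> lf lg; rewrite /ip -RintegralZl//; last exact: L2on_mul.
by apply: Rint_eq => x _; rewrite mulrA.
Qed.

Lemma ipNl f g : L2on f -> L2on g -> ip (fun x => - f x) g = - ip f g.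
Proof.
by move=> lf lg; rewrite -mulN1r -ipZl//; apply: Rint_eq => x _; rewrite mulN1r.
Qed.

Lemma ipBl f g k : L2on f -> L2on g -> L2on k ->
  ip (fun x => f x - g x) k = ip f k - ip g k.
Proof. by move=> lf lg lk; rewrite ipDl// ?ipNl//; exact: L2onN. Qed.

Lemma ipDr f g k : L2on f -> L2on g -> L2on k ->
  ip k (fun x => f x + g x) = ip k f + ip k g.
Proof. by move=> *; rewrite ipC ipDl// ipC (ipC g). Qed.

Lemma ipBr f g k : L2on f -> L2on g -> L2on k ->
  ip k (fun x => f x - g x) = ip k f - ip k g.
Proof. by move=> *; rewrite ipC ipBl// ipC (ipC g). Qed.

Lemma ipZr c f g : L2on f -> L2on g -> ip g (fun x => c * f x) = c * ip g f.
Proof. by move=> *; rewrite ipC ipZl// ipC. Qed.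

Lemma ip_suml (I : Type) (r : seq I) (F : I -> T -> R) g :
  (forall i, L2on (F i)) -> L2on g ->
  ip (fun x => \sum_(i <- r) F i x) g = \sum_(i <- r) ip (F i) g.
Proof.
move=> h lg; rewrite /ip -Rint_sum; last by move=> i; exact: L2on_mul.
by apply: Rint_eq => x _; rewrite mulr_suml.
Qed.

Lemma ip_ge0 f : 0 <= ip f f.
Proof. by apply: Rintegral_ge0 => x _; rewrite -expr2 sqr_ge0. Qed.

Lemma ip_sq f : ip f f = \int[mu]_(x in D) (f x ^+ 2).
Proof. by apply: Rint_eq => x _; rewrite expr2. Qed.

Lemma ip_sqE f : L2on f -> (\int[mu]_(x in D) (f x ^+ 2)%:E)%E = (ip f f)%:E.
Proof.
move=> /L2onP[mf sf]; rewrite ip_sq /Rintegral fineK//.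
exact: (integrable_fin_num mD sf).
Qed.

Lemma ip_eq f g f' g' : (forall x, D x -> f x = f' x) -> (forall x, D x -> g x = g' x) ->
  ip f g = ip f' g'.
Proof. by move=> ff gg; apply: Rint_eq => x Dx; rewrite ff ?gg. Qed.

Lemma ip_CS f g : L2on f -> L2on g -> ip f g ^+ 2 <= ip f f * ip g g.
Proof.
move=> lf lg.
have H t : 0 <= ip f f - 2 * t * ip f g + t ^+ 2 * ip g g.
  rewrite (_ : _ + _ = ip (fun x => f x - t * g x) (fun x => f x - t * g x)); first exact: ip_ge0.
  have ltg := L2onZ t lg.
  by rewrite ipBl ?ipBr ?ipZl ?ipZr ?(ipC g f)//; [ring | exact: L2onB].
have [gg0|gg0] := eqVneq (ip g g) 0.
  have [->|fg] := eqVneq (ip f g) 0; first by rewrite gg0 expr0n mulr0.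
  (* When [ip g g = 0] the quadratic is affine in [t]; at this value of [t] it equals -1. *)
  have := H ((ip f f + 1) / (2 * ip f g)); rewrite gg0 mulr0 addr0.
  rewrite (_ : 2 * _ * _ = ip f f + 1); last by field.
  by have := ltr01 (R := R); lra.
have g0 : 0 < ip g g by rewrite lt_neqAle eq_sym gg0 ip_ge0.
have := H (ip f g / ip g g); rewrite -(pmulr_rge0 _ g0).
rewrite (_ : ip g g * _ = ip f f * ip g g - ip f g ^+ 2) ?subr_ge0//.
by field.
Qed.

Lemma ip_CS_abs f g : L2on f -> L2on g ->
  `|ip f g| <= Num.sqrt (ip f f) * Num.sqrt (ip g g).
Proof.
move=> lf lg; rewrite -sqrtrM ?ip_ge0// -sqrtr_sqr ler_sqrt ?ip_CS//.
by rewrite mulr_ge0 ?ip_ge0.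
Qed.

Lemma ip_eq0_ae f : L2on f -> ip f f = 0 -> {ae mu, forall x, D x -> f x = 0}.
Proof.
move=> lf f0; have [mf sf] := (L2onP f).1 lf.
have m2 : measurable_fun D (EFin \o (fun x => f x ^+ 2)).
  exact/measurable_EFinP/measurable_funX.
have [H _] := ae_eq_integral_abs mu mD m2; have {}H := H _.
apply: filterS (H _) => [x /= h Dx|].
  by have := h Dx => -[] /eqP; rewrite sqrf_eq0 => /eqP.
by under eq_integral do rewrite /= ger0_norm ?sqr_ge0//; rewrite ip_sqE// f0.
Qed.

Lemma ip_ae f f' g : measurable_fun D f -> measurable_fun D f' -> measurable_fun D g ->
  {ae mu, forall x, D x -> f x = f' x} -> ip f g = ip f' g.
Proof.
move=> mf mf' mg ff'; rewrite /ip /Rintegral; congr fine.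
apply: ae_eq_integral => //; try exact/measurable_EFinP/measurable_funM.
by move: ff'; apply: filterS => x /= h Dx; rewrite h.
Qed.

Lemma ip_cvgl (f_ : nat -> T -> R) f g : (forall n, L2on (f_ n)) -> L2on f -> L2on g ->
  ip (fun x => f_ n x - f x) (fun x => f_ n x - f x) @[n --> \oo] --> (0 : R) ->
  ip (f_ n) g @[n --> \oo] --> ip f g.
Proof.
move=> lf_ lf lg h; apply/subr_cvg0.
apply/norm_cvg0P.
have h' : Num.sqrt (ip (fun x => f_ n x - f x) (fun x => f_ n x - f x))
    * Num.sqrt (ip g g) @[n --> \oo] --> (0 : R).
  have h1 : Num.sqrt (ip (fun x => f_ n x - f x) (fun x => f_ n x - f x))
      @[n --> \oo] --> Num.sqrt (0 : R).
    by apply: continuous_cvg => //; exact: sqrt_continuous.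
  rewrite [X in _ --> X](_ : 0 = Num.sqrt 0 * Num.sqrt (ip g g)); last by rewrite sqrtr0 mul0r.
  by apply: cvgM h1 _; exact: cvg_cst.
apply: (squeeze_cvgr _ (cvg_cst 0) h'); near=> n; rewrite normr_ge0/=.
by rewrite -ipBl// ip_CS_abs//; exact: L2onB.
Unshelve. all: by end_near. Qed.

Lemma L1on_fin f : L1on f -> (\int[mu]_(x in D) (f x)%:E)%E = (\int[mu]_(x in D) f x)%:E.
Proof. by move=> lf; rewrite /Rintegral fineK//; exact: (integrable_fin_num mD lf). Qed.

(** Monotone convergence exchanges the sum and the integral. The majorant stays extended-real, since
    it may be infinite on a null set. *)
Lemma L1_series_majorant (f_ : nat -> T -> R) (M : R) : (forall n, L1on (f_ n)) ->
  (forall n, \sum_(i < n) \int[mu]_(x in D) `|f_ i x| <= M) ->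
  mu.-integrable D (fun x => \big[+%E/0%E]_(0 <= i <oo) `|f_ i x|%:E)%E.
Proof.
move=> lf h; apply/integrableP; split.
  apply: ge0_emeasurable_sum => // i _; apply/measurable_EFinP.
  by apply/measurableT_comp => //; exact: L1on_meas.
rewrite (eq_integral (fun x => \big[+%E/0%E]_(0 <= i <oo) `|f_ i x|%:E)%E); last first.
  by move=> x _; rewrite gee0_abs// nneseries_ge0.
rewrite integral_nneseries//; last first.
  by move=> n; apply/measurable_EFinP; apply/measurableT_comp => //; exact: L1on_meas.
apply: (@le_lt_trans _ _ M%:E); last exact: ltry.
apply: lime_le.
  by apply: is_cvg_nneseries => n _ _; apply: integral_ge0 => x _; rewrite lee_fin.
apply: nearW => n; rewrite big_mkord.
rewrite (eq_bigr (fun i : 'I_n => (\int[mu]_(x in D) `|f_ i x|)%:E)); last first.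
  by move=> i _; rewrite L1on_fin//; exact: L1on_norm.
by rewrite sumEFin lee_fin; exact: h.
Qed.

Lemma nneseries_real_cvg (u : nat -> R) : (forall n, 0 <= u n) ->
  ((\big[+%E/0%E]_(0 <= i <oo) (u i)%:E)%E \is a fin_num) -> cvgn (series u).
Proof.
move=> u0 ufin; apply: nondecreasing_is_cvgn.
  by apply/nondecreasing_seqP => n; rewrite /series /= big_nat_recr//= lerDl.
exists (fine (\big[+%E/0%E]_(0 <= i <oo) (u i)%:E)%E) => _ [n _ <-].
rewrite -lee_fin fineK// /series /= -sumEFin.
by apply: nneseries_lim_ge => i _ _; rewrite lee_fin.
Qed.

(** Dominated convergence under the majorant of absolute values. It justifies reading the Fourier
    coefficients of the separated series term by term. *)
Lemma L1_series (f_ : nat -> T -> R) (F : T -> R) (M : R) : (forall n, L1on (f_ n)) ->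
  (forall n, \sum_(i < n) \int[mu]_(x in D) `|f_ i x| <= M) ->
  (forall x, D x -> series (f_ ^~ x) @ \oo --> F x) ->
  L1on F /\ forall g, measurable_fun D g -> bounded_on g ->
    series (fun n => \int[mu]_(x in D) (f_ n x * g x)) @ \oo --> \int[mu]_(x in D) (F x * g x).
Proof.
move=> lf hM hF; have iG := L1_series_majorant lf hM.
have ms n : measurable_fun D (fun x => series (f_ ^~ x) n).
  rewrite /series /=; apply: measurable_sum => i; exact: L1on_meas.
have mF : measurable_fun D F by apply: (measurable_fun_cvg ms).
have leG x n : (`|(series (f_ ^~ x) n)%:E| <= \big[+%E/0%E]_(0 <= i <oo) `|f_ i x|%:E)%E.
  apply: (@le_trans _ _ (\sum_(0 <= i < n) `|f_ i x|%:E)%E).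
    by rewrite /series /= sumEFin lee_fin ler_norm_sum.
  exact: nneseries_lim_ge.
have [] := @dominated_convergence _ _ _ mu D mD (fun n x => (series (f_ ^~ x) n)%:E)
  (EFin \o F) (fun x => \big[+%E/0%E]_(0 <= i <oo) `|f_ i x|%:E)%E.
- by move=> n; exact/measurable_EFinP.
- exact/measurable_EFinP.
- by apply: aeW => x Dx; apply: cvg_EFin; [exact: nearW|exact: hF].
- exact: iG.
- by apply: aeW => x n _; exact: leG.
move=> lF _ _; split=> // g mg bg; have [B gB] := bg.
have B0 x : D x -> 0 <= B by move=> Dx; exact: le_trans (gB x Dx).
pose G x := (B%:E * \big[+%E/0%E]_(0 <= i <oo) `|f_ i x|%:E)%E.
have [] := @dominated_convergence _ _ _ mu D mD (fun n x => (series (f_ ^~ x) n * g x)%:E)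
  (fun x => (F x * g x)%:E) G.
- by move=> n; apply/measurable_EFinP/measurable_funM.
- exact/measurable_EFinP/measurable_funM.
- apply: aeW => x Dx; apply: cvg_EFin; first exact: nearW.
  by apply: cvgM; [exact: hF|exact: cvg_cst].
- exact: integrableZl.
- apply: aeW => x n Dx; rewrite EFinM abseM muleC; apply: lee_pmul => //.
  by rewrite lee_fin gB.
move=> lFg _; rewrite (L1on_fin lFg).
move=> /fine_cvgP[_]; apply: cvg_trans; apply: near_eq_cvg; apply: nearW => n.
rewrite /= /series /=; under eq_integral do rewrite mulr_suml.
by rewrite -[LHS]/(Rintegral _ _ _) Rint_sum// => i; exact: L1onM.
Qed.

(** Integrates [|f| <= f^2 / e + e]. The free parameter turns a bound [4^-k] on square norms into
    one of order [2^-k] on [L1] norms. *)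
Lemma L1_of_L2 f (e : R) : L2on f -> 0 < e ->
  \int[mu]_(x in D) `|f x| <= e^-1 * ip f f + e * fine (mu D).
Proof.
move=> lf e0; have [mf sf] := (L2onP f).1 lf.
rewrite ip_sq -RintegralZl// -Rintegral_cst// -RintegralD//; last 2 first.
  exact: L1onZ.
  exact: L1on_cst.
apply: le_Rintegral => //.
- exact/L1on_norm/L2on_L1.
- by apply: L1onD; [exact: L1onZ|exact: L1on_cst].
move=> x _; rewrite -(real_normK (num_real (f x))); set a := `|f x|.
rewrite -subr_ge0 (_ : _ - a = e^-1 * ((a - e / 2) ^+ 2 + (3 / 4) * e ^+ 2)).
  by rewrite mulr_ge0 ?invr_ge0 ?(ltW e0)// addr_ge0 ?sqr_ge0// mulr_ge0 ?sqr_ge0//; lra.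
by field; rewrite gt_eqF.
Qed.

(** A rapidly converging subsequence converges almost everywhere, and Fatou's lemma controls the
    distance to its limit. *)
Lemma Riesz_Fischer (f_ : nat -> T -> R) : (forall n, L2on (f_ n)) ->
  (forall e, 0 < e -> exists N, forall n m, (N <= n)%N -> (N <= m)%N ->
     ip (fun x => f_ n x - f_ m x) (fun x => f_ n x - f_ m x) <= e) ->
  exists2 f, L2on f &
    ip (fun x => f_ n x - f x) (fun x => f_ n x - f x) @[n --> \oo] --> (0 : R).
Proof.
move=> lf hC.
have /choice[N HN] (k : nat) : exists N, forall n m, (N <= n)%N -> (N <= m)%N ->
    ip (fun x => f_ n x - f_ m x) (fun x => f_ n x - f_ m x) <= (4^-1 ^+ k : R).
  by apply: hC; rewrite exprn_gt0.
(* Strictly increasing and above [N], so that consecutive terms of the subsequence differ by at most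
   [4^-k] in square norm. *)
pose phi := fix phi k := if k is k'.+1 then maxn (phi k').+1 (N k) else N 0%N.
have phiN k : (N k <= phi k)%N by case: k => //= k; rewrite leq_maxr.
have phiS k : (phi k < phi k.+1)%N by rewrite /= leq_maxl.
have phik k : (k <= phi k)%N by elim: k => // k IH; exact: leq_ltn_trans IH (phiS k).
pose dl k x := f_ (phi k.+1) x - f_ (phi k) x.
have ldl k : L2on (dl k) by exact: L2onB.
have dlb k : \int[mu]_(x in D) `|dl k x| <= (1 + fine (mu D)) * 2^-1 ^+ k.
  apply: (le_trans (@L1_of_L2 _ (2^-1 ^+ k) (ldl k) _)); first by rewrite exprn_gt0.
  rewrite mulrDl mul1r [X in _ <= _ + X]mulrC lerD2r ler_pdivrMl ?exprn_gt0//.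
  rewrite -exprMn (_ : 2^-1 * 2^-1 = 4^-1 :> R); last by field.
  by apply: HN; [exact: leq_trans (phiN k) (ltnW (phiS k))|exact: phiN].
have M0 : 0 <= 1 + fine (mu D) by rewrite addr_ge0// fine_ge0.
have sumdl n : \sum_(i < n) \int[mu]_(x in D) `|dl i x| <= (1 + fine (mu D)) * 2.
  apply: (@le_trans _ _ (\sum_(i < n) (1 + fine (mu D)) * 2^-1 ^+ i)).
    by apply: ler_sum => i _; exact: dlb.
  rewrite -(big_mkord xpredT (fun i => (1 + fine (mu D)) * 2^-1 ^+ i)).
  have := @geometric_le_lim R n (1 + fine (mu D)) 2^-1 M0.
  rewrite (_ : 1 - 2^-1 = 2^-1 :> R) ?invrK; last by field.
  by apply; rewrite ?ger0_norm ?invr_ge0 ?invr_gt0 ?invf_lt1 ?ltr1n.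
have iG := L1_series_majorant (fun k => L2on_L1 (ldl k)) sumdl.
set G := (fun x => _) in iG.
have mG : measurable_fun D G := measurable_int _ iG.
(* Off this set of full measure the terms are replaced by 0, which gives a limit at every point and
   hence a measurable one. *)
pose E := D `&` G @^-1` [set x | x \is a fin_num].
have mE : measurable E := emeasurable_fin_num mD mG.
pose g_ k x := f_ (phi k) x * \1_E x.
have mg k : measurable_fun D (g_ k).
  by apply: measurable_funM; [exact: (lf _).1|exact: measurable_indic].
have cg x : D x -> cvgn (g_ ^~ x).
  move=> Dx; rewrite /g_; have [xE|xE] := boolP (x \in E); last first.
    by rewrite indicE (negbTE xE); under eq_fun do rewrite mulr0; exact: is_cvg_cst.
  rewrite indicE xE; under eq_fun do rewrite mulr1.
  have -> : (fun k => f_ (phi k) x) = (fun k => f_ (phi 0%N) x + series (dl ^~ x) k).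
    apply/funext => k; rewrite /series /= /dl telescope_sumr//; ring.
  apply: is_cvgD; first exact: is_cvg_cst.
  apply: normed_cvg; apply: nneseries_real_cvg => [k|]; first exact: normr_ge0.
  by case: (set_mem xE).
pose F x := limn (g_ ^~ x).
have gF x : D x -> g_ ^~ x @ \oo --> F x by move=> /cg.
have mF : measurable_fun D F by exact: (measurable_fun_cvg mg).
have aeE : {ae mu, forall x, D x -> E x}.
  by have := integrable_ae mD iG; apply: filterS => x /= h Dx; split=> //; exact: h.
(* Fatou's lemma in the second index of the Cauchy condition, along the subsequence. *)
have key n e : (forall m, (n <= m)%N ->
    ip (fun x => f_ n x - f_ m x) (fun x => f_ n x - f_ m x) <= e) ->
  (\int[mu]_(x in D) ((f_ n x - F x) ^+ 2)%:E <= e%:E)%E.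
  move=> hn.
  pose h k x := ((f_ n x - g_ k x) ^+ 2)%:E.
  have mh k : measurable_fun D (h k).
    apply/measurable_EFinP/measurable_funX/measurable_funB => //; exact: (lf _).1.
  have := @fatou _ _ _ mu D mD h mh (fun k x _ => ltac:(by rewrite lee_fin sqr_ge0)).
  have -> : (\int[mu]_(x in D) limn_einf (h^~ x))%E =
     (\int[mu]_(x in D) ((f_ n x - F x) ^+ 2)%:E)%E.
    apply: eq_integral => x /set_mem Dx.
    suff hc : h^~ x @ \oo --> ((f_ n x - F x) ^+ 2)%:E by rewrite (cvg_limn_einf_sup hc).1.
    apply: cvg_EFin; first exact: nearW.
    have c1 : (fun k => f_ n x - g_ k x) @ \oo --> f_ n x - F x.
      by apply: cvgB; [exact: cvg_cst|exact: gF].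
    rewrite expr2 (_ : fine \o h^~ x = (fun k => (f_ n x - g_ k x) * (f_ n x - g_ k x))).
      exact: cvgM.
    by apply/funext => k; rewrite /h /= expr2.
  move=> /le_trans; apply.
  have -> : (fun k => \int[mu]_(x in D) h k x)%E = (fun k =>
     (ip (fun x => f_ n x - f_ (phi k) x) (fun x => f_ n x - f_ (phi k) x))%:E).
    apply/funext => k; rewrite -ip_sqE; last exact: L2onB.
    apply: ae_eq_integral => //.
      apply/measurable_EFinP/measurable_funX/measurable_funB; exact: (lf _).1.
    move: aeE; apply: filterS => x /= hE Dx; rewrite /h /g_ indicE mem_set ?mulr1//.
    exact: hE.
  apply: (le_trans (limn_einf_sup _)); rewrite limn_esup_lim.
  apply: lime_le; first exact: is_cvg_esups.
  near=> k; apply: ub_ereal_sup => _ [j /= kj <-]; rewrite lee_fin; apply: hn.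
  apply: leq_trans (phik j); apply: leq_trans kj; near: k; exact: nbhs_infty_ge.
have lF : L2on F.
  have [N1 hN1] := hC 1 ltr01.
  have h1 := key N1 1 (fun m hm => hN1 _ _ (leqnn _) hm).
  have l1 : L2on (fun x => f_ N1 x - F x).
    split; first by apply: measurable_funB => //; exact: (lf _).1.
    by apply: le_lt_trans h1 _; exact: ltry.
  have -> : F = (fun x => f_ N1 x - (f_ N1 x - F x)) by apply/funext => x; ring.
  exact: L2onB.
exists F => //; apply/cvgrPdist_le => e e0.
have [N1 hN1] := hC e e0; near=> n.
rewrite sub0r normrN ger0_norm ?ip_ge0// -lee_fin -ip_sqE; last exact: L2onB.
apply: key => m hm; apply: hN1; last apply: leq_trans hm.
  by near: n; exact: nbhs_infty_ge.
by near: n; exact: nbhs_infty_ge.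
Unshelve. all: by end_near. Qed.

(** * Orthonormal systems: Bessel's inequality, convergence of projections, Parseval's identity *)

Section orthonormal.
Variable e_ : nat -> T -> R.
Hypothesis le_ : forall n, L2on (e_ n).
Hypothesis orth : forall i j, i != j -> ip (e_ i) (e_ j) = 0.
(* Zero vectors are allowed because [sn 0 = 0]. *)
Hypothesis unit : forall i, ip (e_ i) (e_ i) = 1 \/ ip (e_ i) (e_ i) = 0.

Definition proj f n x := \sum_(i < n) ip f (e_ i) * e_ i x.

Lemma L2on_proj f n : L2on (proj f n).
Proof. by apply: L2on_sum => i; exact: L2onZ. Qed.

Lemma coef_unit f i : L2on f -> ip f (e_ i) * ip (e_ i) (e_ i) = ip f (e_ i).
Proof.
move=> lf; case: (unit i) => h; rewrite h ?mulr1// mulr0.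
have := ip_CS lf (le_ i); rewrite h mulr0 => h2; apply/esym/eqP.
by rewrite -sqrf_eq0 eq_le h2 sqr_ge0.
Qed.

Lemma ip_proj f n i : L2on f -> (i < n)%N -> ip (proj f n) (e_ i) = ip f (e_ i).
Proof.
move=> lf ilen; rewrite /proj ip_suml//; last by move=> j; exact: L2onZ.
rewrite (bigD1 (Ordinal ilen))//= big1 ?addr0; last first.
  by move=> j ji; rewrite ipZl// orth ?mulr0.
by rewrite ipZl// coef_unit.
Qed.

Lemma ip_projr f g n : L2on f -> L2on g ->
  ip (proj f n) g = \sum_(i < n) ip f (e_ i) * ip g (e_ i).
Proof.
move=> lf lg; rewrite /proj ip_suml//; last by move=> j; exact: L2onZ.
by apply: eq_bigr => i _; rewrite ipZl// (ipC g).
Qed.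

Lemma ip_proj_proj f n m : L2on f -> (n <= m)%N ->
  ip (proj f m) (proj f n) = \sum_(i < n) ip f (e_ i) ^+ 2.
Proof.
move=> lf nm; rewrite ipC ip_projr//; last exact: L2on_proj.
by apply: eq_bigr => i _; rewrite ip_proj// ?expr2// (leq_trans _ nm).
Qed.

Lemma bessel f n : L2on f -> \sum_(i < n) ip f (e_ i) ^+ 2 <= ip f f.
Proof.
move=> lf; rewrite -subr_ge0; have lp := L2on_proj f n.
have <- : ip (fun x => f x - proj f n x) (fun x => f x - proj f n x) =
   ip f f - \sum_(i < n) ip f (e_ i) ^+ 2.
  rewrite ipBl ?ipBr//; last exact: L2onB.
  rewrite ip_proj_proj// (ipC f (proj f n)) ip_projr//.
  rewrite (eq_bigr (fun i : 'I_n => ip f (e_ i) ^+ 2)) => [|i _]; last by rewrite expr2.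
  by ring.
exact: ip_ge0.
Qed.

(* Completeness is only required relative to [f], so that an even [f] can be expanded in the
   profiles [phiv], which do not span the odd functions. *)
Lemma proj_cvg f : L2on f ->
  (forall g, L2on g -> (forall i, ip g (e_ i) = 0) -> ip g f = 0) ->
  ip (fun x => proj f n x - f x) (fun x => proj f n x - f x) @[n --> \oo] --> (0 : R).
Proof.
move=> lf hf.
pose s n := \sum_(i < n) ip f (e_ i) ^+ 2.
have snd : {homo s : n m / (n <= m)%N >-> n <= m}.
  by apply/nondecreasing_seqP => n; rewrite /s big_ord_recr /= lerDl sqr_ge0.
have scvg : cvgn s.
  apply: nondecreasing_is_cvgn => //; exists (ip f f) => _ [n _ <-]; exact: bessel.
have pp n m : (n <= m)%N -> ip (fun x => proj f n x - proj f m x)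
    (fun x => proj f n x - proj f m x) = s m - s n.
  move=> nm; have ln := L2on_proj f n; have lm := L2on_proj f m.
  rewrite ipBl ?ipBr//; last exact: L2onB.
  rewrite (ipC (proj f n) (proj f m)) !ip_proj_proj// -/(s n) -/(s m); ring.
have [] := @Riesz_Fischer (proj f) (fun n => L2on_proj f n).
  move=> e e0; have /cvgrPdist_le/(_ e e0)[N _ hN] := scvg.
  exists N; suff H n m : (N <= n)%N -> (n <= m)%N ->
      ip (fun x => proj f n x - proj f m x) (fun x => proj f n x - proj f m x) <= e.
    move=> n m Nn Nm; have [nm|/ltnW mn] := leqP n m; first exact: H.
    rewrite (@ip_eq _ _ (fun x => - (proj f m x - proj f n x))
       (fun x => - (proj f m x - proj f n x))); [|by move=> x _; ring|by move=> x _; ring].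
    have ld := L2onB (L2on_proj f m) (L2on_proj f n).
    rewrite ipNl//; last exact: L2onN.
    by rewrite ipC ipNl// opprK H.
  move=> Nn nm; rewrite pp//; apply: le_trans (hN n Nn).
  apply: le_trans (ler_norm _); rewrite lerD2r; exact: nondecreasing_cvgn_le.
move=> g lg pg.
(* The residual [f - g] is orthogonal to every [e_ i], hence to [f] by the completeness hypothesis
   and to [g], a limit of combinations of the [e_ i]. So it vanishes almost everywhere. *)
have ge i : ip (fun x => f x - g x) (e_ i) = 0.
  rewrite ipBl//; apply/eqP; rewrite subr_eq0; apply/eqP.
  have := ip_cvgl (fun n => L2on_proj f n) lg (le_ i) pg.
  apply: cvg_unique => //; apply: cvg_near_cst; near=> n; rewrite ip_proj//.
  by near: n; exact: nbhs_infty_gt.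
have lfg := L2onB lf lg.
have fgf := hf _ lfg ge.
have fgg : ip (fun x => f x - g x) g = 0.
  have := ip_cvgl (fun n => L2on_proj f n) lg lfg pg.
  rewrite (ipC g) => h; apply: cvg_unique h _ => //.
  apply: cvg_near_cst; apply: nearW => n; rewrite ip_projr// big1// => i _.
  by rewrite ge mulr0.
have fg0 : ip (fun x => f x - g x) (fun x => f x - g x) = 0 by rewrite ipBr// fgf fgg subrr.
have fgae := ip_eq0_ae lfg fg0.
suff -> : (fun n => ip (fun x => proj f n x - f x) (fun x => proj f n x - f x)) =
  (fun n => ip (fun x => proj f n x - g x) (fun x => proj f n x - g x)) by [].
apply/funext => n; have lp := L2on_proj f n.
have m1 := (L2onB lp lf).1; have m2 := (L2onB lp lg).1.
have ae1 : {ae mu, forall x, D x -> proj f n x - f x = proj f n x - g x}.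
  move: fgae; apply: filterS => x /= h Dx; have := h Dx => /eqP; rewrite subr_eq0.
  by move=> /eqP ->.
rewrite (ip_ae m1 m2 m1 ae1) ipC; exact: ip_ae.
Unshelve. all: by end_near. Qed.

Lemma parseval f g : L2on f -> L2on g ->
  (forall g, L2on g -> (forall i, ip g (e_ i) = 0) -> ip g f = 0) ->
  series (fun i => ip f (e_ i) * ip g (e_ i)) @ \oo --> ip f g.
Proof.
move=> lf lg hf; have := ip_cvgl (fun n => L2on_proj f n) lf lg (proj_cvg lf hf).
apply: cvg_trans; apply: near_eq_cvg; apply: nearW => n.
by rewrite ip_projr// /series /= big_mkord.
Qed.

End orthonormal.
End L2theory.

(** * Sines and cosines on [-1, 1] *)

Section Trig.
Variable R : realType.
Local Notation mu := (@lebesgue_measure R).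
Local Notation J := (`[-1, 1]%classic : set (measurableTypeR R)).
Implicit Types (a b c t x : R) (l : nat).

Lemma is_derive_sin_affine a c x :
  is_derive x 1 (fun t => sin (a * t + c)) (a * cos (a * x + c)).
Proof. by apply: is_derive_eq; rewrite /GRing.scale /=; ring. Qed.

Lemma is_derive_cos_affine a c x :
  is_derive x 1 (fun t => cos (a * t + c)) (- a * sin (a * x + c)).
Proof. by apply: is_derive_eq; rewrite /GRing.scale /=; ring. Qed.

Lemma is_derive_exp_affine a c x :
  is_derive x 1 (fun t => expR (a * t + c)) (a * expR (a * x + c)).
Proof. by apply: is_derive_eq; rewrite /GRing.scale /=; ring. Qed.

Lemma is_derive_continuous (F f : R -> R) : (forall x, is_derive x 1 F (f x)) ->
  continuous F.
Proof. by move=> h x; apply: differentiable_continuous; apply/derivable1_diffP; case: (h x). Qed.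

Lemma FTC_itv (F f : R -> R) a c : (forall x, is_derive x 1 F (f x)) -> continuous f ->
  a <= c -> \int[mu]_(x in `[a, c]) f x = F c - F a.
Proof.
move=> dF cf; rewrite le_eqVlt => /orP[/eqP->|ac].
  by rewrite set_itv1 Rintegral_set1 subrr.
have cF := is_derive_continuous dF.
have := @continuous_FTC2 R f F a c ac (continuous_subspaceT cf).
rewrite /Rintegral => -> //.
- split; first by move=> x _; case: (dF x).
  + by apply: cvg_at_right_filter; exact: cF.
  + by apply: cvg_at_left_filter; exact: cF.
- by move=> x _; rewrite derive1E; case: (dF x).
Qed.

Lemma FTC_J (F f : R -> R) : (forall x, is_derive x 1 F (f x)) -> continuous f ->
  \int[mu]_(x in J) f x = F 1 - F (-1).
Proof. by move=> dF cf; apply: FTC_itv => //; lra. Qed.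

Lemma mJ : measurable J. Proof. exact: measurable_itv. Qed.
Lemma muJ : mu J = 2%:E.
Proof.
rewrite lebesgue_measure_itv /= lte_fin.
have -> : (-1 : R) < 1 by lra.
by rewrite -EFinD; congr (_%:E); ring.
Qed.
Lemma muJ_lty : (mu J < +oo)%E. Proof. by rewrite muJ ltry. Qed.
Hint Resolve mJ muJ_lty : core.

Lemma intJ_eq (f g : R -> R) : (forall x : R, J x -> f x = g x) ->
  \int[mu]_(x in J) f x = \int[mu]_(x in J) g x.
Proof. by move=> h; apply: eq_Rintegral => x /set_mem; exact: h. Qed.

Lemma ipJ_eq (f g f' g' : R -> R) : (forall x : R, J x -> f x = f' x) ->
  (forall x : R, J x -> g x = g' x) -> ip mu J f g = ip mu J f' g'.
Proof. by move=> hf hg; apply: intJ_eq => x Jx; rewrite hf ?hg. Qed.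

Lemma within_cont_L1 (f : R -> R) : {within J, continuous f} -> L1on mu J f.
Proof. by move=> cf; apply: continuous_compact_integrable => //; exact: segment_compact. Qed.

Lemma within_cont_bounded (f : R -> R) : {within J, continuous f} -> bounded_on J f.
Proof.
move=> cf; have le11 : (-1 : R) <= 1 by lra.
have [c _ hc] := EVT_max le11 cf.
have cNf : {within J, continuous (fun x => - f x)}.
  by move=> x; apply: cvgN; exact: cf.
have [d _ hd] := EVT_max le11 cNf.
exists (`|f c| + `|f d|) => x Jx; have := hc x Jx; have := hd x Jx.
have := ler_norm (f c); have := ler_norm (- f d); rewrite normrN.
have := normr_ge0 (f c); have := normr_ge0 (f d).
by rewrite ler_norml => *; apply/andP; split; lra.
Qed.

Lemma cont_L1 (f : R -> R) : continuous f -> L1on mu J f.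
Proof. by move=> cf; apply: within_cont_L1; exact: continuous_subspaceT. Qed.

Lemma cont_meas (f : R -> R) (D : set (measurableTypeR R)) : continuous f -> measurable_fun D f.
Proof.
move=> cf; apply: (@measurable_funS _ _ _ _ setT) => //.
exact: continuous_measurable_fun.
Qed.

Lemma cont_bounded (f : R -> R) : continuous f -> bounded_on J f.
Proof. by move=> cf; apply: within_cont_bounded; exact: continuous_subspaceT. Qed.

Lemma cont_L2 (f : R -> R) : continuous f -> L2on mu J f.
Proof. by move=> cf; apply: L2on_bounded => //; [exact: cont_meas|exact: cont_bounded]. Qed.

Lemma contM (f g : R -> R) : continuous f -> continuous g -> continuous (fun x => f x * g x).
Proof. by move=> cf cg x; apply: cvgM; [exact: cf|exact: cg]. Qed.

Lemma contX (f : R -> R) n : continuous f -> continuous (fun x => f x ^+ n).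
Proof.
move=> cf; elim: n => [|n IH] x; first by under eq_fun do rewrite expr0; exact: cvg_cst.
by under eq_fun do rewrite exprS; apply: cvgM; [exact: cf|exact: IH].
Qed.

(** Lagrange's identity: the Wronskian of solutions of [u'' = p u] and [v'' = q v] has derivative
    [(p - q) u v]. It is left undivided because [p = q] may occur. *)
Lemma int_green (u u1 v v1 : R -> R) (p q : R) :
  (forall x, is_derive x 1 u (u1 x)) -> (forall x, is_derive x 1 u1 (p * u x)) ->
  (forall x, is_derive x 1 v (v1 x)) -> (forall x, is_derive x 1 v1 (q * v x)) ->
  (p - q) * ip mu J u v = (u1 1 * v 1 - u 1 * v1 1) - (u1 (-1) * v (-1) - u (-1) * v1 (-1)).
Proof.
move=> du du1 dv dv1.
have cu := is_derive_continuous du; have cv := is_derive_continuous dv.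
rewrite /ip -RintegralZl//; last by apply: cont_L1; exact: contM.
have D x : is_derive x 1 (fun x => u1 x * v x - u x * v1 x) ((p - q) * (u x * v x)).
  have ? := du x; have ? := du1 x; have ? := dv x; have ? := dv1 x.
  by apply: is_derive_eq; rewrite /GRing.scale /=; ring.
by rewrite (FTC_J D)// => x; apply: cvgM; [exact: cvg_cst|exact: contM].
Qed.

(** Replaces [int_green] in the degenerate case [p = q], through the first integral
    [u'^2 - p u^2 = E]. *)
Lemma int_square (u u1 : R -> R) (p E : R) :
  (forall x, is_derive x 1 u (u1 x)) -> (forall x, is_derive x 1 u1 (p * u x)) ->
  (forall x, u1 x ^+ 2 - p * u x ^+ 2 = E) ->
  2 * p * ip mu J u u = u1 1 * u 1 - u1 (-1) * u (-1) - 2 * E.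
Proof.
move=> du du1 hE.
have cu := is_derive_continuous du.
rewrite /ip -RintegralZl//; last by apply: cont_L1; exact: contM.
have D x : is_derive x 1 (fun x => u1 x * u x - E * x) (2 * p * (u x * u x)).
  have ? := du x; have ? := du1 x.
  by apply: is_derive_eq; rewrite /GRing.scale /= -(hE x); ring.
rewrite (FTC_J D); first by ring.
by move=> x; apply: cvgM; [exact: cvg_cst|exact: contM].
Qed.

(** The functions [sn l] and [cn l] are the Dirichlet and Neumann eigenfunctions of the interval;
    the shift of the phase puts the left end at phase 0, so both parities are treated at once. *)
Definition fr l : R := l%:R * (pi / 2).
Definition sn l t : R := sin (fr l * t + fr l).
Definition cn l t : R := cos (fr l * t + fr l).

Lemma fr0 : fr 0 = 0. Proof. by rewrite /fr mul0r. Qed.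
Lemma fr_ge0 l : 0 <= fr l. Proof. by rewrite mulr_ge0// divr_ge0// pi_ge0. Qed.
Lemma fr_gt0 l : (0 < l)%N -> 0 < fr l.
Proof. by move=> l0; rewrite mulr_gt0 ?ltr0n// divr_gt0// pi_gt0. Qed.
Lemma fr_inj : injective fr.
Proof.
move=> k l /(mulIf _) h; apply/eqP; rewrite -(eqr_nat R); apply/eqP; apply: h.
by rewrite gt_eqF// divr_gt0// pi_gt0.
Qed.
Lemma fr_ge l : l%:R <= fr l.
Proof. by rewrite -{1}(mulr1 l%:R) ler_wpM2l//; exact: pihalf_ge1. Qed.

Lemma sn0 t : sn 0 t = 0. Proof. by rewrite /sn fr0 mul0r addr0 sin0. Qed.
Lemma cn0 t : cn 0 t = 1. Proof. by rewrite /cn fr0 mul0r addr0 cos0. Qed.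
Lemma snN1 l : sn l (-1) = 0. Proof. by rewrite /sn mulrN1 addNr sin0. Qed.
Lemma cnN1 l : cn l (-1) = 1. Proof. by rewrite /cn mulrN1 addNr cos0. Qed.
Lemma sn_cn1 l : sn l 1 = 0 /\ cn l 1 = (-1) ^+ l.
Proof.
rewrite /sn /cn mulr1.
have -> : fr l + fr l = l%:R * pi by rewrite /fr; field.
elim: l => [|l [IHs IHc]]; first by rewrite mul0r sin0 cos0.
by rewrite -natr1 mulrDl mul1r sinDpi cosDpi IHs IHc oppr0 exprS mulN1r.
Qed.
Lemma sn1 l : sn l 1 = 0. Proof. by case: (sn_cn1 l). Qed.
Lemma cn1 l : cn l 1 = (-1) ^+ l. Proof. by case: (sn_cn1 l). Qed.

Lemma is_derive_sn l x : is_derive x 1 (sn l) (fr l * cn l x).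
Proof. exact: is_derive_sin_affine. Qed.
Lemma is_derive_cn l x : is_derive x 1 (cn l) (- fr l * sn l x).
Proof. exact: is_derive_cos_affine. Qed.
Lemma is_derive_sn2 l x : is_derive x 1 (fun x => fr l * cn l x) (- fr l ^+ 2 * sn l x).
Proof.
have ? := is_derive_cn l x.
by apply: is_derive_eq; rewrite /GRing.scale /=; ring.
Qed.
Lemma is_derive_cn2 l x : is_derive x 1 (fun x => - fr l * sn l x) (- fr l ^+ 2 * cn l x).
Proof.
have ? := is_derive_sn l x.
by apply: is_derive_eq; rewrite /GRing.scale /=; ring.
Qed.
Lemma sn_cont l : continuous (sn l). Proof. exact: is_derive_continuous (is_derive_sn l). Qed.
Lemma cn_cont l : continuous (cn l). Proof. exact: is_derive_continuous (is_derive_cn l). Qed.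
Lemma sn_le1 l t : `|sn l t| <= 1.
Proof. by rewrite ler_norml sin_geN1 sin_le1. Qed.
Lemma cn_le1 l t : `|cn l t| <= 1.
Proof. by rewrite ler_norml cos_geN1 cos_le1. Qed.

Lemma ip_sn k l : ip mu J (sn k) (sn l) = (if (k == l) && (0 < l)%N then 1 else 0).
Proof.
have [->|kl] := eqVneq k l; last first.
  have := int_green (is_derive_sn k) (is_derive_sn2 k) (is_derive_sn l) (is_derive_sn2 l).
  rewrite !snN1 !sn1 !(mulr0, mul0r) !subr0 => /eqP; rewrite mulf_eq0 => /orP[|/eqP//].
  rewrite opprK addrC subr_eq0 eqf_sqr => /orP[/eqP/fr_inj|].
    by move=> lk; rewrite lk eqxx in kl.
  have := fr_ge0 k; have := fr_ge0 l => h1 h2 /eqP h3.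
  have : fr k = fr l by lra.
  by move/fr_inj => kl'; rewrite kl' eqxx in kl.
case: l => [|l] /=.
  by rewrite /ip (@intJ_eq _ (fun=> 0)) ?Rintegral_cst ?mul0r// => x _; rewrite sn0 mul0r.
have f0 : fr l.+1 != 0 by rewrite gt_eqF// fr_gt0.
have := @int_square (sn l.+1) _ _ (fr l.+1 ^+ 2) (is_derive_sn _) (is_derive_sn2 _) _.
rewrite snN1 sn1 !mulr0 subr0 sub0r => h.
have {}h := h (fun x => _); apply: (@mulfI _ (2 * - fr l.+1 ^+ 2)).
  by rewrite mulrN oppr_eq0 mulf_neq0// expf_neq0.
rewrite h; first by ring.
move=> x; rewrite /sn /cn exprMn mulNr opprK -mulrDr cos2Dsin2 mulr1//.
Qed.

(** Only the constant [cn 0] has square norm 2; the other cosines are already normalised. *)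
Definition nrm l : R := if l == 0%N then (Num.sqrt 2)^-1 else 1.
Definition cnn l t : R := nrm l * cn l t.

Lemma ip_cn k l : ip mu J (cnn k) (cnn l) = (k == l)%:R.
Proof.
rewrite /cnn ipZl ?ipZr//; try (by apply: cont_L2; exact: cn_cont);
  last by apply: L2onZ => //; apply: cont_L2; exact: cn_cont.
have [->|kl] := eqVneq k l; last first.
  suff -> : ip mu J (cn k) (cn l) = 0 by rewrite !mulr0.
  have := int_green (is_derive_cn k) (is_derive_cn2 k) (is_derive_cn l) (is_derive_cn2 l).
  rewrite !snN1 !sn1 !(mulr0, mul0r) !subr0 => /eqP; rewrite mulf_eq0 => /orP[|/eqP//].
  rewrite opprK addrC subr_eq0 eqf_sqr => /orP[/eqP/fr_inj|].
    by move=> lk; rewrite lk eqxx in kl.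
  have := fr_ge0 k; have := fr_ge0 l => h1 h2 /eqP h3.
  have : fr k = fr l by lra.
  by move/fr_inj => kl'; rewrite kl' eqxx in kl.
case: l => [|l]; rewrite /nrm /=.
  rewrite /ip (@intJ_eq _ (fun=> 1)); last by move=> x _; rewrite cn0 mul1r.
  rewrite Rintegral_cst// [X in fine X]muJ mul1r mulrA -invfM -expr2 sqr_sqrtr//=.
  by rewrite mulVf.
rewrite !mul1r.
have f0 : fr l.+1 != 0 by rewrite gt_eqF// fr_gt0.
have := @int_square (cn l.+1) _ _ (fr l.+1 ^+ 2) (is_derive_cn _) (is_derive_cn2 _) _.
rewrite snN1 sn1 !mulr0 !mul0r subr0 sub0r => h.
have {}h := h (fun x => _); apply: (@mulfI _ (2 * - fr l.+1 ^+ 2)).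
  by rewrite mulrN oppr_eq0 mulf_neq0// expf_neq0.
rewrite h; first by ring.
move=> x; rewrite /sn /cn mulNr sqrrN exprMn mulNr opprK -mulrDr addrC cos2Dsin2 mulr1//.
Qed.

(** * Primitives, and completeness of the cosines and of the sines *)

Definition prim (f : R -> R) x : R := \int[mu]_(t in `[-1, x]) f t.

Lemma prim_cont f : L1on mu J f -> {within J, continuous (prim f)}.
Proof.
by move=> lf; apply: parameterized_integral_continuous => //; lra.
Qed.

Lemma ae_neq c : {ae mu, forall x, x <> c}.
Proof.
exists [set c]; split; [exact: measurable_set1|exact: lebesgue_measure_set1|].
by move=> x /= /contrapT.
Qed.

(** Lebesgue's differentiation theorem for the extension of [f] by zero; the two endpoints are
    discarded as null. *)
Lemma prim_cst_ae f c : L1on mu J f -> (forall x, -1 < x < 1 -> prim f x = c) ->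
  {ae mu, forall x, J x -> f x = 0}.
Proof.
move=> lf hc; pose fJ := f \_ J.
have lfJ : mu.-integrable setT (EFin \o fJ).
  by rewrite /fJ -restrict_EFin; apply/(integrable_mkcond _ mJ).1.
have := @FTC1 R fJ (BLeft (-1)).
have iy y : mu.-integrable [set` Interval (BLeft (-1)) (BRight y)] (EFin \o fJ).
  exact: integrableS lfJ.
have lJ := integrable_locally mJ lf.
move=> /(_ iy lJ) /= H.
have E1 := ae_neq (-1); have E2 := ae_neq 1.
have FF := ae_filter_ringOfSetsType mu.
apply: filterS3 H E1 E2 => x h x1 x2 Jx.
have xI : -1 < x < 1.
  move: Jx; rewrite /= in_itv /= => /andP[h1 h2]; rewrite !lt_neqAle h1 h2 !andbT.
  by apply/andP; split; apply/eqP => e; [apply: x1|apply: x2].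
have [_ <-] : derivable (fun x => \int[mu]_(t in `[-1, x]) fJ t) x 1 /\ derive1 (fun x => \int[mu]_(t in `[-1, x]) fJ t) x = f x.
  have -> : f x = fJ x by rewrite /fJ patchE mem_set.
  by apply: h; rewrite lte_fin; case/andP: xI.
rewrite derive1E -(derive_cst c x 1); apply: near_eq_derive => //.
have : \forall y \near x, y \in `](-1 : R), 1[ by apply: near_in_itvoo; rewrite in_itv.
apply: filterS => y; rewrite in_itv /= => hy; rewrite -[RHS](hc y hy) /prim; apply: eq_Rintegral => t.
rewrite inE /= in_itv /= => /andP[t1 t2]; rewrite /fJ patchE mem_set//=.
by rewrite in_itv /= t1 (le_trans t2)//; case/andP: hy => _ /ltW.
Qed.

(* Fubini on the triangle [-1 <= t <= s <= 1]. *)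
Lemma prim_parts (f P p : R -> R) : L1on mu J f ->
  (forall x, is_derive x 1 P (p x)) -> continuous p ->
  ip mu J f P = P 1 * prim f 1 - ip mu J (prim f) p.
Proof.
move=> lf dP cp.
have cP := is_derive_continuous dP.
pose fJ := f \_ J; pose pJ := p \_ J.
have lfJ : mu.-integrable setT (EFin \o fJ).
  by rewrite /fJ -restrict_EFin; apply/(integrable_mkcond _ mJ).1.
have lpJ : mu.-integrable setT (EFin \o pJ).
  by rewrite /pJ -restrict_EFin; apply/(integrable_mkcond _ mJ).1; exact: cont_L1.
have mfJ : measurable_fun setT fJ by apply/measurable_EFinP; exact: measurable_int lfJ.
have mpJ : measurable_fun setT pJ by apply/measurable_EFinP; exact: measurable_int lpJ.
pose L : set (measurableTypeR R * measurableTypeR R) := [set q | q.1 <= q.2].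
have mL : measurable L.
  rewrite -[L]setTI; apply: measurable_fun_le => //; exact: measurable_snd || exact: measurable_fst.
pose K (q : measurableTypeR R * measurableTypeR R) : \bar R :=
  (fJ q.1 * pJ q.2 * \1_L q)%:E.
have mK : measurable_fun setT K.
  apply/measurable_EFinP/measurable_funM; last exact: measurable_indic.
  by apply: measurable_funM; [exact: measurableT_comp|exact: measurableT_comp].
have iK : (mu \x mu)%E.-integrable setT K.
  apply/(integrable12ltyP _ _ mK).
  have fin1 : (\int[mu]_s `|(pJ s)%:E| \is a fin_num)%E.
    by have /integrable_abse/(integrable_fin_num measurableT) := lpJ.
  apply: (@le_lt_trans _ _ (\int[mu]_t (`|(fJ t)%:E| * \int[mu]_s `|(pJ s)%:E|))%E).
    apply: ge0_le_integral => //.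
    - by move=> x _; exact: integral_ge0.
    - apply: (measurable_fun_fubini_tonelli_F (abse \o K)) => //=.
      exact: measurableT_comp.
    - apply: emeasurable_funM => //; apply: measurableT_comp => //; exact/measurable_EFinP.
    move=> t _; rewrite -ge0_integralZl//; last first.
      by apply: measurableT_comp => //; exact/measurable_EFinP.
    apply: ge0_le_integral => //.
    - apply: measurableT_comp => //; exact: (measurableT_comp mK (measurable_pair1 t)).
    - apply: emeasurable_funM => //; apply: measurableT_comp => //; exact/measurable_EFinP.
    move=> s _; rewrite /K /= lee_fin normrM indicE.
    case: (_ \in _); rewrite ?normr1 ?normr0 ?mulr1 ?mulr0 ?normrM//.
  rewrite -(fineK fin1) ge0_integralZr//; last 2 first.
  - apply: measurableT_comp => //; exact/measurable_EFinP.
  - by rewrite lee_fin fine_ge0// integral_ge0.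
  apply: lte_mul_pinfty; first exact: integral_ge0.
  - by have /integrable_abse/(integrable_fin_num measurableT) := lfJ.
  - exact: ltry.
have E1 t : fubini_F mu K t = (fJ t * (P 1 - P t))%:E.
  rewrite /fubini_F; have [Jt|Jt] := boolP (t \in J); last first.
    have fJ0 : fJ t = 0 by rewrite /fJ patchE (negbTE Jt).
    under eq_integral do rewrite /K /= fJ0 !mul0r.
    rewrite fJ0 mul0r.
    by rewrite integral0.
  have /andP[t1 t2] : -1 <= t <= 1 by move: Jt; rewrite inE /= in_itv.
  rewrite (_ : (fun s => K (t, s)) = (fun s => (fJ t * p s)%:E) \_ (`[t, 1]%classic : set (measurableTypeR R))); last first.
    apply/funext => s; rewrite /K /= /pJ !patchE indicE /L.
    have -> : ((t, s) \in [set q : R * R | q.1 <= q.2]) = (t <= s) by apply/idP/idP; rewrite inE.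
    have -> : (s \in J) = (-1 <= s <= 1) by apply/idP/idP; rewrite inE /= in_itv.
    have -> : (s \in `[t, 1]%classic) = (t <= s <= 1) by apply/idP/idP; rewrite inE /= in_itv.
    have [ts|ts] := leP t s; rewrite ?mulr0// (le_trans t1 ts) /=.
    by case: ifP; rewrite ?mulr1 ?mulr0 ?mul0r.
  rewrite -integral_mkcond -(FTC_itv dP cp t2) -RintegralZl//; last first.
    apply: integrableS (cont_L1 cp) => //; apply: subset_itvr; rewrite bnd_simp//.
  rewrite /Rintegral fineK//; apply: integrable_fin_num => //.
  have : L1on mu J (fun s => fJ t * p s) by apply: L1onZ => //; exact: cont_L1.
  by apply: integrableS => //; apply: subset_itvr; rewrite bnd_simp.
have E2 s : fubini_G mu K s = (prim f s * pJ s)%:E.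
  rewrite /fubini_G; have [Js|Js] := boolP (s \in J); last first.
    have pJ0 : pJ s = 0 by rewrite /pJ patchE (negbTE Js).
    under eq_integral do rewrite /K /= pJ0 mulr0 mul0r.
    rewrite pJ0 mulr0.
    by rewrite integral0.
  have /andP[s1 s2] : -1 <= s <= 1 by move: Js; rewrite inE /= in_itv.
  rewrite (_ : (fun t => K (t, s)) = (fun t => (f t * pJ s)%:E) \_ (`[-1, s]%classic : set (measurableTypeR R))); last first.
    apply/funext => t; rewrite /K /= /fJ !patchE indicE /L.
    have -> : ((t, s) \in [set q : R * R | q.1 <= q.2]) = (t <= s) by apply/idP/idP; rewrite inE.
    have -> : (t \in J) = (-1 <= t <= 1) by apply/idP/idP; rewrite inE /= in_itv.
    have -> : (t \in `[-1, s]%classic) = (-1 <= t <= s) by apply/idP/idP; rewrite inE /= in_itv.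
    have [ts|ts] := leP t s; rewrite ?mulr0 ?andbF// (le_trans ts s2) !andbT.
    by case: ifP; rewrite ?mulr1 ?mulr0 ?mul0r.
  have sub : `[-1, s]%classic `<=` (`[-1, 1]%classic : set R) by apply: subset_itvl; rewrite bnd_simp.
  rewrite -integral_mkcond -RintegralZr//; last exact: integrableS lf.
  rewrite /Rintegral fineK//; apply: integrable_fin_num => //.
  have : L1on mu J (fun t => f t * pJ s).
    by apply: L1onM => //; exists `|pJ s|.
  exact: integrableS.
have := integral12_prod_meas1 iK; rewrite -(integral21_prod_meas1 iK).
under eq_integral do rewrite E1.
under [in RHS]eq_integral do rewrite E2.
have -> : (fun t => (fJ t * (P 1 - P t))%:E) = (fun t => (f t * (P 1 - P t))%:E) \_ J.
  by apply/funext => t; rewrite /fJ !patchE; case: ifP; rewrite ?mul0r.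
have -> : (fun t => (prim f t * pJ t)%:E) = (fun t => (prim f t * p t)%:E) \_ J.
  by apply/funext => t; rewrite /pJ !patchE; case: ifP; rewrite ?mulr0.
rewrite -!integral_mkcond => /(congr1 fine); rewrite -/(Rintegral _ _ _) -/(Rintegral _ _ _) => h.
rewrite /ip -h /prim -RintegralZl// -RintegralB//; first last.
- apply: L1onM => //; first by apply: measurable_funB => //; exact: cont_meas.
  by apply: cont_bounded => x; apply: cvgB; [exact: cvg_cst|exact: cP].
- exact: L1onZ.
by apply: Rint_eq => x _; ring.
Qed.

(** Multiplication by [cn 1] preserves the span of the cosines, so orthogonality to all cosines
    becomes orthogonality to all polynomials in [cn 1]. *)
Lemma cn_mul l t : cn 1 t * cn l.+1 t = 2^-1 * (cn l.+2 t + cn l t).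
Proof.
rewrite /cn; set A := fr 1 * t + fr 1; set B := fr l.+1 * t + fr l.+1.
have e l' : fr l'.+1 = fr l' + fr 1 by rewrite /fr -natr1; ring.
have -> : fr l.+2 * t + fr l.+2 = B + A by rewrite /A /B (e l.+1); ring.
have -> : fr l * t + fr l = B - A by rewrite /A /B (e l); ring.
have key (a c : R) : cos a * cos c = 2^-1 * (cos (c + a) + cos (c - a)).
  by rewrite cosD cosB; field.
exact: key.
Qed.

(** On [J] the argument of [cn 1] runs once through [[0, pi]], where cosine decreases. Hence [cn 1]
    separates points, and a peak in its value is a peak at one point. *)
Lemma cn1_mono (x y : R) : x \in J -> y \in J -> (cn 1 x < cn 1 y) = (y < x).
Proof.
have fE : fr 1 = pi / 2 by rewrite /fr mul1r.
have pg := @pihalf_ge1 R.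
have H z : z \in J -> pi / 2 * z + pi / 2 \in `[0 : R, pi].
  rewrite inE /= !in_itv /= => /andP[z1 z2]; apply/andP; split; nra.
move=> xJ yJ; rewrite /cn fE (ltr_cos (H _ yJ) (H _ xJ)) ltrD2r ltr_pM2l//.
by rewrite (lt_le_trans ltr01).
Qed.

Lemma peak_horner (u0 x : R) n :
  ((1 - (4^-1)%:P * ('X - u0%:P) ^+ 2) ^+ n : {poly R}).[x] = (1 - (x - u0) ^+ 2 / 4) ^+ n.
Proof.
rewrite horner_exp; congr (_ ^+ _).
by rewrite hornerD hornerN hornerM !hornerC horner_exp hornerXsubC mulrC.
Qed.

Section cont_complete.
Variable G : R -> R.
Hypothesis cG : {within J, continuous G}.
Hypothesis Gn : forall l, ip mu J G (cn l) = 0.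

Lemma within_contM_L1 (p : R -> R) : continuous p -> L1on mu J (fun t => G t * p t).
Proof.
move=> cp; apply: L1onM => //; [exact: within_cont_L1|exact: cont_meas|exact: cont_bounded].
Qed.

Lemma cn1X_cont n : continuous (fun t => cn 1 t ^+ n).
Proof. by apply: contX; exact: cn_cont. Qed.

(** The spare factor [cn l] absorbs each new factor [cn 1] through [cn_mul] and makes the induction
    on the power possible. *)
Lemma cont_moment n l : ip mu J G (fun t => cn 1 t ^+ n * cn l t) = 0.
Proof.
elim: n l => [|n IH] l.
  rewrite -(Gn l); apply: ip_eq => // x _; by rewrite expr0 mul1r.
case: l => [|l].
  rewrite -(IH 1%N); apply: ip_eq => // x _; by rewrite cn0 exprSr mulr1.
rewrite (@ipJ_eq _ _ G (fun t => 2^-1 * (cn 1 t ^+ n * cn l.+2 t) + 2^-1 * (cn 1 t ^+ n * cn l t)))//; last first.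
  by move=> x _; rewrite exprSr -mulrA cn_mul; ring.
have c1 k : L2on mu J (fun t => cn 1 t ^+ n * cn k t).
  by apply: cont_L2; apply: contM; [exact: cn1X_cont|exact: cn_cont].
have lG : L2on mu J G.
  by apply: L2on_bounded => //; [exact: L1on_meas (within_cont_L1 cG)|exact: within_cont_bounded].
by rewrite ipDr ?ipZr ?IH ?mulr0 ?addr0//; exact: L2onZ.
Qed.

Lemma cont_poly (q : {poly R}) : ip mu J G (fun t => q.[cn 1 t]) = 0.
Proof.
rewrite /ip (@intJ_eq _ (fun t => \sum_(i < size q) q`_i * (G t * cn 1 t ^+ i))); last first.
  by move=> x _; rewrite horner_coef mulr_sumr; apply: eq_bigr => i _; ring.
rewrite Rint_sum//; last by move=> i; apply: L1onZ => //; apply: within_contM_L1; exact: cn1X_cont.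
rewrite big1// => i _; rewrite RintegralZl//; last by apply: within_contM_L1; exact: cn1X_cont.
have := cont_moment i 0; rewrite /ip (@intJ_eq _ (fun t => G t * cn 1 t ^+ i)); last first.
  by move=> x _; rewrite cn0 mulr1.
by move=> ->; rewrite mulr0.
Qed.

(* The powers of [1 - (cn 1 t - cn 1 t0)^2 / 4], a polynomial in the cosine [cn 1 t], concentrate at [t0]. *)
Lemma cont_not_pos t0 : -1 < t0 < 1 -> G t0 <= 0.
Proof.
move=> /andP[ta tb]; rewrite leNgt; apply/negP => G0.
have t0J : t0 \in J by rewrite inE /= in_itv /= !ltW.
set u0 := cn 1 t0.
pose w t := 1 - (cn 1 t - u0) ^+ 2 / 4.
have w01 t : 0 <= w t <= 1.
  have := cn_le1 1 t; have := cn_le1 1 t0; rewrite -/u0 !ler_norml /w.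
  move: (cn 1 t) => a /andP[? ?] /andP[? ?]; have := sqr_ge0 (a - u0).
  have h1 : 0 <= 2 - (a - u0) by lra.
  have h2 : 0 <= 2 + (a - u0) by lra.
  by have := mulr_ge0 h1 h2; rewrite -subr_sqr => *; apply/andP; split; lra.
have [M MG] := within_cont_bounded cG.
have M0 : 0 < M by have := MG t0 (set_mem t0J); have := ler_norm (G t0); lra.
have [d [d0 dJ1 dJ2 dG]] : exists d, [/\ 0 < d, -1 <= t0 - d, t0 + d <= 1 &
    forall t, `|t - t0| < d -> G t0 / 2 < G t].
  have t0I : t0 \in `](-1 : R), 1[ by rewrite in_itv /= ta tb.
  have cGt : {for t0, continuous G}.
    have lt11 : (-1 : R) < 1 by lra.
    have := within_continuous_continuous lt11 cG => h; exact: h.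
  have h2 : 0 < G t0 / 2 by rewrite divr_gt0.
  have /cvgrPdist_lt/(_ _ h2) := cGt.
  move=> [e /= e0 he].
  exists (Num.min (e / 2) (Num.min (t0 + 1) (1 - t0))); split.
  - by rewrite !lt_min divr_gt0//=; apply/andP; split; lra.
  - have : Num.min (e / 2) (Num.min (t0 + 1) (1 - t0)) <= t0 + 1 by rewrite !ge_min lexx orbT.
    by lra.
  - have : Num.min (e / 2) (Num.min (t0 + 1) (1 - t0)) <= 1 - t0 by rewrite !ge_min lexx !orbT.
    by lra.
  - move=> t; rewrite lt_min => /andP[te _].
    have : `|G t0 - G t| < G t0 / 2 by apply: he; rewrite /ball /= distrC; lra.
    by rewrite ltr_norml => /andP[_]; lra.
have tdJ : t0 + d \in J by rewrite inE /= in_itv /=; apply/andP; split; lra.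
have tmJ : t0 - d \in J by rewrite inE /= in_itv /=; apply/andP; split; lra.
have up : cn 1 (t0 + d) < u0 by rewrite cn1_mono//; lra.
have um : u0 < cn 1 (t0 - d) by rewrite cn1_mono//; lra.
set eta := Num.min (u0 - cn 1 (t0 + d)) (cn 1 (t0 - d) - u0).
have eta0 : 0 < eta by rewrite lt_min !subr_gt0 up.
(* At distance at least [d] from [t0] the cosine differs from [u0] by at least [eta], so [w <= r2];
   where the difference is below [eta / 2], [w >= r1]. *)
pose r2 := 1 - eta ^+ 2 / 4; pose r1 := 1 - eta ^+ 2 / 16.
have r12 : r2 < r1 by have := exprn_gt0 2 eta0; rewrite /r1 /r2; lra.
have wfar t : t \in J -> d <= `|t - t0| -> w t <= r2.
  move=> tJ dt; rewrite /w /r2 lerD2l lerN2 ler_pM2r ?invr_gt0//.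
  rewrite -(real_normK (num_real (_ - _))) ler_sqr ?nnegrE ?(ltW eta0)//.
  have [tt|tt] := leP t0 t.
    rewrite ger0_norm ?subr_ge0// in dt.
    have : cn 1 t <= cn 1 (t0 + d) by rewrite leNgt cn1_mono// -leNgt; lra.
    move=> h; apply: (@le_trans _ _ (u0 - cn 1 (t0 + d))); first by rewrite ge_min lexx.
    by rewrite distrC (le_trans _ (ler_norm _))//; lra.
  rewrite ltr0_norm ?subr_lt0// in dt.
  have : cn 1 (t0 - d) <= cn 1 t by rewrite leNgt cn1_mono// -leNgt; lra.
  move=> h; apply: (@le_trans _ _ (cn 1 (t0 - d) - u0)); first by rewrite ge_min lexx orbT.
  by rewrite (le_trans _ (ler_norm _))//; lra.
have r20 : 0 <= r2.
  apply: le_trans (wfar _ tdJ _); first by case/andP: (w01 (t0 + d)).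
  by rewrite [t0 + d]addrC addrK ger0_norm; [exact: lexx|exact: ltW].
have [d1 [d10 d1d wnear]] : exists d1, [/\ 0 < d1, d1 <= d &
    forall t, `|t - t0| < d1 -> r1 <= w t].
  have h2 : 0 < eta / 2 by rewrite divr_gt0.
  have /cvgrPdist_lt/(_ _ h2) := @cn_cont 1%N t0.
  move=> [e /= e0 he].
  exists (Num.min e d); split; [by rewrite lt_min e0|by rewrite ge_min lexx orbT|].
  move=> t; rewrite lt_min => /andP[te _].
  have := he t; rewrite /ball /= distrC => /(_ te); rewrite -/u0 distrC => h.
  rewrite /w /r1 lerD2l lerN2 -(real_normK (num_real (_ - _))).
  have : `|cn 1 t - u0| ^+ 2 <= (eta / 2) ^+ 2.
    by rewrite ler_sqr ?nnegrE ?normr_ge0 ?ltW.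
  by rewrite exprMn; lra.
have r10 : 0 < r1 by exact: le_lt_trans r12.
pose A : set (measurableTypeR R) := `]t0 - d1, t0 + d1[%classic.
have mA : measurable A by exact: measurable_itv.
have muA : mu (A `&` J) = (2 * d1)%:E.
  rewrite (_ : A `&` J = A); last first.
    apply/setIidPl => t; rewrite /A /= !in_itv /= => /andP[? ?]; apply/andP; split; lra.
  rewrite lebesgue_measure_itv /= lte_fin.
  have -> : t0 - d1 < t0 + d1 by lra.
  by rewrite -EFinD; congr (_%:E); ring.
have pw n t : t \in J ->
    G t0 / 2 * r1 ^+ n * \1_A t - M * r2 ^+ n <= G t * w t ^+ n.
  move=> tJ; have /andP[w0 w1] := w01 t.
  have Mr : 0 <= M * r2 ^+ n by rewrite mulr_ge0 ?exprn_ge0// ltW.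
  have [tA|tA] := boolP (t \in A).
    have : `|t - t0| < d1.
      by move: tA; rewrite inE /A /= in_itv /= ltr_norml => /andP[? ?]; apply/andP; split; lra.
    move=> td; rewrite indicE tA mulr1.
    have h1 := wnear t td; have h2 := dG t (lt_le_trans td d1d).
    apply: (@le_trans _ _ (G t0 / 2 * r1 ^+ n)); first by lra.
    apply: ler_pM => //; [by rewrite divr_ge0 ?ltW|by rewrite exprn_ge0 ?ltW|by rewrite ltW|].
    by rewrite lerXn2r ?nnegrE ?(ltW r10).
  rewrite indicE (negbTE tA) mulr0 sub0r.
  have [td|td] := ltP (`|t - t0|) d.
    have h2 := dG t td; apply: (@le_trans _ _ 0); first by rewrite oppr_le0.
    rewrite mulr_ge0 ?exprn_ge0// ltW// (lt_trans _ h2)// divr_gt0//.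
  have h1 := wfar t tJ td.
  have := MG t (set_mem tJ); rewrite ler_norml => /andP[Ml _].
  have hw : w t ^+ n <= r2 ^+ n by rewrite lerXn2r ?nnegrE.
  have hw0 : 0 <= w t ^+ n by rewrite exprn_ge0.
  have : - (M * w t ^+ n) <= G t * w t ^+ n by rewrite -mulNr ler_wpM2r.
  have h5 : M * w t ^+ n <= M * r2 ^+ n := ler_wpM2l (ltW M0) hw.
  by move=> h6; apply: le_trans h6; rewrite lerN2.
(* The integral of [G w^n] is 0, so integrating the pointwise bound [pw] compares two geometric
   rates; since [r2 < r1], large [n] gives the contradiction. *)
have key n : G t0 * d1 * r1 ^+ n <= 2 * M * r2 ^+ n.
  have q0 := cont_poly ((1 - (4^-1)%:P * ('X - u0%:P) ^+ 2) ^+ n).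
  have qE : ip mu J G (fun t => ((1 - (4^-1)%:P * ('X - u0%:P) ^+ 2) ^+ n : {poly R}).[cn 1 t])
     = \int[mu]_(t in J) (G t * w t ^+ n).
    by apply: intJ_eq => t _; rewrite peak_horner.
  rewrite qE in q0.
  have cw : continuous (fun t => w t ^+ n).
    have cw1 : continuous w.
      move=> x; apply: cvgB; first exact: cvg_cst.
      apply: cvgM; last exact: cvg_cst.
      have := (fun x => cvgB (@cn_cont 1%N x) (@cvg_cst _ u0 _ (nbhs x) _)) => h.
      by under eq_fun do rewrite expr2; apply: cvgM; exact: h.
    exact: contX.
  have lI : L1on mu J (\1_A : _ -> R).
    apply: L1on_bounded => //; exists 1 => x _; rewrite indicE.
    by case: (_ \in _); rewrite ?normr1 ?normr0.
  have : \int[mu]_(t in J) (G t0 / 2 * r1 ^+ n * \1_A t - M * r2 ^+ n) <=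
         \int[mu]_(t in J) (G t * w t ^+ n).
    apply: le_Rintegral => //.
    - by apply: L1onB => //; [exact: L1onZ|exact: L1on_cst].
    - exact: within_contM_L1.
    - by move=> t tJ; apply: pw; rewrite inE.
  rewrite q0 RintegralB//; [|exact: L1onZ|exact: L1on_cst].
  rewrite RintegralZl// Rintegral_cst// [X in fine X]muJ.
  have -> : \int[mu]_(t in J) (\1_A t : R) = 2 * d1.
    by rewrite /Rintegral integral_indic// [X in fine X]muA.
  by rewrite /=; lra.
have h0 : `|r2 / r1| < 1.
  rewrite ger0_norm ?divr_ge0 ?(ltW r10)// ltr_pdivrMr// mul1r//.
have := cvg_geometric (2 * M) h0.
have c0 : 0 < G t0 * d1 by rewrite mulr_gt0.
move=> /cvgrPdist_lt/(_ _ c0)[N _ /(_ N (leqnn _))].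
rewrite sub0r normrN /geometric /= ger0_norm; last first.
  by rewrite mulr_ge0 ?exprn_ge0 ?divr_ge0 ?(ltW r10)//; lra.
have := key N; rewrite exprMn exprVn mulrA -ler_pdivlMr ?exprn_gt0//.
by move=> h1 h2; have := lt_le_trans h2 h1; rewrite ltxx.
Qed.
End cont_complete.

Lemma cn_complete_cont (G : R -> R) : {within J, continuous G} ->
  (forall l, ip mu J G (cn l) = 0) -> forall t, -1 < t < 1 -> G t = 0.
Proof.
move=> cG Gn t tI; apply/eqP; rewrite eq_le (cont_not_pos cG Gn tI) /=.
rewrite -oppr_le0; apply: (@cont_not_pos (fun x => - G x)) => //.
  by move=> x; apply: cvgN; exact: cG.
move=> l; rewrite ipNl ?Gn ?oppr0//; last by apply: cont_L2; exact: cn_cont.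
by apply: L2on_bounded => //; [exact: L1on_meas (within_cont_L1 cG)|exact: within_cont_bounded].
Qed.

Lemma ip_L1_prim_sn f l : L1on mu J f -> ip mu J f (sn l) = - fr l * ip mu J (prim f) (cn l).
Proof.
move=> lf; have cp : continuous (fun x => fr l * cn l x).
  by move=> x; apply: cvgM; [exact: cvg_cst|exact: cn_cont].
rewrite (prim_parts lf (is_derive_sn l) cp) sn1 mul0r sub0r mulNr -ipZr//.
- by apply: cont_L2; exact: cn_cont.
- have c := prim_cont lf.
  by apply: L2on_bounded => //; [exact: L1on_meas (within_cont_L1 c)|exact: within_cont_bounded].
Qed.

Lemma L2_prim f : L1on mu J f -> L2on mu J (prim f).
Proof.
move=> lf; have c := prim_cont lf.
by apply: L2on_bounded => //; [exact: L1on_meas (within_cont_L1 c)|exact: within_cont_bounded].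
Qed.

(** Integration by parts turns the sine coefficients of [f] into cosine coefficients of its
    primitive. The primitive is continuous, so after subtraction of its mean it vanishes inside the
    interval. *)
Lemma sn_complete f : L1on mu J f -> (forall l, ip mu J f (sn l) = 0) ->
  {ae mu, forall x, J x -> f x = 0}.
Proof.
move=> lf h; pose m := 2^-1 * ip mu J (prim f) (cn 0).
have lp := L2_prim lf.
have lc l : L2on mu J (cn l) by apply: cont_L2; exact: cn_cont.
apply: (@prim_cst_ae f m) => // x xI; apply/eqP; rewrite -subr_eq0; apply/eqP.
apply: (@cn_complete_cont (fun x => prim f x - m)) => //.
  by move=> y; apply: cvgB; [exact: prim_cont|exact: cvg_cst].
move=> l; rewrite ipBl//; last exact: L2on_cst.
rewrite (@ipJ_eq (fun=> m) _ (fun x => m * cn 0 x) (cn l))//; last first.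
  by move=> y _; rewrite cn0 mulr1.
rewrite ipZl//; case: l => [|l].
  rewrite (_ : ip mu J (cn 0) (cn 0) = 2); first by rewrite /m; field.
  rewrite /ip (@intJ_eq _ (fun=> 1)); last by move=> y _; rewrite cn0 mul1r.
  by rewrite Rintegral_cst// [X in fine X]muJ mul1r.
have f0 : fr l.+1 != 0 by rewrite gt_eqF// fr_gt0.
have -> : ip mu J (prim f) (cn l.+1) = 0.
  have := h l.+1; rewrite ip_L1_prim_sn// => /eqP; rewrite mulf_eq0 oppr_eq0 (negbTE f0).
  by move/eqP.
have := ip_cn 0 l.+1; rewrite /cnn ipZl ?ipZr//; last exact: L2onZ.
rewrite /= {2}/nrm /= mul1r => /eqP; rewrite mulf_eq0 /nrm /= invr_eq0 sqrtr_eq0.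
by rewrite real_leNgt ?num_real// ltr0n /= => /eqP ->; rewrite mulr0 subrr.
Qed.

(** The coefficient of index 0 makes the primitive vanish at 1, which removes the boundary term; its
    sine coefficients then vanish, and continuity upgrades almost everywhere to everywhere
    inside. *)
Lemma cn_complete f : L1on mu J f -> (forall l, ip mu J f (cn l) = 0) ->
  {ae mu, forall x, J x -> f x = 0}.
Proof.
move=> lf h; have lp := L2_prim lf; have cp := prim_cont lf.
have p1 : prim f 1 = 0.
  rewrite -(h 0%N) /ip /prim; apply: Rint_eq => x _; by rewrite cn0 mulr1.
have sp l : ip mu J (prim f) (sn l) = 0.
  have cs : continuous (fun x => - fr l * sn l x).
    by move=> x; apply: cvgM; [exact: cvg_cst|exact: sn_cont].
  have := h l; rewrite (prim_parts lf (is_derive_cn l) cs) p1 mulr0 sub0r ipZr//; last first.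
    by apply: cont_L2; exact: sn_cont.
  case: l {cs} => [_|l].
    rewrite /ip (@intJ_eq _ (fun=> 0)) ?Rintegral_cst ?mul0r// => x _.
    by rewrite sn0 mulr0.
  move=> /eqP; rewrite mulNr opprK mulf_eq0 gt_eqF ?fr_gt0//= => /eqP ->//.
have pae := sn_complete (L2on_L1 mJ muJ_lty lp) sp.
apply: (@prim_cst_ae f 0) => // x xI.
apply: cn_complete_cont cp _ x xI => l.
rewrite (@ip_ae _ _ _ mu J mJ (prim f) (fun=> 0))//.
- by rewrite /ip (@intJ_eq _ (fun=> 0)) ?Rintegral_cst ?mul0r// => y _; rewrite mul0r.
- exact: lp.1.
- by apply: cont_meas; exact: cn_cont.
Qed.

End Trig.

(** * Integration on the square *)

Lemma Rint_ae d (T : measurableType d) (R : realType) (mu : {measure set T -> \bar R})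
    (D : set T) (f g : T -> R) : measurable D -> measurable_fun D f -> measurable_fun D g ->
  {ae mu, forall x, D x -> f x = g x} -> \int[mu]_(x in D) f x = \int[mu]_(x in D) g x.
Proof.
move=> mD mf mg fg; rewrite /Rintegral; congr fine.
apply: ae_eq_integral => //; try exact/measurable_EFinP.
by move: fg; apply: filterS => x /= h Dx; rewrite h.
Qed.

Lemma bounded_cvg_Rint d (T : measurableType d) (R : realType) (mu : {measure set T -> \bar R})
    (D : set T) (f : T -> R) (g_ : nat -> T -> R) (g : T -> R) (B : R) :
  measurable D -> L1on mu D f -> (forall n, measurable_fun D (g_ n)) ->
  (forall n x, D x -> `|g_ n x| <= B) -> (forall x, D x -> g_ ^~ x @ \oo --> g x) ->
  \int[mu]_(x in D) (f x * g_ n x) @[n --> \oo] --> \int[mu]_(x in D) (f x * g x).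
Proof.
move=> mD lf mg gB gg; have mf := L1on_meas lf.
have mgl : measurable_fun D g by exact: (measurable_fun_cvg mg).
have [] := @dominated_convergence _ _ _ mu D mD (fun n x => (f x * g_ n x)%:E)
  (fun x => (f x * g x)%:E) (fun x => (B * `|f x|)%:E).
- by move=> n; apply/measurable_EFinP/measurable_funM.
- exact/measurable_EFinP/measurable_funM.
- apply: aeW => x Dx; apply: cvg_EFin; first exact: nearW.
  by apply: cvgM; [exact: cvg_cst|exact: gg].
- by have := L1onZ mD B (L1on_norm lf).
- by apply: aeW => x n Dx; rewrite /= lee_fin normrM mulrC ler_wpM2r// gB.
move=> lfg _; rewrite (L1on_fin mD lfg) => /fine_cvgP[_].
by apply: cvg_trans; apply: near_eq_cvg; apply: nearW.
Qed.

Section Square.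
Variable R : realType.
Local Notation mu := (@lebesgue_measure R).
Local Notation T2 := (measurableTypeR R * measurableTypeR R)%type.
Local Notation mu2 := (mu \x mu)%E.
Local Notation J := (`[-1, 1]%classic : set (measurableTypeR R)).
Local Notation I := (`]-1, 1[%classic : set (measurableTypeR R)).
Local Notation Q := (@G1 R : set T2).
Implicit Types (f : R * R -> R).

Let mJ := @mJ R.
Let muJ_lty := @muJ_lty R.
Hint Resolve mJ muJ_lty : core.

Lemma mQ : measurable Q. Proof. by apply: measurableX; exact: measurable_itv. Qed.
Lemma muI : mu I = 2%:E.
Proof.
rewrite lebesgue_measure_itv /= lte_fin.
have -> : (-1 : R) < 1 by lra.
by rewrite -EFinD; congr (_%:E); ring.
Qed.
Lemma muQ : mu2 Q = 4%:E.
Proof.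
rewrite /G1 product_measure1E; [|exact: measurable_itv|exact: measurable_itv].
rewrite [X in (X * _)%E]muI [X in (_ * X)%E]muI -EFinM; congr (_%:E); ring.
Qed.
Lemma muQ_lty : (mu2 Q < +oo)%E. Proof. by rewrite muQ ltry. Qed.

Lemma QP (x y : R) : Q (x, y) <-> (-1 < x < 1) /\ (-1 < y < 1).
Proof. by rewrite /G1 /setX /= !in_itv. Qed.

Lemma open_Q : open (@G1 R).
Proof.
have oI : open (`]-1, 1[%classic : set R) := @interval_open R (BRight (-1)) (BLeft 1) isT isT.
rewrite (_ : G1 (R := R) = fst @^-1` `]-1, 1[ `&` snd @^-1` `]-1, 1[) //.
apply: openI; apply: open_comp => // z _; [exact: cvg_fst|exact: cvg_snd].
Qed.

(** Links the product topology to the product sigma-algebra: an open set is the union of the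
    countably many squares with centres on the grids [1 / n] that it contains. *)
Lemma open_measurable2 (O : set (R * R)) : open O -> measurable (O : set T2).
Proof.
move=> oO.
pose sq (k : nat * int * int) : set T2 :=
  `](k.1.2%:~R - 1) / k.1.1.+1%:R, (k.1.2%:~R + 1) / k.1.1.+1%:R[ `*`
  `](k.2%:~R - 1) / k.1.1.+1%:R, (k.2%:~R + 1) / k.1.1.+1%:R[.
have -> : (O : set T2) = \bigcup_k (if `[< sq k `<=` O >] then sq k else set0).
  apply/seteqP; split; last first.
    by move=> p [k _]; case: asboolP => // h; exact: h.
  move=> [x y] Op; have : nbhs (x, y) O by exact: open_nbhs_nbhs.
  rewrite -nbhs_ballE => -[e /= e0 he].
  pose n := Num.trunc (2 / e).
  have n0 : (0 : R) < n.+1%:R by rewrite ltr0n.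
  have ne : 2 / n.+1%:R < e.
    rewrite ltr_pdivrMr// mulrC -ltr_pdivrMr//.
    exact: truncnS_gt.
  have key (z w : R) : (Num.floor (z * n.+1%:R))%:~R - 1 < w * n.+1%:R -> w * n.+1%:R < (Num.floor (z * n.+1%:R))%:~R + 1 ->
     `|z - w| < e.
    move=> w1 w2; apply: lt_le_trans (ltW ne); rewrite ltr_pdivlMr// -{1}(ger0_norm (ltW n0)) -normrM.
    have := floor_le (z * n.+1%:R).
    have := floorD1_gt (z * n.+1%:R).
    by rewrite intrD ltr_norml mulrBl => h1 h2; apply/andP; split; lra.
  have sqE (z w : R) : (w \in `](z - 1) / n.+1%:R, (z + 1) / n.+1%:R[) = (z - 1 < w * n.+1%:R) && (w * n.+1%:R < z + 1).
    by rewrite in_itv /= ltr_pdivrMr// ltr_pdivlMr.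
  exists (n, Num.floor (x * n.+1%:R), Num.floor (y * n.+1%:R)) => //.
  rewrite asboolT; last first.
    move=> -[z w] [/=]; rewrite !sqE => /andP[? ?] /andP[? ?].
    by apply: he; split; rewrite /ball /=; apply: key.
  split=> /=; rewrite sqE; have := floor_le (x * n.+1%:R); have := floor_le (y * n.+1%:R);
  have := floorD1_gt (x * n.+1%:R); have := floorD1_gt (y * n.+1%:R);
  rewrite !intrD => ? ? ? ?; apply/andP; split; lra.
apply: countable_bigcupT_measurable => // k; case: asboolP => // _.
by apply: measurableX; exact: measurable_itv.
Qed.

Lemma cont_meas2 (U : set (R * R)) f : open U -> (forall p, U p -> {for p, continuous f}) ->
  measurable_fun (U : set T2) f.
Proof.
move=> oU cf; apply: (measurability _ (RGenOpens.measurableE R)).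
move=> _ [_ [a [b ->] <-]]; apply: open_measurable2.
have : {in U, continuous f} by move=> p /set_mem; exact: cf.
rewrite -continuous_open_subspace// => /continuousP cf'.
have /open_subspaceP[V oV VU] := cf' _ (@interval_open R (BRight a) (BLeft b) isT isT).
by rewrite setIC -VU; exact: openI.
Qed.

(** The square is a product of open intervals, whereas one-dimensional integrals run over the closed
    [J]; the endpoints are null. *)
Lemma L1_IJ (g : R -> R) : L1on mu I g -> L1on mu J g.
Proof.
move=> lg; have mg := L1on_meas lg.
apply/integrableP; split.
  apply/measurable_EFinP/measurable_fun_itv_bndo_bndcP/measurable_fun_itv_obnd_cbndP.
  exact: mg.
have m2 : measurable_fun I (fun x => `|(g x)%:E|%E).
  by apply: measurableT_comp => //; exact/measurable_EFinP.
rewrite -integral_itv_bndo_bndc; last first.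
  by apply/emeasurable_fun_itv_obnd_cbndP.
rewrite -integral_itv_obnd_cbnd//.
by case/integrableP : lg.
Qed.

Lemma int_IJ (g : R -> \bar R) : measurable_fun I g ->
  (\int[mu]_(x in J) g x = \int[mu]_(x in I) g x)%E.
Proof.
move=> mg; rewrite -integral_itv_bndo_bndc; last by apply/emeasurable_fun_itv_obnd_cbndP.
by rewrite -integral_itv_obnd_cbnd.
Qed.

Lemma J_I (x : R) : J x -> x <> -1 -> x <> 1 -> -1 < x < 1.
Proof.
rewrite /= in_itv /= => /andP[h1 h2] n1 n2; rewrite !lt_neqAle h1 h2 !andbT.
by apply/andP; split; apply/eqP => e; [apply: n1|apply: n2].
Qed.

(** * Fubini's theorem on the square *)

Section fub.
Variable f : R * R -> R.
Hypothesis lf : L1on mu2 Q f.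

Let fQ : T2 -> \bar R := EFin \o (f \_ Q).
Let ifQ : mu2.-integrable setT fQ.
Proof. by rewrite /fQ -restrict_EFin; apply/(integrable_mkcond _ mQ).1. Qed.

Definition sec1 (x : R) : R := \int[mu]_(y in J) f (x, y).

Let fQ_sec x : -1 < x < 1 -> (fun y => fQ (x, y)) = (fun y => (f (x, y))%:E) \_ I.
Proof.
move=> xI; apply/funext => y; rewrite /fQ /= !patchE.
have -> : ((x, y) \in Q) = (y \in I).
  by apply/idP/idP; rewrite !inE /= in_itv /=; rewrite /G1 /setX /= !in_itv /= xI; [case|split].
by case: ifP.
Qed.

Let fQ_out x : ~ (-1 < x < 1) -> (fun y => fQ (x, y)) = cst 0%E.
Proof.
move=> xI; apply/funext => y; rewrite /fQ /= !patchE.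
by case: ifPn => // /set_mem /QP[].
Qed.

Let msec x : -1 < x < 1 -> measurable_fun I (fun y => (f (x, y))%:E).
Proof.
move=> xI; have := measurableT_comp (measurable_int _ ifQ) (measurable_pair1 x).
rewrite /comp => m1; have : measurable_fun setT (fun y => fQ (x, y)) by exact: m1.
rewrite fQ_sec// => m2; apply/(measurable_restrictT _ _).2 => //; exact: measurable_itv.
Qed.

Let F' := fubini_F mu fQ.

Let F'E x : -1 < x < 1 -> F' x = (\int[mu]_(y in J) (f (x, y))%:E)%E.
Proof.
move=> xI; rewrite /F' /fubini_F fQ_sec// -integral_mkcond int_IJ//.
exact: msec.
Qed.

Let sec1E x : -1 < x < 1 -> sec1 x = fine (F' x).
Proof. by move=> xI; rewrite F'E. Qed.

Lemma sec1_L1 : L1on mu J sec1.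
Proof.
apply: L1_IJ; have iF : mu.-integrable I F'.
  by apply: integrableS (integrable_fubini_F ifQ) => //; exact: measurable_itv.
have mF := measurable_int _ iF.
have mI : measurable I by exact: measurable_itv.
apply: le_integrable iF => //.
  apply/measurable_EFinP; apply: (@eq_measurable_fun _ _ _ _ I (fine \o F')).
    by move=> x; rewrite inE /= in_itv /= => /sec1E ->.
  by apply: measurableT_comp mF => //; exact: measurable_fine.
move=> x; rewrite /= in_itv /= => /sec1E ->.
by case: (F' x) => [r| |] /=; [exact: lexx|exact: leey|exact: leey].
Qed.

Lemma sec1_ae : {ae mu, forall x, J x -> L1on mu J (fun y => f (x, y))}.
Proof.
have FF := ae_filter_ringOfSetsType mu.
have := ae_integrable1 ifQ; have := ae_neq (1 : R); have := ae_neq (-1 : R).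
apply: filterS3 => x x1 x2 h Jx; apply: L1_IJ; have xI := J_I Jx x1 x2.
by move: h; rewrite fQ_sec// => h; apply/(integrable_mkcond _ _).2 => //; exact: measurable_itv.
Qed.

Lemma fub1 : \int[mu2]_(z in Q) f z = \int[mu]_(x in J) sec1 x.
Proof.
have FF := ae_filter_ringOfSetsType mu.
rewrite /Rintegral integral_mkcond restrict_EFin -(integral12_prod_meas1 ifQ); congr fine.
have lsec := sec1_L1.
transitivity (\int[mu]_(x in I) F' x)%E.
  rewrite [RHS]integral_mkcond; apply: eq_integral => x _; rewrite patchE.
  case: ifPn => //; rewrite notin_setE /= in_itv /= => h.
  by rewrite /F' /fubini_F fQ_out ?integral0//; exact/negP.
have iF : mu.-integrable I F'.
  by apply: integrableS (integrable_fubini_F ifQ) => //; exact: measurable_itv.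
have mI : measurable I by exact: measurable_itv.
have msI : measurable_fun I (fun x => (sec1 x)%:E).
  apply/measurable_EFinP; apply: measurable_funS (L1on_meas lsec) => //.
  by apply: subset_itv; rewrite bnd_simp.
rewrite [RHS]int_IJ//; apply: ae_eq_integral => //; first exact: measurable_int iF.
have := integrable_ae mI iF; apply: filterS => x /= h xI.
have xI' : -1 < x < 1 by move: xI; rewrite in_itv.
by rewrite (sec1E xI') fineK//; exact: h.
Qed.
End fub.

(** Reflection in the diagonal, used to transfer statements about [x] to [y]. *)
Definition swp f : R * R -> R := fun p => f (p.2, p.1).

Lemma swap_ge0 (g : T2 -> \bar R) : measurable_fun setT g -> (forall z, (0 <= g z)%E) ->
  (\int[mu2]_z g (z.2, z.1) = \int[mu2]_z g z)%E.
Proof.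
move=> mg g0; rewrite (fubini_tonelli2 g)// (fubini_tonelli1 (fun z => g (z.2, z.1)))//.
apply: measurableT_comp => //; apply: measurable_fun_pair; [exact: measurable_snd|exact: measurable_fst].
Qed.

Lemma swp_Q f : (swp f) \_ Q = swp (f \_ Q).
Proof.
apply/funext => -[x y]; rewrite /swp !patchE /=.
suff -> : ((x, y) \in Q) = ((y, x) \in Q) by [].
by apply/idP/idP => /set_mem /QP[? ?]; rewrite inE; apply/QP.
Qed.

Lemma swp_L1 f : L1on mu2 Q f -> L1on mu2 Q (swp f).
Proof.
move=> /(integrable_mkcond _ mQ).1; rewrite restrict_EFin => lf.
apply/(integrable_mkcond _ mQ).2; rewrite restrict_EFin swp_Q.
have mf := measurable_int _ lf.
apply/integrableP; split.
  apply: (measurableT_comp mf).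
  apply: measurable_fun_pair; [exact: measurable_snd|exact: measurable_fst].
case/integrableP : lf => _; rewrite -(swap_ge0 (g := fun z => `|(EFin \o f \_ Q) z|%E))//.
exact: measurableT_comp.
Qed.

Lemma swp_int f : L1on mu2 Q f -> \int[mu2]_(z in Q) swp f z = \int[mu2]_(z in Q) f z.
Proof.
move=> /(integrable_mkcond _ mQ).1; rewrite restrict_EFin => lf.
have mf := measurable_int _ lf.
rewrite /Rintegral [in LHS]integral_mkcond [in RHS]integral_mkcond !restrict_EFin swp_Q; congr fine.
rewrite [LHS]integralE [RHS]integralE.
have mp := measurable_funepos mf; have mn := measurable_funeneg mf.
have ep := swap_ge0 mp (fun z => funepos_ge0 _ _).
have en := swap_ge0 mn (fun z => funeneg_ge0 _ _).
by rewrite -ep -en; congr (_ - _)%E; apply: eq_integral => z _;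
  rewrite ?funeposE ?funenegE.
Qed.

Definition complete (p : nat -> R -> R) := forall f : R -> R, L1on mu J f ->
  (forall k, ip mu J f (p k) = 0) -> {ae mu, forall x, J x -> f x = 0}.

Lemma prod_cont (p q : R -> R) : continuous p -> continuous q ->
  continuous (fun z : R * R => p z.1 * q z.2).
Proof.
move=> cp cq z; apply: cvgM.
  by apply: (continuous_comp (g := p)); [exact: cvg_fst|exact: cp].
by apply: (continuous_comp (g := q)); [exact: cvg_snd|exact: cq].
Qed.

Lemma meas2 (g : R * R -> R) : continuous g -> measurable_fun Q g.
Proof. by move=> cg; apply: cont_meas2; [exact: open_Q|move=> p _; exact: cg]. Qed.

Lemma prod_bounded (p q : R -> R) : continuous p -> continuous q ->
  bounded_on Q (fun z : R * R => p z.1 * q z.2).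
Proof.
move=> cp cq; have [A hA] := cont_bounded cp; have [B hB] := cont_bounded cq.
exists (A * B) => -[x y] /QP[xI yI] /=.
have xJ : J x by rewrite /= in_itv /= !ltW//; case/andP: xI.
have yJ : J y by rewrite /= in_itv /= !ltW//; case/andP: yI.
rewrite normrM ler_pM//; [exact: hA|exact: hB].
Qed.

(** The coefficients against [q l] of the sections in [y] form a function of [x], which completeness
    of [p] annihilates almost everywhere. The countably many null sets are united, and completeness
    of [q] then kills almost every section. *)
Lemma prod_complete (d : R * R -> R) (p q : nat -> R -> R) : L1on mu2 Q d ->
  (forall k, continuous (p k)) -> (forall l, continuous (q l)) ->
  complete p -> complete q ->
  (forall k l, ip mu2 Q d (fun z => p k z.1 * q l z.2) = 0) ->
  {ae mu2, forall z, Q z -> d z = 0}.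
Proof.
move=> ld cp cq Cp Cq h0.
have FF := ae_filter_ringOfSetsType mu.
have ldpq (u v : R -> R) : continuous u -> continuous v -> L1on mu2 Q (fun z => d z * (u z.1 * v z.2)).
  by move=> cu cv; apply: L1onM => //; [exact: mQ|apply: meas2; exact: prod_cont|exact: prod_bounded].
have c1 : continuous (fun _ : R => 1 : R) by exact: cst_continuous.
(* The factor [1 *] gives the integrand the product shape to which [ldpq] applies. *)
have D0 l : {ae mu, forall x, J x -> sec1 (fun z => d z * (1 * q l z.2)) x = 0}.
  have l1 := ldpq _ _ c1 (cq l).
  apply: Cp; first exact: sec1_L1.
  move=> k; rewrite -(h0 k l) /ip (fub1 (ldpq _ _ (cp k) (cq l))).
  apply: Rint_ae => //.
  - apply: measurable_funM; first exact: L1on_meas (sec1_L1 l1).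
    by apply: cont_meas; exact: cp.
  - exact: L1on_meas (sec1_L1 (ldpq _ _ (cp k) (cq l))).
  have := sec1_ae l1; apply: filterS => x hx Jx.
  rewrite /sec1 -RintegralZr//; last exact: hx.
  by apply: intJ_eq => y _ /=; ring.
have Dall : {ae mu, forall x, forall l, J x -> sec1 (fun z => d z * (1 * q l z.2)) x = 0}.
  exact: ae_foralln.
have lad := L1on_norm ld.
have : \int[mu2]_(z in Q) `|d z| = 0.
  rewrite (fub1 lad) (@Rint_ae _ _ _ mu J _ (fun=> 0))//.
  - by rewrite Rintegral_cst// mul0r.
  - exact: L1on_meas (sec1_L1 lad).
  have := sec1_ae ld; move: Dall; apply: filterS2 => x hx lx Jx.
  have lx' := lx Jx.
  have y0 : {ae mu, forall y, J y -> d (x, y) = 0}.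
    apply: Cq => // l; rewrite -(hx l Jx) /sec1.
    by apply: intJ_eq => y _ /=; rewrite mul1r.
  rewrite /sec1 (@Rint_ae _ _ _ mu J _ (fun=> 0))//.
  - by rewrite Rintegral_cst// mul0r.
  - exact: (L1on_meas (L1on_norm lx')).
  - by move: y0; apply: filterS => y hy Jy; rewrite hy ?normr0.
move=> hz.
have [+ _] := ae_eq_integral_abs mu2 mQ (measurable_int _ ld).
have FF2 := ae_filter_ringOfSetsType mu2.
move=> H; apply: filterS (H _) => [z /= hzz Qz|].
  by have := hzz Qz => -[].
by rewrite (L1on_fin mQ lad) hz.
Qed.

End Square.

(** * Products as test functions *)

Lemma cvg_eq (R : realType) (u v : nat -> R) (a b : R) :
  u n @[n --> \oo] --> a -> v n @[n --> \oo] --> b -> (forall n, u n = v n) -> a = b.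
Proof.
move=> ua vb /funext uv; rewrite uv in ua; exact: (cvg_unique _ ua vb).
Qed.

Section Cutoff.
Variable R : realType.
Local Notation mu := (@lebesgue_measure R).
Local Notation T2 := (measurableTypeR R * measurableTypeR R)%type.
Local Notation mu2 := (mu \x mu)%E.
Local Notation J := (`[-1, 1]%classic : set (measurableTypeR R)).
Local Notation Q := (@G1 R : set T2).
Let mQ := @mQ R.
Let muQ_lty := @muQ_lty R.
Hint Resolve mQ muQ_lty : core.

(** A differentiation criterion by quadratic remainder, for the square of the positive part and for
    the series of the Dirichlet problem. *)
Lemma is_derive_quad (f : R -> R) (x d C e : R) : 0 < e ->
  (forall h, `|h| < e -> `|f (x + h) - f x - d * h| <= C * h ^+ 2) -> is_derive x 1 f d.
Proof.
move=> e0 hf.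
suff H : h^-1 *: ((f \o shift x) (h *: (1 : R)) - f x) @[h --> 0^'] --> d.
  apply: DeriveDef; first by apply/cvg_ex; exists d.
  exact: cvg_lim H.
apply/cvgrPdist_le => eps eps0.
pose C1 := `|C| + 1; have C10 : 0 < C1 by rewrite ltr_wpDl.
near=> h.
have h0 : h != 0 by near: h; exact: nbhs_dnbhs_neq.
have he : `|h| < e by near: h; exact: dnbhs0_lt.
have hC : `|h| < eps / C1 by near: h; apply: dnbhs0_lt; rewrite divr_gt0.
rewrite /= /GRing.scale /= mulr1 [h + x]addrC.
have -> : d - h^-1 * (f (x + h) - f x) = - h^-1 * (f (x + h) - f x - d * h) by field.
rewrite normrM normrN normfV ler_pdivrMl ?normr_gt0//.
apply: le_trans (hf h he) _.
rewrite -(real_normK (num_real h)) expr2 mulrA [X in _ <= X]mulrC ler_wpM2r//.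
apply: (@le_trans _ _ (C1 * `|h|)).
  by rewrite ler_wpM2r// /C1; have := ler_norm C; lra.
by rewrite mulrC -ler_pdivlMr// ltW.
Unshelve. all: by end_near. Qed.

Definition pos (s : R) : R := Num.max s 0.

Lemma pos_ge0 s : 0 <= pos s. Proof. by rewrite le_max lexx orbT. Qed.

Lemma is_derive_pos2 (s : R) : is_derive s 1 (fun s => pos s ^+ 2) (2 * pos s).
Proof.
apply: (@is_derive_quad _ _ _ 1 1 ltr01) => h _; rewrite mul1r /pos.
rewrite ler_norml; case: (leP s 0) => hs; case: (leP (s + h) 0) => hsh; apply/andP; split;
  rewrite ?expr0n ?mulr0 ?mul0r ?subr0 ?sub0r ?oppr0 ?oppr_le0 ?sqr_ge0//; nra.
Qed.

Lemma pos_cont : continuous pos.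
Proof. by move=> x; apply: continuous_max; [exact: cvg_id|exact: cvg_cst]. Qed.

Definition eps n : R := n.+1%:R^-1.
(** [cut n] vanishes near the ends and tends to 1 inside. Only the square of the positive part
    enters it, which makes it C^1 without any exponential bump. *)
Definition cutu n (x : R) : R := pos (1 - x ^+ 2 - eps n).
Definition cut n (x : R) : R := cutu n x ^+ 2 / (cutu n x ^+ 2 + eps n ^+ 2).
Definition dcut n (x : R) : R :=
  2 * cutu n x * (- 2 * x) * (eps n ^+ 2 / (cutu n x ^+ 2 + eps n ^+ 2) ^+ 2).

Lemma eps_gt0 n : 0 < eps n. Proof. by rewrite invr_gt0 ltr0n. Qed.
Lemma cutden_gt0 n x : 0 < cutu n x ^+ 2 + eps n ^+ 2.
Proof. by rewrite ltr_wpDl ?sqr_ge0// exprn_gt0// eps_gt0. Qed.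

Lemma is_derive_cut n (x : R) : is_derive x 1 (cut n) (dcut n x).
Proof.
have d1 : is_derive x 1 (fun x => 1 - x ^+ 2 - eps n) (- 2 * x).
  by apply: is_derive_eq; rewrite /GRing.scale /=; ring.
have d2 : is_derive x 1 (fun x => cutu n x ^+ 2) (2 * cutu n x * (- 2 * x)).
  exact: (@is_derive1_comp _ (fun s => pos s ^+ 2) (fun x => 1 - x ^+ 2 - eps n) x _ _
    (is_derive_pos2 _) d1).
have n0 := cutden_gt0 n x.
have d3 : is_derive x 1 (fun x => (cutu n x ^+ 2 + eps n ^+ 2)^-1)
   (- (cutu n x ^+ 2 + eps n ^+ 2) ^- 2 *: (2 * cutu n x * (- 2 * x))).
  apply: is_deriveV; first by rewrite gt_eqF.
  by apply: is_derive_eq; rewrite addr0.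
have D := is_deriveM d2 d3.
have E : dcut n x = cutu n x ^+ 2 *: (- (cutu n x ^+ 2 + eps n ^+ 2) ^- 2 *: (2 * cutu n x * (- 2 * x)))
    + (cutu n x ^+ 2 + eps n ^+ 2)^-1 *: (2 * cutu n x * (- 2 * x)).
  by rewrite /GRing.scale /= /dcut; field; rewrite gt_eqF.
by rewrite E; exact: D.
Qed.

Lemma contV (f : R -> R) : continuous f -> (forall x, f x != 0) -> continuous (fun x => (f x)^-1).
Proof. by move=> cf f0 x; apply: cvgV; [exact: f0|exact: cf]. Qed.

Lemma contD (f g : R -> R) : continuous f -> continuous g -> continuous (fun x => f x + g x).
Proof. by move=> cf cg x; apply: cvgD; [exact: cf|exact: cg]. Qed.

Lemma contC (c : R) : continuous (fun _ : R => c).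
Proof. exact: cst_continuous. Qed.

Lemma cutu_cont n : continuous (cutu n).
Proof.
have c1 : continuous (fun x : R => 1 - x ^+ 2 - eps n).
  move=> x; apply: cvgB; last exact: cvg_cst.
  by apply: cvgB; [exact: cvg_cst|exact: exprn_continuous].
by move=> x; exact: (continuous_comp (c1 x) (@pos_cont _)).
Qed.

Lemma cut_cont n : continuous (cut n).
Proof. exact: is_derive_continuous (is_derive_cut n). Qed.

Lemma dcut_cont n : continuous (dcut n).
Proof.
have c2 : continuous (fun x => cutu n x ^+ 2) by apply: contX; exact: cutu_cont.
have cden : continuous (fun x => cutu n x ^+ 2 + eps n ^+ 2).
  by apply: contD => //; exact: contC.
have cid : continuous (fun x : R => x) by move=> x; exact: cvg_id.
apply: contM; first apply: contM.
- by apply: contM; [exact: contC|exact: cutu_cont].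
- by apply: contM; [exact: contC|].
- apply: contM; first exact: contC.
  apply: contV; first exact: contX.
  by move=> x; rewrite expf_neq0// gt_eqF// cutden_gt0.
Qed.

Lemma cut01 n x : 0 <= cut n x <= 1.
Proof.
have d0 := cutden_gt0 n x.
rewrite /cut divr_ge0 ?sqr_ge0 ?(ltW d0)//= ler_pdivrMr// mul1r lerDl sqr_ge0//.
Qed.

Lemma cut_norm n x : `|cut n x| <= 1.
Proof. by case/andP: (cut01 n x) => h1 h2; rewrite ger0_norm. Qed.

Lemma cut_supp n x : cut n x != 0 -> eps n < 1 - x ^+ 2.
Proof.
apply: contraNT; rewrite -leNgt /cut /cutu /pos => h.
have -> : Num.max (1 - x ^+ 2 - eps n) 0 = 0 by apply/max_idPr; lra.
by rewrite expr0n mul0r.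
Qed.

(* Since [dcut n] is at most of the order of the inverse distance to the ends, functions that vanish
   linearly there survive the cutoff in H^1. *)
Lemma dcut_bound n x : -1 < x < 1 -> `|dcut n x| * (1 - x ^+ 2) <= 4.
Proof.
move=> /andP[x1 x2]; have e0 := eps_gt0 n; have d0 := cutden_gt0 n x.
have m0 : 0 <= cutu n x by exact: pos_ge0.
have hm : 1 - x ^+ 2 <= cutu n x + eps n.
  have : 1 - x ^+ 2 - eps n <= cutu n x by rewrite /cutu /pos le_max lexx.
  by lra.
have hx0 : 0 <= 1 - x ^+ 2 by nra.
have xn : `|x| <= 1 by rewrite ler_norml; apply/andP; split; lra.
set m := cutu n x in d0 m0 hm *; set e := eps n in e0 d0 hm *.
have q0 : 0 < (m ^+ 2 + e ^+ 2) ^+ 2 by rewrite exprn_gt0.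
have K0 : 0 <= e ^+ 2 / (m ^+ 2 + e ^+ 2) ^+ 2 by rewrite divr_ge0 ?sqr_ge0.
have -> : `|dcut n x| = 2 * m * (2 * `|x|) * (e ^+ 2 / (m ^+ 2 + e ^+ 2) ^+ 2).
  rewrite /dcut -/m -/e (_ : _ * _ = 2 * m * 2 * (e ^+ 2 / (m ^+ 2 + e ^+ 2) ^+ 2) * - x); last by ring.
  rewrite normrM normrN ger0_norm; first by ring.
  by rewrite mulr_ge0// mulr_ge0// mulr_ge0.
have step : 2 * m * (2 * `|x|) * (e ^+ 2 / (m ^+ 2 + e ^+ 2) ^+ 2) * (1 - x ^+ 2)
   <= 2 * m * (2 * 1) * (e ^+ 2 / (m ^+ 2 + e ^+ 2) ^+ 2) * (m + e).
  apply: ler_pM => //.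
    by rewrite mulr_ge0// mulr_ge0// mulr_ge0.
  apply: ler_wpM2r; first exact: K0.
  by apply: ler_wpM2l; [rewrite mulr_ge0|apply: ler_wpM2l].
apply: (le_trans step).
rewrite (_ : _ * (m + e) = (4 * m * e ^+ 2 * (m + e)) / (m ^+ 2 + e ^+ 2) ^+ 2); last first.
  by field; rewrite gt_eqF.
rewrite ler_pdivrMr//.
have h1 := sqr_ge0 (m - e); have h2 := sqr_ge0 (m ^+ 2 - e ^+ 2).
have h3 := sqr_ge0 (m * (m - e)); have h4 := sqr_ge0 (e * (m - e)).
have h5 : 0 <= m ^+ 4 by rewrite exprn_ge0.
have h6 : 0 <= e ^+ 4 by rewrite exprn_ge0// ltW.
nra.
Qed.

Lemma eps_cvg0 : eps n @[n --> \oo] --> (0 : R).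
Proof. exact: cvg_harmonic. Qed.

Lemma cutu_cvg (x : R) : -1 < x < 1 -> cutu n x @[n --> \oo] --> 1 - x ^+ 2.
Proof.
move=> /andP[x1 x2]; have p : 0 <= 1 - x ^+ 2 by nra.
have h : pos (1 - x ^+ 2 - eps n) @[n --> \oo] --> pos (1 - x ^+ 2 - 0).
  have c : 1 - x ^+ 2 - eps n @[n --> \oo] --> 1 - x ^+ 2 - 0.
    by apply: cvgB; [exact: cvg_cst|exact: eps_cvg0].
  exact: (cvg_comp _ _ c (@pos_cont _)).
by move: h; rewrite subr0 {2}/pos max_l.
Qed.

Let sq_cvg (u : nat -> R) (l : R) : u n @[n --> \oo] --> l -> u n ^+ 2 @[n --> \oo] --> l ^+ 2.
Proof. by move=> h; rewrite expr2; under eq_fun do rewrite expr2; exact: cvgM. Qed.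

Let den_cvg (x : R) : -1 < x < 1 ->
  cutu n x ^+ 2 + eps n ^+ 2 @[n --> \oo] --> (1 - x ^+ 2) ^+ 2.
Proof.
move=> xI; rewrite -[X in _ --> X]addr0 -[X in _ --> _ + X](@expr0n R 2).
by apply: cvgD; [exact/sq_cvg/cutu_cvg|exact/sq_cvg/eps_cvg0].
Qed.

Let sq0 (x : R) : -1 < x < 1 -> (1 - x ^+ 2) != 0.
Proof. by move=> /andP[x1 x2]; rewrite gt_eqF//; nra. Qed.

Lemma cut_cvg (x : R) : -1 < x < 1 -> cut n x @[n --> \oo] --> (1 : R).
Proof.
move=> xI; rewrite -(divff (expf_neq0 2 (sq0 xI))).
apply: cvgM; first exact/sq_cvg/cutu_cvg.
by apply: cvgV; [exact: expf_neq0 (sq0 xI)|exact: den_cvg].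
Qed.

Lemma dcut_cvg (x : R) : -1 < x < 1 -> dcut n x @[n --> \oo] --> (0 : R).
Proof.
move=> xI.
have -> : (0 : R) = 2 * (1 - x ^+ 2) * (- 2 * x) * (0 ^+ 2 / ((1 - x ^+ 2) ^+ 2) ^+ 2).
  by rewrite expr0n /= mul0r mulr0.
apply: cvgM.
  by apply: cvgM; [apply: cvgM; [exact: cvg_cst|exact: cutu_cvg]|exact: cvg_cst].
apply: cvgM; first exact/sq_cvg/eps_cvg0.
by apply: cvgV; [rewrite !expf_neq0// sq0|apply/sq_cvg/den_cvg].
Qed.

(** * Products with cutoffs in the weak formulations *)

Section product_test.
Variables (w w' v v' : R -> R).
Hypothesis dw : forall x : R, is_derive x 1 w (w' x).
Hypothesis cw' : continuous w'.
Hypothesis dv : forall x : R, is_derive x 1 v (v' x).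
Hypothesis cv' : continuous v'.

Definition ctest n (u : R -> R) x := cut n x * u x.
Definition dctest n (u u' : R -> R) x := dcut n x * u x + cut n x * u' x.

Lemma is_derive_ctest n (u u' : R -> R) : (forall x : R, is_derive x 1 u (u' x)) ->
  forall x : R, is_derive x 1 (ctest n u) (dctest n u u' x).
Proof.
move=> du x; have ? := du x; have ? := is_derive_cut n x.
by apply: is_derive_eq; rewrite /GRing.scale /= /dctest; ring.
Qed.

Lemma dctest_cont n (u u' : R -> R) : (forall x : R, is_derive x 1 u (u' x)) -> continuous u' ->
  continuous (dctest n u u').
Proof.
move=> du cu'; have cu := is_derive_continuous du; move=> x; apply: cvgD; apply: cvgM.
- exact: dcut_cont.
- exact: cu.
- exact: cut_cont.
- exact: cu'.
Qed.

Definition phi n (p : R * R) : R := ctest n w p.1 * ctest n v p.2.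

Lemma dx_prod (a b a' : R -> R) : (forall x : R, is_derive x 1 a (a' x)) ->
  dx (fun p : R * R => a p.1 * b p.2) = (fun p => a' p.1 * b p.2).
Proof.
move=> da; apply/funext => p; rewrite /dx derive1E /=.
have ? := da p.1.
have : is_derive p.1 1 (fun t => a t * b p.2) (a' p.1 * b p.2).
  by apply: is_derive_eq; rewrite /GRing.scale /=; ring.
by case.
Qed.

Lemma dy_prod (a b b' : R -> R) : (forall x : R, is_derive x 1 b (b' x)) ->
  dy (fun p : R * R => a p.1 * b p.2) = (fun p => a p.1 * b' p.2).
Proof.
move=> db; apply/funext => p; rewrite /dy derive1E /=.
have ? := db p.2.
have : is_derive p.2 1 (fun t => a p.1 * b t) (a p.1 * b' p.2).
  by apply: is_derive_eq; rewrite /GRing.scale /=; ring.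
by case.
Qed.

Lemma Ck1_prod (a a' b b' : R -> R) : (forall x : R, is_derive x 1 a (a' x)) -> continuous a' ->
  (forall x : R, is_derive x 1 b (b' x)) -> continuous b' ->
  Ck 1 setT (fun p : R * R => a p.1 * b p.2).
Proof.
move=> da ca' db cb'; have ca := is_derive_continuous da; have cb := is_derive_continuous db.
split; first by move=> p _; exact: prod_cont.
split.
- move=> p _; have ? := da p.1.
  have : is_derive p.1 1 (fun t => a t * b p.2) (a' p.1 * b p.2).
    by apply: is_derive_eq; rewrite /GRing.scale /=; ring.
  by case.
- move=> p _; have ? := db p.2.
  have : is_derive p.2 1 (fun t => a p.1 * b t) (a p.1 * b' p.2).
    by apply: is_derive_eq; rewrite /GRing.scale /=; ring.
  by case.
- by split=> // p _; rewrite (dx_prod _ da); exact: prod_cont.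
- by split=> // p _; rewrite (dy_prod _ db); exact: prod_cont.
Qed.

Lemma phi_dx n : dx (phi n) = (fun p => dctest n w w' p.1 * ctest n v p.2).
Proof. exact/dx_prod/is_derive_ctest. Qed.

Lemma phi_dy n : dy (phi n) = (fun p => ctest n w p.1 * dctest n v v' p.2).
Proof. exact/dy_prod/is_derive_ctest. Qed.

Lemma phi_test n : test_fun (phi n).
Proof.
pose K : set (R * R) := [set p | eps n <= 1 - p.1 ^+ 2] `&` [set p | eps n <= 1 - p.2 ^+ 2].
have c1 : continuous (fun p : R * R => 1 - p.1 ^+ 2).
  move=> p; apply: cvgB; first exact: cvg_cst.
  by apply: (continuous_comp (g := fun x : R => x ^+ 2)); [exact: cvg_fst|exact: exprn_continuous].
have c2 : continuous (fun p : R * R => 1 - p.2 ^+ 2).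
  move=> p; apply: cvgB; first exact: cvg_cst.
  by apply: (continuous_comp (g := fun x : R => x ^+ 2)); [exact: cvg_snd|exact: exprn_continuous].
have cK : closed K.
  apply: closedI.
    exact: (closed_comp (fun p _ => c1 p) (@closed_ge R (eps n))).
  exact: (closed_comp (fun p _ => c2 p) (@closed_ge R (eps n))).
have sub : closure [set p | phi n p != 0] `<=` K.
  have -> : K = closure K by apply/closure_id.
  apply: closure_subset => p /=; rewrite /phi /ctest => h.
  have h1 : cut n p.1 != 0 by apply: contraNneq h => ->; rewrite !mul0r.
  have h2 : cut n p.2 != 0 by apply: contraNneq h => ->; rewrite mul0r mulr0.
  by split=> /=; apply: ltW; apply: cut_supp.
have KG : K `<=` @G1 R.
  move=> [x y] [/= h1 h2]; have e0 := eps_gt0 n; apply/QP.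
  by split; apply/andP; split; nra.
split.
- apply: Ck1_prod; [exact: is_derive_ctest|exact: dctest_cont|exact: is_derive_ctest|exact: dctest_cont].
- pose B : set (R * R) := (`[-1, 1]%classic : set R) `*` (`[-1, 1]%classic : set R).
  apply: (@subclosed_compact _ _ B).
  + exact: closed_closure.
  + by apply: compact_setX; exact: segment_compact.
  + move=> p /sub/KG; rewrite /G1 /setX /= !in_itv /= => -[/andP[? ?] /andP[? ?]].
    by split; apply/andP; split; apply: ltW.
- exact: subset_trans sub KG.
Qed.

Lemma ctest_le n (u : R -> R) (B x : R) : `|u x| <= B -> `|ctest n u x| <= B.
Proof.
move=> uB; rewrite /ctest normrM; apply: le_trans uB.
by rewrite ler_piMl// cut_norm.
Qed.

Lemma ctest_cvg (u : R -> R) (x : R) : -1 < x < 1 -> ctest n u x @[n --> \oo] --> u x.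
Proof.
by move=> xI; rewrite -[X in _ --> X]mul1r; apply: cvgM; [exact: cut_cvg|exact: cvg_cst].
Qed.

Lemma dctest_cvg (u u' : R -> R) (x : R) : -1 < x < 1 -> dctest n u u' x @[n --> \oo] --> u' x.
Proof.
move=> xI; rewrite -[X in _ --> X]add0r -(mul0r (u x)) -[X in _ --> _ + X]mul1r.
apply: cvgD; apply: cvgM; [exact: dcut_cvg|exact: cvg_cst|exact: cut_cvg|exact: cvg_cst].
Qed.

(** Linear decay at both ends, written with [1 - x ^+ 2] to match [dcut_bound]. *)
Definition vanishing (u : R -> R) := exists B, forall x, -1 < x < 1 -> `|u x| <= B * (1 - x ^+ 2).

Lemma dctest_le n (u u' : R -> R) (B C x : R) : -1 < x < 1 ->
  `|u x| <= B * (1 - x ^+ 2) -> `|u' x| <= C -> `|dctest n u u' x| <= 4 * `|B| + C.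
Proof.
move=> xI uB uC; rewrite /dctest; apply: le_trans (ler_normD _ _) _; apply: lerD.
  rewrite normrM; have x0 : 0 <= 1 - x ^+ 2 by case/andP: xI => *; nra.
  apply: (@le_trans _ _ (`|dcut n x| * (`|B| * (1 - x ^+ 2)))).
    by rewrite ler_wpM2l// (le_trans uB)// ler_wpM2r// ler_norm.
  rewrite mulrCA [X in _ <= X]mulrC ler_wpM2l//; exact: dcut_bound.
by rewrite normrM (le_trans _ uC)// ler_piMl// cut_norm.
Qed.

Let cw := is_derive_continuous dw.
Let cv := is_derive_continuous dv.

Let bnd (u : R -> R) : continuous u -> exists B, forall x, -1 < x < 1 -> `|u x| <= B.
Proof.
move=> cu; have [B hB] := cont_bounded cu; exists B => x /andP[x1 x2]; apply: hB.
by rewrite /= in_itv /= !ltW.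
Qed.

Lemma phi_cvg (f : R * R -> R) : L1on mu2 Q f ->
  ip mu2 Q f (phi n) @[n --> \oo] --> ip mu2 Q f (fun p => w p.1 * v p.2).
Proof.
move=> lf; have [A hA] := bnd cw; have [B hB] := bnd cv.
apply: (@bounded_cvg_Rint _ _ _ mu2 Q f phi _ (A * B)) => //.
- by move=> n; apply: meas2; apply: prod_cont; apply: contM => //; exact: cut_cont.
- move=> n [x y] /QP[xI yI]; rewrite normrM; apply: ler_pM => //; apply: ctest_le; auto.
- by move=> [x y] /QP[xI yI]; apply: cvgM; exact: ctest_cvg.
Qed.

(** The [x]-derivative falls on the cutoff in [x] alone, so decay is asked of [w] and not of [v].
    This asymmetry later allows a sine in one variable and a cosine in the other. *)
Lemma phi_dx_cvg (f : R * R -> R) : L1on mu2 Q f -> vanishing w ->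
  ip mu2 Q f (dx (phi n)) @[n --> \oo] --> ip mu2 Q f (fun p => w' p.1 * v p.2).
Proof.
move=> lf [A hA]; have [A' hA'] := bnd cw'; have [B hB] := bnd cv.
apply: (@bounded_cvg_Rint _ _ _ mu2 Q f (fun n => dx (phi n)) _ ((4 * `|A| + A') * B)) => //.
- move=> n; rewrite phi_dx; apply: meas2; apply: prod_cont; first exact: dctest_cont.
  by apply: contM => //; exact: cut_cont.
- move=> n [x y] /QP[xI yI]; rewrite phi_dx normrM; apply: ler_pM => //.
    by apply: dctest_le; auto.
  by apply: ctest_le; auto.
- move=> [x y] /QP[xI yI]; under eq_fun do rewrite phi_dx.
  by apply: cvgM; [exact: dctest_cvg|exact: ctest_cvg].
Qed.

Lemma phi_dy_cvg (f : R * R -> R) : L1on mu2 Q f -> vanishing v ->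
  ip mu2 Q f (dy (phi n)) @[n --> \oo] --> ip mu2 Q f (fun p => w p.1 * v' p.2).
Proof.
move=> lf [A hA]; have [A' hA'] := bnd cv'; have [B hB] := bnd cw.
apply: (@bounded_cvg_Rint _ _ _ mu2 Q f (fun n => dy (phi n)) _ (B * (4 * `|A| + A'))) => //.
- move=> n; rewrite phi_dy; apply: meas2; apply: prod_cont; last exact: dctest_cont.
  by apply: contM => //; exact: cut_cont.
- move=> n [x y] /QP[xI yI]; rewrite phi_dy normrM; apply: ler_pM => //.
    by apply: ctest_le; auto.
  by apply: dctest_le; auto.
- move=> [x y] /QP[xI yI]; under eq_fun do rewrite phi_dy.
  by apply: cvgM; [exact: ctest_cvg|exact: dctest_cvg].
Qed.

Let L2L1 (f : R * R -> R) : L2 f -> L1on mu2 Q f.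
Proof. by move=> h; apply: L2on_L1. Qed.

Lemma H1_weak_dx (h hx hy : R * R -> R) : H1_grad h hx hy -> vanishing w ->
  ip mu2 Q h (fun p => w' p.1 * v p.2) = - ip mu2 Q hx (fun p => w p.1 * v p.2).
Proof.
move=> [lh lhx lhy H] vw.
have c1 := phi_dx_cvg (L2L1 lh) vw.
have c2 : - ip mu2 Q hx (phi n) @[n --> \oo] --> - ip mu2 Q hx (fun p => w p.1 * v p.2).
  by apply: cvgN; exact: phi_cvg (L2L1 lhx).
apply: (cvg_eq c1 c2) => n.
by have [h1 _] := H _ (phi_test n); rewrite /ip h1.
Qed.

Lemma H1_weak_dy (h hx hy : R * R -> R) : H1_grad h hx hy -> vanishing v ->
  ip mu2 Q h (fun p => w p.1 * v' p.2) = - ip mu2 Q hy (fun p => w p.1 * v p.2).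
Proof.
move=> [lh lhx lhy H] vw.
have c1 := phi_dy_cvg (L2L1 lh) vw.
have c2 : - ip mu2 Q hy (phi n) @[n --> \oo] --> - ip mu2 Q hy (fun p => w p.1 * v p.2).
  by apply: cvgN; exact: phi_cvg (L2L1 lhy).
apply: (cvg_eq c1 c2) => n.
by have [_ h1] := H _ (phi_test n); rewrite /ip h1.
Qed.

(** A trace brings its own weak gradient; this identifies its coefficients with those of the
    gradient in the harmonic equation. *)
Lemma H1_grad_unique (h hx hy hx' hy' : R * R -> R) :
  H1_grad h hx hy -> H1_grad h hx' hy' ->
  ip mu2 Q hx (fun p => w p.1 * v p.2) = ip mu2 Q hx' (fun p => w p.1 * v p.2) /\
  ip mu2 Q hy (fun p => w p.1 * v p.2) = ip mu2 Q hy' (fun p => w p.1 * v p.2).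
Proof.
move=> [lh lhx lhy H] [_ lhx' lhy' H']; split.
  apply: (cvg_eq (phi_cvg (L2L1 lhx)) (phi_cvg (L2L1 lhx'))) => n.
  have [h1 _] := H _ (phi_test n); have [h1' _] := H' _ (phi_test n).
  by apply: oppr_inj; rewrite /ip -h1 h1'.
apply: (cvg_eq (phi_cvg (L2L1 lhy)) (phi_cvg (L2L1 lhy'))) => n.
have [_ h1] := H _ (phi_test n); have [_ h1'] := H' _ (phi_test n).
by apply: oppr_inj; rewrite /ip -h1 h1'.
Qed.

Lemma harmonic_weak (hx hy : R * R -> R) : L2 hx -> L2 hy ->
  (forall phi, test_fun phi ->
     Rintegral mu2 (G1 (R:=R)) (fun p => hx p * dx phi p + hy p * dy phi p) = 0) ->
  vanishing w -> vanishing v ->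
  ip mu2 Q hx (fun p => w' p.1 * v p.2) + ip mu2 Q hy (fun p => w p.1 * v' p.2) = 0.
Proof.
move=> lhx lhy H vw vv.
have c1 : ip mu2 Q hx (dx (phi n)) + ip mu2 Q hy (dy (phi n)) @[n --> \oo] -->
    ip mu2 Q hx (fun p => w' p.1 * v p.2) + ip mu2 Q hy (fun p => w p.1 * v' p.2).
  by apply: cvgD; [exact: phi_dx_cvg (L2L1 lhx) vw|exact: phi_dy_cvg (L2L1 lhy) vv].
have c0 : (fun _ : nat => 0 : R) n @[n --> \oo] --> (0 : R) by exact: cvg_cst.
apply: (cvg_eq c1 c0) => n.
rewrite -(H _ (phi_test n)) /ip -RintegralD//.
  apply: L1onM => //; first exact: L2L1.
    by rewrite phi_dx; apply: meas2; apply: prod_cont; [exact: dctest_cont|apply: contM => //; exact: cut_cont].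
  by rewrite phi_dx; apply: prod_bounded; [exact: dctest_cont|apply: contM => //; exact: cut_cont].
apply: L1onM => //; first exact: L2L1.
  by rewrite phi_dy; apply: meas2; apply: prod_cont; [apply: contM => //; exact: cut_cont|exact: dctest_cont].
by rewrite phi_dy; apply: prod_bounded; [apply: contM => //; exact: cut_cont|exact: dctest_cont].
Qed.

End product_test.
End Cutoff.

(** * Functions of class C^1 up to the boundary *)

Section Calculus2.
Variable R : realType.
Local Notation mu := (@lebesgue_measure R).
Local Notation T2 := (measurableTypeR R * measurableTypeR R)%type.
Local Notation mu2 := (mu \x mu)%E.
Local Notation J := (`[-1, 1]%classic : set (measurableTypeR R)).
Local Notation Q := (@G1 R : set T2).
Let mJ := @mJ R.
Let muJ_lty := @muJ_lty R.
Let mQ := @mQ R.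
Let muQ_lty := @muQ_lty R.
Hint Resolve mQ muQ_lty mJ muJ_lty : core.
Implicit Types (f g u : R * R -> R) (U : set (R * R)).

Lemma cont_swap : continuous (fun q : R * R => (q.2, q.1)).
Proof.
by move=> [a b]; exact: (cvg_pair (F := nbhs (a, b)) (G := nbhs b) (H := nbhs a) cvg_snd cvg_fst).
Qed.

Lemma cont_pairl (c : R) : continuous (fun t : R => (t, c)).
Proof.
by move=> q; exact: (cvg_pair (F := nbhs q) (G := nbhs q) (H := nbhs c) cvg_id (cvg_cst c)).
Qed.

Lemma cont_pairr (c : R) : continuous (fun t : R => (c, t)).
Proof.
by move=> q; exact: (cvg_pair (F := nbhs q) (G := nbhs c) (H := nbhs q) (cvg_cst c) cvg_id).
Qed.

Lemma cont_at_ext U f g p : open U -> (forall p, U p -> f p = g p) -> U p ->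
  {for p, continuous f} -> {for p, continuous g}.
Proof.
move=> oU fg Up cf; have h : f @ p --> g p by rewrite -fg//; exact: cf.
apply: cvg_trans h; apply: near_eq_cvg.
by have : nbhs p U by [exact: open_nbhs_nbhs]; apply: filterS => q Uq; rewrite fg.
Qed.

Lemma near_fst U (p : R * R) : open U -> U p -> \forall t \near p.1, U (t, p.2).
Proof.
move=> oU Up; have : nbhs p U by exact: open_nbhs_nbhs.
by case: p Up => a b Up h; exact: (cont_pairl h).
Qed.

Lemma near_snd U (p : R * R) : open U -> U p -> \forall t \near p.2, U (p.1, t).
Proof.
move=> oU Up; have : nbhs p U by exact: open_nbhs_nbhs.
by case: p Up => a b Up h; exact: (cont_pairr h).
Qed.

Lemma dx_ext U f g : open U -> (forall p, U p -> f p = g p) -> forall p, U p -> dx f p = dx g p.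
Proof.
move=> oU fg p Up; rewrite /dx !derive1E; apply: near_eq_derive => //.
by have := near_fst oU Up; apply: filterS => t Ut; exact: fg.
Qed.

Lemma dy_ext U f g : open U -> (forall p, U p -> f p = g p) -> forall p, U p -> dy f p = dy g p.
Proof.
move=> oU fg p Up; rewrite /dy !derive1E; apply: near_eq_derive => //.
by have := near_snd oU Up; apply: filterS => t Ut; exact: fg.
Qed.

Lemma Ck_ext k U f g : open U -> (forall p, U p -> f p = g p) -> Ck k U f -> Ck k U g.
Proof.
move=> oU; elim: k f g => [|k IH] f g fg /= [cf hf].
  by split=> // p Up; exact: cont_at_ext oU fg Up (cf p Up).
have [fx fy kx ky] := hf; split.
  by move=> p Up; exact: cont_at_ext oU fg Up (cf p Up).
split.
- move=> p Up; apply: near_eq_derivable (fx p Up) => //.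
  by have := near_fst oU Up; apply: filterS => t Ut; exact: fg.
- move=> p Up; apply: near_eq_derivable (fy p Up) => //.
  by have := near_snd oU Up; apply: filterS => t Ut; exact: fg.
- apply: IH kx => p Up; exact: dx_ext fg p Up.
- apply: IH ky => p Up; exact: dy_ext fg p Up.
Qed.

Lemma dxD f g p : derivable (fun t : R => f (t, p.2)) p.1 1 -> derivable (fun t : R => g (t, p.2)) p.1 1 ->
  dx (fun q => f q + g q) p = dx f p + dx g p.
Proof. by move=> df dg; rewrite /dx !derive1E; exact: deriveD df dg. Qed.

Lemma dyD f g p : derivable (fun t : R => f (p.1, t)) p.2 1 -> derivable (fun t : R => g (p.1, t)) p.2 1 ->
  dy (fun q => f q + g q) p = dy f p + dy g p.
Proof. by move=> df dg; rewrite /dy !derive1E; exact: deriveD df dg. Qed.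

Lemma Ck_add k U f g : open U -> Ck k U f -> Ck k U g -> Ck k U (fun p => f p + g p).
Proof.
move=> oU; elim: k f g => [|k IH] f g /= [cf hf] [cg hg].
  by split=> // p Up; apply: cvgD; [exact: cf|exact: cg].
have [fx fy kx ky] := hf; have [gx gy lx ly] := hg; split.
  by move=> p Up; apply: cvgD; [exact: cf|exact: cg].
split.
- by move=> p Up; apply: derivableD; [exact: fx|exact: gx].
- by move=> p Up; apply: derivableD; [exact: fy|exact: gy].
- apply: Ck_ext (IH _ _ kx lx) => // p Up; by rewrite dxD//; [exact: fx|exact: gx].
- apply: Ck_ext (IH _ _ ky ly) => // p Up; by rewrite dyD//; [exact: fy|exact: gy].
Qed.

Lemma Ck_swp k U f : Ck k U f -> Ck k [set p | U (p.2, p.1)] (swp f).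
Proof.
elim: k f => [|k IH] f /= [cf hf].
  by split=> // p Up; apply: (continuous_comp (@cont_swap p)); exact: cf.
have [fx fy kx ky] := hf; split.
  by move=> p Up; apply: (continuous_comp (@cont_swap p)); exact: cf.
split.
- by move=> p Up; exact: (fy (p.2, p.1) Up).
- by move=> p Up; exact: (fx (p.2, p.1) Up).
- exact: (IH _ ky).
- exact: (IH _ kx).
Qed.

(** Approximants of a trace are C^1 on a neighbourhood of the closed square, so continuity in the
    plane and two-sided derivatives make sense at its boundary points too. *)
Definition C1sq u := forall x y, J x -> J y ->
  [/\ {for (x, y), continuous u}, {for (x, y), continuous (dx u)}, {for (x, y), continuous (dy u)},
      is_derive x 1 (fun t => u (t, y)) (dx u (x, y)) &
      is_derive y 1 (fun t => u (x, t)) (dy u (x, y))].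

Lemma closure_G1 (x y : R) : J x -> J y -> closure (@G1 R) (x, y).
Proof.
rewrite /= !in_itv /= => /andP[x1 x2] /andP[y1 y2] B; rewrite -nbhs_ballE => -[e /= e0 he].
pose t := Num.min (e / 2) (2^-1).
have t0 : 0 < t by rewrite lt_min divr_gt0//= invr_gt0.
have te : t < e by rewrite gt_min; apply/orP; left; lra.
have th : t <= 2^-1 by rewrite ge_min lexx orbT.
exists ((1 - t) * x, (1 - t) * y); split; first by apply/QP; split; apply/andP; split; nra.
apply: he; split; rewrite /ball /= ltr_norml; apply/andP; split; nra.
Qed.

Lemma Ck1_C1sq U u : open U -> closure (@G1 R) `<=` U -> Ck 1 U u -> C1sq u.
Proof.
move=> oU GU [cu [ux uy [cx _] [cy _]]] x y Jx Jy; have Up := GU _ (closure_G1 Jx Jy).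
split; [exact: cu|exact: cx|exact: cy| |].
- by have := ux _ Up => h; rewrite /dx derive1E; exact: derivableP.
- by have := uy _ Up => h; rewrite /dy derive1E; exact: derivableP.
Qed.

Lemma Ck1T_C1sq u : Ck 1 setT u -> C1sq u.
Proof. by move=> h; apply: Ck1_C1sq h => //; exact: openT. Qed.

Lemma C1sq_swp u : C1sq u -> C1sq (swp u).
Proof.
move=> h x y Jx Jy; have [h1 h2 h3 h4 h5] := h y x Jy Jx.
have cs := @cont_swap (x, y).
have ex : dx (swp u) = swp (dy u) by [].
have ey : dy (swp u) = swp (dx u) by [].
rewrite ex ey; split.
- exact: (@continuous_comp _ _ _ _ u _ cs h1).
- exact: (@continuous_comp _ _ _ _ (dy u) _ cs h3).
- exact: (@continuous_comp _ _ _ _ (dx u) _ cs h2).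
- exact: h5.
- exact: h4.
Qed.

Definition contsq f := forall x y, J x -> J y -> {for (x, y), continuous f}.

Lemma contsq_bounded f : contsq f -> exists M, forall x y, J x -> J y -> `|f (x, y)| <= M.
Proof.
move=> cf; pose B : set (R * R) := (`[-1, 1]%classic : set R) `*` (`[-1, 1]%classic : set R).
have cB : compact B by apply: compact_setX; exact: segment_compact.
have wf : {within B, continuous f}.
  by apply: continuous_in_subspaceT => -[x y] /set_mem [/= Jx Jy]; exact: cf.
have [M [_ hM]] := compact_bounded (continuous_compact wf cB).
exists (M + 1) => x y Jx Jy; apply: (hM (M + 1)); first by rewrite ltrDl.
by exists (x, y).
Qed.

Lemma I_J (x : R) : -1 < x < 1 -> J x.
Proof. by move=> /andP[? ?]; rewrite /= in_itv /= !ltW. Qed.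

Lemma contsq_meas f : contsq f -> measurable_fun Q f.
Proof.
move=> cf; apply: cont_meas2; first exact: open_Q.
by move=> [x y] /QP[xI yI]; apply: cf; exact: I_J.
Qed.

Lemma contsq_bnd f : contsq f -> bounded_on Q f.
Proof.
by move=> /contsq_bounded[M hM]; exists M => -[x y] /QP[xI yI]; apply: hM; exact: I_J.
Qed.

Lemma contsq_L1 f : contsq f -> L1on mu2 Q f.
Proof. by move=> cf; apply: L1on_bounded => //; [exact: contsq_meas|exact: contsq_bnd]. Qed.

Lemma contsq_L2 f : contsq f -> L2on mu2 Q f.
Proof. by move=> cf; apply: L2on_bounded => //; [exact: contsq_meas|exact: contsq_bnd]. Qed.

Lemma contsqM f g : contsq f -> contsq g -> contsq (fun p => f p * g p).
Proof. by move=> cf cg x y Jx Jy; apply: cvgM; [exact: cf|exact: cg]. Qed.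

Lemma contsqD f g : contsq f -> contsq g -> contsq (fun p => f p + g p).
Proof. by move=> cf cg x y Jx Jy; apply: cvgD; [exact: cf|exact: cg]. Qed.

Lemma cont_contsq f : continuous f -> contsq f.
Proof. by move=> cf x y _ _; exact: cf. Qed.

Lemma contsq_sec f y : contsq f -> J y -> forall x, J x -> {for x, continuous (fun t => f (t, y))}.
Proof.
move=> cf Jy x Jx; by apply: (continuous_comp (@cont_pairl y x)); exact: cf.
Qed.

Lemma contsq_secy f x : contsq f -> J x -> forall y, J y -> {for y, continuous (fun t => f (x, t))}.
Proof.
move=> cf Jx y Jy; by apply: (continuous_comp (@cont_pairr x y)); exact: cf.
Qed.

Lemma within_J (f : R -> R) : (forall x, J x -> {for x, continuous f}) -> {within J, continuous f}.
Proof. by move=> h; apply: continuous_in_subspaceT => x /set_mem; exact: h. Qed.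

Lemma contsq_secy_L2 f x : contsq f -> J x -> L2on mu J (fun t => f (x, t)).
Proof.
move=> cf Jx; have w := within_J (contsq_secy cf Jx).
by apply: L2on_bounded => //; [exact: L1on_meas (within_cont_L1 w)|exact: within_cont_bounded].
Qed.

Lemma FTC_Jloc (F f : R -> R) : (forall x, J x -> is_derive x 1 F (f x)) ->
  (forall x, J x -> {for x, continuous f}) -> \int[mu]_(x in J) f x = F 1 - F (-1).
Proof.
move=> dF cf; have lt11 : (-1 : R) < 1 by lra.
have J1 : J 1 by rewrite /= in_itv /=; apply/andP; split; lra.
have JN1 : J (-1) by rewrite /= in_itv /=; apply/andP; split; lra.
have cF x : J x -> {for x, continuous F}.
  by move=> Jx; apply: differentiable_continuous; apply/derivable1_diffP; case: (dF x Jx).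
have := @continuous_FTC2 R f F (-1) 1 lt11 (within_J cf).
rewrite /Rintegral => -> //.
- split; first by move=> x; rewrite in_itv /= => /I_J Jx; case: (dF x Jx).
  + by apply: cvg_at_right_filter; exact: cF.
  + by apply: cvg_at_left_filter; exact: cF.
- by move=> x; rewrite in_itv /= => /I_J Jx; rewrite derive1E; case: (dF x Jx).
Qed.

Lemma div_x (F f : R * R -> R) : contsq f ->
  (forall x y, J x -> J y -> is_derive x 1 (fun t => F (t, y)) (f (x, y))) ->
  \int[mu2]_(p in Q) f p = \int[mu]_(y in J) (F (1, y) - F (-1, y)).
Proof.
move=> cf dF; have lf := contsq_L1 cf.
rewrite -(swp_int lf) (fub1 (swp_L1 lf)); apply: intJ_eq => y Jy.
rewrite /sec1 /swp /=; apply: (@FTC_Jloc (fun t => F (t, y)) (fun t => f (t, y))).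
  by move=> x Jx; exact: dF.
exact: contsq_sec.
Qed.

Lemma green_x u (w w' v : R -> R) : C1sq u -> (forall x : R, is_derive x 1 w (w' x)) ->
  continuous w' -> continuous v ->
  ip mu2 Q (dx u) (fun p => w p.1 * v p.2) =
  w 1 * ip mu J (fun y => u (1, y)) v - w (-1) * ip mu J (fun y => u (-1, y)) v
  - ip mu2 Q u (fun p => w' p.1 * v p.2).
Proof.
move=> cu dw cw' cv; have cw := is_derive_continuous dw.
have c0 : contsq u by move=> x y Jx Jy; case: (cu x y Jx Jy).
have c1 : contsq (dx u) by move=> x y Jx Jy; case: (cu x y Jx Jy).
have cwv : contsq (fun p : R * R => w p.1 * v p.2) by apply: cont_contsq; exact: prod_cont.
have cwv' : contsq (fun p : R * R => w' p.1 * v p.2) by apply: cont_contsq; exact: prod_cont.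
have J1 : J 1 by rewrite /= in_itv /=; apply/andP; split; lra.
have JN1 : J (-1) by rewrite /= in_itv /=; apply/andP; split; lra.
have lv : L2on mu J v by exact: cont_L2.
apply/eqP; rewrite -subr_eq opprK addrC /ip -RintegralD//; last 2 first.
- exact/contsq_L1/contsqM.
- exact/contsq_L1/contsqM.
pose f p := u p * (w' p.1 * v p.2) + dx u p * (w p.1 * v p.2).
have cf : contsq f by apply: contsqD; exact: contsqM.
have dF x y : J x -> J y -> is_derive x 1 (fun t => u (t, y) * (w t * v y)) (f (x, y)).
  move=> Jx Jy; have [_ _ _ d _] := cu x y Jx Jy; have ? := dw x.
  by apply: is_derive_eq; rewrite /GRing.scale /f /=; ring.
apply/eqP; rewrite [LHS](@div_x (fun p => u p * (w p.1 * v p.2)) f cf dF) /=.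
rewrite -RintegralZl//; last by apply: L2on_mul => //; exact: contsq_secy_L2.
rewrite -RintegralZl//; last by apply: L2on_mul => //; exact: contsq_secy_L2.
rewrite -RintegralB//; last 2 first.
- by apply: L1onZ => //; apply: L2on_mul => //; exact: contsq_secy_L2.
- by apply: L1onZ => //; apply: L2on_mul => //; exact: contsq_secy_L2.
by apply: intJ_eq => y _ /=; ring.
Qed.

(** Integrates the [x]-derivative of [s (1 + s x) / 2 * u^2]: the weight reduces this function to
    [s u^2] on the side [x = s] and to 0 on the opposite side. *)
Lemma trace_ineq u (s : R) : C1sq u -> s = 1 \/ s = -1 ->
  ip mu J (fun y => u (s, y)) (fun y => u (s, y)) <=
  2 * (ip mu2 Q u u + ip mu2 Q (dx u) (dx u)).
Proof.
move=> cu hs.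
have s2 : s * s = 1 by case: hs => ->; ring.
have c0 : contsq u by move=> x y Jx Jy; case: (cu x y Jx Jy).
have c1 : contsq (dx u) by move=> x y Jx Jy; case: (cu x y Jx Jy).
have cx : contsq (fun p : R * R => s * (1 + s * p.1)).
  move=> x y _ _; apply: cvgM; first exact: cvg_cst.
  by apply: cvgD; [exact: cvg_cst|apply: cvgM; [exact: cvg_cst|exact: cvg_fst]].
pose f p := 2^-1 * (u p * u p) + s * (1 + s * p.1) * (u p * dx u p).
have cf : contsq f.
  apply: contsqD; last by apply: contsqM => //; exact: contsqM.
  apply: contsqM; last exact: contsqM.
  by move=> x y _ _; exact: cvg_cst.
have := @div_x (fun p => s * (1 + s * p.1) / 2 * (u p * u p)) f cf.
have dF x y : J x -> J y ->
   is_derive x 1 (fun t => s * (1 + s * t) / 2 * (u (t, y) * u (t, y))) (f (x, y)).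
  move=> Jx Jy; have [_ _ _ d _] := cu x y Jx Jy.
  apply: is_derive_eq; rewrite /GRing.scale /= /f /=.
  by case: hs => ->; field.
move=> /(_ dF) /= E.
have -> : ip mu J (fun y => u (s, y)) (fun y => u (s, y)) = \int[mu2]_(p in Q) f p.
  by rewrite E; apply: intJ_eq => y _ /=; case: hs => ->; field.
rewrite /ip -RintegralD//; last 2 first.
- exact/contsq_L1/contsqM.
- exact/contsq_L1/contsqM.
rewrite -RintegralZl//; last by apply: contsq_L1; apply: contsqD; exact: contsqM.
apply: le_Rintegral => //.
- exact: contsq_L1.
- by apply: L1onZ => //; apply: contsq_L1; apply: contsqD; exact: contsqM.
move=> [x y] /QP[/andP[x1 x2] _]; rewrite /f /=.
set a := u _; set b := dx u _.
have h1 := sqr_ge0 (a - b); have h2 := sqr_ge0 (a + b); have h3 := sqr_ge0 a; have h4 := sqr_ge0 b.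
by case: hs => ->; nra.
Qed.

End Calculus2.

(** * Existence of traces *)

Lemma ip0l d (T : measurableType d) (R : realType) (mu : {measure set T -> \bar R}) (D : set T)
    (f : T -> R) : ip mu D (fun=> 0) f = 0.
Proof. by rewrite /ip /Rintegral integral0_eq// => x _; rewrite mul0r. Qed.

Lemma ip0r d (T : measurableType d) (R : realType) (mu : {measure set T -> \bar R}) (D : set T)
    (f : T -> R) : ip mu D f (fun=> 0) = 0.
Proof. by rewrite ipC ip0l. Qed.

Section TraceExists.
Variable R : realType.
Local Notation mu := (@lebesgue_measure R).
Local Notation T2 := (measurableTypeR R * measurableTypeR R)%type.
Local Notation mu2 := (mu \x mu)%E.
Local Notation J := (`[-1, 1]%classic : set (measurableTypeR R)).
Local Notation Q := (@G1 R : set T2).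
Let mJ := @mJ R.
Let muJ_lty := @muJ_lty R.
Let mQ := @mQ R.
Let muQ_lty := @muQ_lty R.
Hint Resolve mQ muQ_lty mJ muJ_lty : core.

Lemma ipQ_eq (f g f' g' : R * R -> R) : (forall p : R * R, Q p -> f p = f' p) ->
  (forall p : R * R, Q p -> g p = g' p) -> ip mu2 Q f g = ip mu2 Q f' g'.
Proof. by move=> h1 h2; apply: ip_eq. Qed.

Lemma prod_L2 (p q : R -> R) : continuous p -> continuous q ->
  L2on mu2 Q (fun z => p z.1 * q z.2).
Proof. by move=> cp cq; apply: contsq_L2; apply: cont_contsq; exact: prod_cont. Qed.

Lemma ip_prod (p q p' q' : R -> R) : continuous p -> continuous q -> continuous p' -> continuous q' ->
  ip mu2 Q (fun z => p z.1 * q z.2) (fun z => p' z.1 * q' z.2) = ip mu J p p' * ip mu J q q'.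
Proof.
move=> cp cq cp' cq'; rewrite /ip fub1; last by apply: L2on_mul => //; exact: prod_L2.
have l1 : L1on mu J (fun t => p t * p' t) by apply: L2on_mul => //; exact: cont_L2.
have l2 : L1on mu J (fun t => q t * q' t) by apply: L2on_mul => //; exact: cont_L2.
rewrite mulrC -RintegralZl//; apply: intJ_eq => x _.
rewrite /sec1 /= [RHS]mulrC -RintegralZl//; apply: intJ_eq => y _; ring.
Qed.

(** * Tensor products of orthonormal systems *)

Section system.
Variables p q : nat -> R -> R.
Hypothesis cp : forall k, continuous (p k).
Hypothesis cq : forall k, continuous (q k).
Definition orthosys (r : nat -> R -> R) :=
  (forall i j, i != j -> ip mu J (r i) (r j) = 0) /\
  (forall i, ip mu J (r i) (r i) = 1 \/ ip mu J (r i) (r i) = 0).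
Hypothesis op : orthosys p.
Hypothesis oq : orthosys q.

(** Pairs of indices are enumerated through their codes; a number that codes no pair contributes the
    zero vector. *)
Definition sys2 n (z : R * R) : R :=
  if @pickle_inv (nat * nat)%type n is Some kl then p kl.1 z.1 * q kl.2 z.2 else 0.

Lemma sys2P n : (exists kl : nat * nat, pickle_inv n = Some kl /\
  sys2 n = (fun z => p kl.1 z.1 * q kl.2 z.2)) \/ (sys2 n = (fun=> 0)).
Proof.
rewrite /sys2; case: (@pickle_inv (nat * nat)%type n) => [kl|]; last by right.
by left; exists kl.
Qed.

Lemma sys2_L2 n : L2on mu2 Q (sys2 n).
Proof.
by case: (sys2P n) => [[kl [_ ->]]|->]; [exact: prod_L2|exact: L2on_cst].
Qed.

Lemma sys2_orth i j : i != j -> ip mu2 Q (sys2 i) (sys2 j) = 0.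
Proof.
move=> ij; case: (sys2P i) => [[kl [hi ->]]|->]; last first.
  by rewrite ip0l.
case: (sys2P j) => [[kl' [hj ->]]|->]; last first.
  by rewrite ip0r.
rewrite ip_prod//; have [e1|n1] := eqVneq kl.1 kl'.1; last by rewrite op.1// mul0r.
have [e2|n2] := eqVneq kl.2 kl'.2; last by rewrite oq.1// mulr0.
have e : kl = kl' by rewrite [kl]surjective_pairing [kl']surjective_pairing e1 e2.
have := @pickle_invK (nat * nat)%type i; have := @pickle_invK (nat * nat)%type j.
rewrite hi hj /= e => -> E.
by rewrite E eqxx in ij.
Qed.

Lemma sys2_unit i : ip mu2 Q (sys2 i) (sys2 i) = 1 \/ ip mu2 Q (sys2 i) (sys2 i) = 0.
Proof.
case: (sys2P i) => [[kl [hi ->]]|->]; last first.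
  by right; rewrite ip0l.
rewrite ip_prod//; case: (op.2 kl.1) => ->; case: (oq.2 kl.2) => ->;
  rewrite ?mulr1 ?mulr0 ?mul0r; [left|right|right|right] => //.
Qed.

Hypothesis Cp : complete p.
Hypothesis Cq : complete q.

Lemma sys2_complete g : L2on mu2 Q g -> (forall i, ip mu2 Q g (sys2 i) = 0) ->
  {ae mu2, forall z, Q z -> g z = 0}.
Proof.
move=> lg h; apply: (@prod_complete R g p q) => //; first exact: L2on_L1.
move=> k l; have := h (pickle (k, l)); rewrite /sys2 pickleK_inv//.
Qed.

Lemma sys2_cvg f : L2on mu2 Q f ->
  ip mu2 Q (fun x => proj mu2 Q sys2 f n x - f x) (fun x => proj mu2 Q sys2 f n x - f x)
    @[n --> \oo] --> (0 : R).
Proof.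
move=> lf; apply: proj_cvg => //; [exact: sys2_L2|exact: sys2_orth|exact: sys2_unit|].
move=> g lg hg; have h0 := sys2_complete lg hg.
rewrite (@ip_ae _ _ _ _ _ mQ g (fun=> 0) f) => //; [|exact: lg.1|exact: lf.1].
by rewrite ip0l.
Qed.

End system.

Lemma cnn_cont k : continuous (@cnn R k).
Proof. by apply: contM => //; [exact: contC|exact: cn_cont]. Qed.

Lemma orthosys_cnn : orthosys (@cnn R).
Proof.
by split=> [i j ij|i]; rewrite ip_cn ?(negbTE ij)// eqxx; left.
Qed.

Lemma orthosys_sn : orthosys (@sn R).
Proof.
split=> [i j ij|i]; rewrite ip_sn ?(negbTE ij)// eqxx /=; case: ifP; auto.
Qed.

Lemma nrm_neq0 k : nrm R k != 0.
Proof. by rewrite /nrm; case: ifP => // _; rewrite invr_eq0 sqrtr_eq0 -ltNge. Qed.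

Lemma complete_cnn : complete (@cnn R).
Proof.
move=> f lf h; apply: cn_complete => // l; apply: (mulfI (nrm_neq0 l)); rewrite mulr0 -(h l).
rewrite /ip -RintegralZl//; first by apply: intJ_eq => x _; rewrite /cnn; ring.
by apply: L1onM => //; [exact: cont_meas (@cn_cont R l)|exact: cont_bounded (@cn_cont R l)].
Qed.

Lemma complete_sn : complete (@sn R).
Proof. by move=> f lf h; exact: sn_complete. Qed.

Lemma sn_lip l (x y : R) : `|sn l x - sn l y| <= fr R l * `|x - y|.
Proof.
wlog yx : x y / y <= x.
  move=> H; case: (leP y x) => [|/ltW] h; first exact: H.
  by rewrite distrC [in leRHS]distrC; exact: H.
have [|c _ ->] := @MVT_segment R (@sn R l) (fun x => fr R l * cn l x) y x yx
  (fun x _ => is_derive_sn l x).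
  by apply: continuous_subspaceT; exact: sn_cont.
rewrite normrM ler_wpM2r// normrM ger0_norm ?fr_ge0//.
by rewrite -[leRHS]mulr1 ler_wpM2l ?fr_ge0// cn_le1.
Qed.

Lemma vanishing_sn l : vanishing (@sn R l).
Proof.
exists (fr R l) => x /andP[x1 x2].
have h1 := sn_lip l x (-1); have h2 := sn_lip l x 1; have f0 := fr_ge0 R l.
rewrite snN1 subr0 opprK (ger0_norm (_ : 0 <= x + 1)) in h1; last lra.
rewrite sn1 subr0 (ler0_norm (_ : x - 1 <= 0)) in h2; last lra.
case: (leP 0 x) => hx.
  apply: le_trans h2 _; rewrite ler_wpM2l//; nra.
apply: le_trans h1 _; rewrite ler_wpM2l//; nra.
Qed.

Lemma nrm_fr k : nrm R k * fr R k = fr R k.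
Proof. by rewrite /nrm; case: eqP => [->|_]; rewrite ?fr0 ?mulr0 ?mul1r. Qed.

Lemma is_derive_cnn k (x : R) : is_derive x 1 (cnn k) (- fr R k * sn k x).
Proof.
have ? := is_derive_cn k x; apply: is_derive_eq.
by rewrite /GRing.scale /= mulrA mulrN nrm_fr.
Qed.

Lemma is_derive_snn k (x : R) : is_derive x 1 (sn k) (fr R k * cnn k x).
Proof.
apply: is_derive_eq (is_derive_sn k x) _.
by rewrite /cnn mulrA [fr R k * nrm R k]mulrC nrm_fr.
Qed.

Lemma Ck_cst k U (c : R) : Ck k U (fun=> c).
Proof.
have dx0 : forall c : R, dx (fun=> c) = (fun=> 0 : R).
  by move=> a; apply/funext => p; rewrite /dx derive1E derive_cst.
have dy0 : forall c : R, dy (fun=> c) = (fun=> 0 : R).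
  by move=> a; apply/funext => p; rewrite /dy derive1E derive_cst.
elim: k c => [|k IH] c; split; try by move=> p _; exact: cvg_cst.
  by [].
by split; try (by move=> p _; exact: derivable_cst); rewrite ?dx0 ?dy0; exact: IH.
Qed.

Lemma dxZ (c : R) f p : derivable (fun t : R => f (t, p.2)) p.1 1 ->
  dx (fun q => c * f q) p = c * dx f p.
Proof. by move=> df; rewrite /dx !derive1E; exact: deriveZ df. Qed.

Lemma dyZ (c : R) f p : derivable (fun t : R => f (p.1, t)) p.2 1 ->
  dy (fun q => c * f q) p = c * dy f p.
Proof. by move=> df; rewrite /dy !derive1E; exact: deriveZ df. Qed.

Lemma CkZ k U (c : R) f : open U -> Ck k U f -> Ck k U (fun p => c * f p).
Proof.
move=> oU; elim: k f => [|k IH] f /= [cf hf].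
  by split=> // p Up; apply: cvgM; [exact: cvg_cst|exact: cf].
have [fx fy kx ky] := hf; split.
  by move=> p Up; apply: cvgM; [exact: cvg_cst|exact: cf].
split.
- by move=> p Up; apply: derivableZ; exact: fx.
- by move=> p Up; apply: derivableZ; exact: fy.
- apply: Ck_ext (IH _ kx) => // p Up; by rewrite dxZ//; exact: fx.
- apply: Ck_ext (IH _ ky) => // p Up; by rewrite dyZ//; exact: fy.
Qed.

Lemma Ck1T_sum (F : nat -> R * R -> R) n : (forall i, Ck 1 setT (F i)) ->
  [/\ Ck 1 setT (fun p => \sum_(i < n) F i p),
      dx (fun p => \sum_(i < n) F i p) = (fun p => \sum_(i < n) dx (F i) p) &
      dy (fun p => \sum_(i < n) F i p) = (fun p => \sum_(i < n) dy (F i) p)].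
Proof.
move=> h; elim: n => [|n [k1 k2 k3]].
  have e (f : nat -> R * R -> R) : (fun p => \sum_(i < 0) f i p) = (fun=> 0).
    by apply/funext => p; rewrite big_ord0.
  rewrite (e F) (e (fun i => dx (F i))) (e (fun i => dy (F i))); split; first exact: Ck_cst.
    by apply/funext => p; rewrite /dx derive1E derive_cst.
  by apply/funext => p; rewrite /dy derive1E derive_cst.
have e (f : nat -> R * R -> R) :
    (fun p => \sum_(i < n.+1) f i p) = (fun p => (\sum_(i < n) f i p) + f n p).
  by apply/funext => p; rewrite big_ord_recr.
have [_ [hx hy _ _]] := h n; have [_ [sx sy _ _]] := k1.
rewrite (e F) (e (fun i => dx (F i))) (e (fun i => dy (F i))); split; first by apply: Ck_add => //; exact: openT.
  by apply/funext => p; rewrite dxD ?k2//; [exact: sx|exact: hx].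
by apply/funext => p; rewrite dyD ?k3//; [exact: sy|exact: hy].
Qed.

(** * Cosine partial sums and their convergence in H^1 *)

Section approx.
Variables h hx hy : R * R -> R.
Hypothesis H : H1_grad h hx hy.
Local Notation cc := (sys2 (@cnn R) (@cnn R)).
Local Notation sc := (sys2 (@sn R) (@cnn R)).
Local Notation cs := (sys2 (@cnn R) (@sn R)).

Let fr_cont (k : nat) : continuous (fun x : R => fr R k * cnn k x).
Proof. by apply: contM => //; [exact: contC|exact: cnn_cont]. Qed.
Let frs_cont (k : nat) : continuous (fun x : R => - fr R k * sn k x).
Proof. by apply: contM => //; [exact: contC|exact: sn_cont]. Qed.

Lemma cc_Ck1 n : Ck 1 setT (cc n).
Proof.
case: (sys2P (@cnn R) (@cnn R) n) => [[kl [_ ->]]|->]; last exact: Ck_cst.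
by apply: Ck1_prod (is_derive_cnn _) _ (is_derive_cnn _) _; exact: frs_cont.
Qed.

(** The weak derivative may be tested with a sine in [x], which vanishes at the ends, times a cosine
    in [y]. Consequently the [x]-derivative of a cosine partial sum of [h] is the sine-cosine
    partial sum of [hx]. *)
Lemma coef_dx n z : ip mu2 Q h (cc n) * dx (cc n) z = ip mu2 Q hx (sc n) * sc n z.
Proof.
rewrite /sys2; case: (@pickle_inv (nat * nat)%type n) => [[k l]|] /=; last first.
  by rewrite !ip0r !mul0r.
rewrite (dx_prod (cnn l) (is_derive_cnn k)).
have := H1_weak_dx (is_derive_snn k) (@fr_cont k) (is_derive_cnn l) (@frs_cont l) H (vanishing_sn k).
have lcc : L2on mu2 Q (fun p => cnn k p.1 * cnn l p.2) by apply: prod_L2; exact: cnn_cont.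
have lh : L2on mu2 Q h by case: H.
rewrite (@ipQ_eq h _ h (fun p => fr R k * (cnn k p.1 * cnn l p.2))) => //; last first.
  by move=> p _; rewrite mulrA.
by rewrite ipZr// => e; rewrite -[ip mu2 _ hx _]opprK -e; ring.
Qed.

Lemma coef_dy n z : ip mu2 Q h (cc n) * dy (cc n) z = ip mu2 Q hy (cs n) * cs n z.
Proof.
rewrite /sys2; case: (@pickle_inv (nat * nat)%type n) => [[k l]|] /=; last first.
  by rewrite !ip0r !mul0r.
rewrite (dy_prod (cnn k) (is_derive_cnn l)).
have := H1_weak_dy (is_derive_cnn k) (@frs_cont k) (is_derive_snn l) (@fr_cont l) H (vanishing_sn l).
have lcc : L2on mu2 Q (fun p => cnn k p.1 * cnn l p.2) by apply: prod_L2; exact: cnn_cont.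
have lh : L2on mu2 Q h by case: H.
rewrite (@ipQ_eq h _ h (fun p => fr R l * (cnn k p.1 * cnn l p.2))) => //; last first.
  by move=> p _; ring.
by rewrite ipZr// => e; rewrite -[ip mu2 _ hy _]opprK -e; ring.
Qed.

Definition apx := proj mu2 Q cc h.

Lemma apx_Ck1 n : [/\ Ck 1 setT (apx n), dx (apx n) = proj mu2 Q sc hx n &
  dy (apx n) = proj mu2 Q cs hy n].
Proof.
have Hc i : Ck 1 setT (fun p => ip mu2 Q h (cc i) * cc i p).
  by apply: CkZ; [exact: openT|exact: cc_Ck1].
have [k1 k2 k3] := Ck1T_sum n Hc; split=> //.
- rewrite /apx /proj k2; apply/funext => p; apply: eq_bigr => i _.
  rewrite -coef_dx dxZ//; have [_ [hx' _ _ _]] := cc_Ck1 i; exact: hx'.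
- rewrite /apx /proj k3; apply/funext => p; apply: eq_bigr => i _.
  rewrite -coef_dy dyZ//; have [_ [_ hy' _ _]] := cc_Ck1 i; exact: hy'.
Qed.

Lemma apx_cvg : [/\
  ip mu2 Q (fun x => apx n x - h x) (fun x => apx n x - h x) @[n --> \oo] --> (0 : R),
  ip mu2 Q (fun x => dx (apx n) x - hx x) (fun x => dx (apx n) x - hx x) @[n --> \oo] --> (0 : R) &
  ip mu2 Q (fun x => dy (apx n) x - hy x) (fun x => dy (apx n) x - hy x) @[n --> \oo] --> (0 : R)].
Proof.
have [lh lhx lhy _] := H.
have cnc := @cnn_cont; have snc := @sn_cont R.
have oc := orthosys_cnn; have os := orthosys_sn.
have kc := complete_cnn; have ks := complete_sn.
split; first exact: sys2_cvg.
- under eq_fun => n do have [_ -> _] := apx_Ck1 n; exact: sys2_cvg.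
- under eq_fun => n do have [_ _ ->] := apx_Ck1 n; exact: sys2_cvg.
Qed.

End approx.

Lemma swp_ip (f : R * R -> R) : L2on mu2 Q f -> ip mu2 Q (swp f) (swp f) = ip mu2 Q f f.
Proof.
by move=> lf; exact: (swp_int (f := fun p => f p * f p)) (L2on_mul mQ lf lf).
Qed.

Lemma trace_ineq_side u (k : 'I_4) : C1sq u ->
  ip mu J (fun t => u (@side R k t)) (fun t => u (@side R k t)) <=
  2 * (ip mu2 Q u u + (ip mu2 Q (dx u) (dx u) + ip mu2 Q (dy u) (dy u))).
Proof.
have Hx (a b c : R) : 0 <= c -> 2 * (a + b) <= 2 * (a + (b + c)) by lra.
have Hy (a b c : R) : 0 <= b -> 2 * (a + c) <= 2 * (a + (b + c)) by lra.
move=> cu; have cs := C1sq_swp cu.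
have l0 : L2on mu2 Q u by apply: contsq_L2 => x y Jx Jy; case: (cu x y Jx Jy).
have ly : L2on mu2 Q (dy u) by apply: contsq_L2 => x y Jx Jy; case: (cu x y Jx Jy).
have px := ip_ge0 mu2 Q (dx u); have py := ip_ge0 mu2 Q (dy u).
have sx := swp_ip l0; have sy := swp_ip ly.
have ex : dx (swp u) = swp (dy u) by [].
have t0 := le_trans (@trace_ineq R u 1 cu (or_introl erefl)) (Hx (ip mu2 Q u u) (ip mu2 Q (dx u) (dx u)) _ py).
have t1 := le_trans (@trace_ineq R u (-1) cu (or_intror erefl)) (Hx (ip mu2 Q u u) (ip mu2 Q (dx u) (dx u)) _ py).
have := @trace_ineq R (swp u) 1 cs (or_introl erefl); rewrite ex sx sy => t2.
have := @trace_ineq R (swp u) (-1) cs (or_intror erefl); rewrite ex sx sy => t3.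
have {}t2 := le_trans t2 (Hy (ip mu2 Q u u) _ (ip mu2 Q (dy u) (dy u)) px).
have {}t3 := le_trans t3 (Hy (ip mu2 Q u u) _ (ip mu2 Q (dy u) (dy u)) px).
case: k => [[|[|[|[|//]]]] i].
- exact: t0.
- exact: t1.
- exact: t2.
- exact: t3.
Qed.

Lemma ip_parallelogram (a b : R * R -> R) : L2on mu2 Q a -> L2on mu2 Q b ->
  ip mu2 Q (fun x => a x - b x) (fun x => a x - b x) + ip mu2 Q (fun x => a x + b x) (fun x => a x + b x) =
  2 * ip mu2 Q a a + 2 * ip mu2 Q b b.
Proof.
move=> la lb; have l1 := L2onB mQ la lb; have l2 := L2onD mQ la lb.
rewrite ipBl// !ipBr// ipDl// !ipDr//; ring.
Qed.

Lemma ip_cauchy (f_ : nat -> R * R -> R) f : (forall n, L2on mu2 Q (f_ n)) -> L2on mu2 Q f ->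
  ip mu2 Q (fun x => f_ n x - f x) (fun x => f_ n x - f x) @[n --> \oo] --> (0 : R) ->
  forall e, 0 < e -> exists N, forall n m, (N <= n)%N -> (N <= m)%N ->
    ip mu2 Q (fun x => f_ n x - f_ m x) (fun x => f_ n x - f_ m x) <= e.
Proof.
move=> lf_ lf c e e0; have e4 : 0 < e / 4 by rewrite divr_gt0.
have /cvgrPdist_le/(_ _ e4)[N _ hN] := c.
exists N => n m Nn Nm; have := hN n Nn; have := hN m Nm.
rewrite !sub0r !normrN !ger0_norm ?ip_ge0// => h1 h2.
have l1 := L2onB mQ (lf_ n) lf; have l2 := L2onB mQ (lf_ m) lf.
have := ip_parallelogram l1 l2.
rewrite (@ipQ_eq (fun x => (f_ n x - f x) - (f_ m x - f x)) (fun x => (f_ n x - f x) - (f_ m x - f x))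
   (fun x => f_ n x - f_ m x) (fun x => f_ n x - f_ m x)); [|by move=> *; ring|by move=> *; ring].
have := ip_ge0 mu2 Q (fun x => (f_ n x - f x) + (f_ m x - f x)); lra.
Qed.

Lemma L2on_inside (f f' : R -> R) : L2on mu J f -> (forall t, -1 < t < 1 -> f t = f' t) ->
  L2on mu J f' /\ {ae mu, forall t, J t -> f t = f' t}.
Proof.
move=> lf e; have FF := ae_filter_ringOfSetsType mu.
have ae1 : {ae mu, forall t, J t -> f t = f' t}.
  have := ae_neq (1 : R); have := ae_neq (-1 : R).
  by apply: filterS2 => x x1 x2 Jx; apply: e; exact: J_I.
have m' : measurable_fun J f'.
  apply/measurable_fun_itv_bndo_bndcP/measurable_fun_itv_obnd_cbndP.
  have := lf.1; move/measurable_fun_itv_bndo_bndcP/measurable_fun_itv_obnd_cbndP.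
  by apply: eq_measurable_fun => x /set_mem /=; rewrite in_itv /=; exact: e.
split=> //; split=> //.
have -> : (\int[mu]_(x in J) (f' x ^+ 2)%:E = \int[mu]_(x in J) (f x ^+ 2)%:E)%E; last exact: lf.2.
apply: ae_eq_integral => //.
- by apply/measurable_EFinP/measurable_funX.
- by apply/measurable_EFinP/measurable_funX; exact: lf.1.
- by move: ae1; apply: filterS => x /= h Dx; rewrite h.
Qed.

(** The trace inequality for differences of cosine partial sums makes their restrictions to each
    side Cauchy; the four limits are glued into one function. *)
Lemma trace_exists (h : R * R -> R) : (exists hx hy, H1_grad h hx hy) -> exists g, is_trace h g.
Proof.
move=> [hx [hy H]]; have [lh lhx lhy _] := H.
have [c0 cx cy] := apx_cvg H; pose u := apx h.
have Cu n : C1sq (u n) by apply: Ck1T_C1sq; case: (apx_Ck1 H n).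
have lu n : L2on mu2 Q (u n) by apply: contsq_L2 => x y Jx Jy; case: (Cu n x y Jx Jy).
have lux n : L2on mu2 Q (dx (u n)) by apply: contsq_L2 => x y Jx Jy; case: (Cu n x y Jx Jy).
have luy n : L2on mu2 Q (dy (u n)) by apply: contsq_L2 => x y Jx Jy; case: (Cu n x y Jx Jy).
have lside n (k : 'I_4) : L2on mu J (fun t => u n (@side R k t)).
  have k0 : contsq (u n) by move=> x y Jx Jy; case: (Cu n x y Jx Jy).
  have ks : contsq (swp (u n)) by move=> x y Jx Jy; case: (C1sq_swp (Cu n) Jx Jy).
  have J1 : J 1 by rewrite /= in_itv /=; apply/andP; split; lra.
  have JN1 : J (-1) by rewrite /= in_itv /=; apply/andP; split; lra.
  case: k => [[|[|[|[|//]]]] i]; rewrite /side /=.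
  - exact: contsq_secy_L2 k0 J1.
  - exact: contsq_secy_L2 k0 JN1.
  - exact: contsq_secy_L2 ks J1.
  - exact: contsq_secy_L2 ks JN1.
have RF (k : 'I_4) : exists g : R -> R, L2on mu J g /\
    ip mu J (fun t => u n (@side R k t) - g t) (fun t => u n (@side R k t) - g t) @[n --> \oo] --> (0 : R).
  have [|g lg cg] := @Riesz_Fischer _ _ _ mu J mJ muJ_lty (fun n t => u n (@side R k t)) (lside ^~ k).
    move=> e e0; have e8 : 0 < e / 8 by rewrite divr_gt0.
    have H3 (a b c : R) : a <= e / 8 -> b <= e / 8 -> c <= e / 8 -> 2 * (a + (b + c)) <= e by lra.
    have [N1 h1] := ip_cauchy lu lh c0 e8; have [N2 h2] := ip_cauchy lux lhx cx e8.
    have [N3 h3] := ip_cauchy luy lhy cy e8.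
    exists (maxn N1 (maxn N2 N3)) => n m; rewrite !geq_max => /and3P[n1 n2 n3] /and3P[m1 m2 m3].
    have [kn _ _] := apx_Ck1 H n; have [km _ _] := apx_Ck1 H m.
    have oT := @openT (R * R)%type.
    have kd : Ck 1 setT (fun p => u n p + (-1) * u m p) by apply: Ck_add => //; exact: CkZ.
    have := trace_ineq_side k (Ck1T_C1sq kd).
    have [_ [dxn dyn _ _]] := kn; have [_ [dxm dym _ _]] := km.
    have km' := CkZ (-1) oT km; have [_ [dxm' dym' _ _]] := km'.
    rewrite (@ipJ_eq R _ _ (fun t => u n (@side R k t) - u m (@side R k t))
       (fun t => u n (@side R k t) - u m (@side R k t))); [|by move=> *; ring|by move=> *; ring].
    have eu p : u n p + (-1) * u m p = u n p - u m p by rewrite mulN1r.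
    have ex p : dx (fun p => u n p + (-1) * u m p) p = dx (u n) p - dx (u m) p.
      by rewrite dxD ?dxZ ?mulN1r//; [exact: dxm|exact: dxn|exact: dxm'].
    have ey p : dy (fun p => u n p + (-1) * u m p) p = dy (u n) p - dy (u m) p.
      by rewrite dyD ?dyZ ?mulN1r//; [exact: dym|exact: dyn|exact: dym'].
    rewrite (ipQ_eq (fun p _ => eu p) (fun p _ => eu p)) (ipQ_eq (fun p _ => ex p) (fun p _ => ex p)).
    rewrite (ipQ_eq (fun p _ => ey p) (fun p _ => ey p)) => /le_trans; apply.
    exact: H3 (h1 _ _ n1 m1) (h2 _ _ n2 m2) (h3 _ _ n3 m3).
  by exists g.
have {RF}[G HG] := choice RF.
(* At a corner two sides compete and the first matching clause wins; corners are null on each side,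
   whence the almost everywhere comparison in [gL]. *)
pose g (p : R * R) := if p.1 == 1 then G 0 p.2 else if p.1 == -1 then G 1 p.2 else
  if p.2 == 1 then G 2%:R p.1 else G 3%:R p.1.
have gG k t : -1 < t < 1 -> G k t = g (@side R k t).
  move=> /andP[t1 t2].
  have n1 : (t == 1) = false by rewrite lt_eqF.
  have n2 : (t == -1) = false by rewrite gt_eqF.
  have n3 : ((-1 : R) == 1) = false by rewrite lt_eqF//; lra.
  case: k => [[|[|[|[|//]]]] i]; rewrite /side /g /= ?eqxx ?n1 ?n2 ?n3; congr (G _ t); exact: val_inj.
have gL k := L2on_inside (HG k).1 (gG k).
exists g; split; first by move=> k; exact: (gL k).1.
exists hx, hy, u; split=> //.
- by move=> n; exists setT; split=> //; [exact: openT|case: (apx_Ck1 H n)].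
- pose F n p := (u n p - h p) ^+ 2 + (dx (u n) p - hx p) ^+ 2 + (dy (u n) p - hy p) ^+ 2.
  have l2 n := L2onB mQ (lu n) lh; have l3 n := L2onB mQ (lux n) lhx; have l4 n := L2onB mQ (luy n) lhy.
  have -> : (fun n => \int[mu2]_(p in Q) (F n p)%:E)%E = (fun n =>
    (ip mu2 Q (fun x => u n x - h x) (fun x => u n x - h x) +
     ip mu2 Q (fun x => dx (u n) x - hx x) (fun x => dx (u n) x - hx x) +
     ip mu2 Q (fun x => dy (u n) x - hy x) (fun x => dy (u n) x - hy x))%:E).
    apply/funext => n; have q2 := (L2onP mu2 Q _).1 (l2 n).
    have q3 := ((L2onP mu2 Q _).1 (l3 n)).2; have q4 := ((L2onP mu2 Q _).1 (l4 n)).2.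
    rewrite L1on_fin//; last by apply: L1onD => //; apply: L1onD => //; exact: q2.2.
    congr (_%:E); rewrite !ip_sq -!RintegralD//; try exact: q2.2.
    by apply: L1onD => //; exact: q2.2.
  apply: cvg_EFin; first exact: nearW.
  rewrite -[X in _ --> X]addr0 -[X in _ --> X + _]addr0.
  by apply: cvgD => //; exact: cvgD.
- move=> k; have [lk aek] := gL k; have [lG cG] := HG k.
  have -> : (fun n => \int[mu]_(t in J) ((u n (@side R k t) - g (@side R k t)) ^+ 2)%:E)%E =
    (fun n => (ip mu J (fun t => u n (@side R k t) - G k t) (fun t => u n (@side R k t) - G k t))%:E).
    apply/funext => n; have l1 := L2onB mJ (lside n k) lk; have l2 := L2onB mJ (lside n k) lG.
    have ae2 : {ae mu, forall t, J t -> u n (@side R k t) - g (@side R k t) = u n (@side R k t) - G k t}.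
      by move: aek; apply: filterS => t /= h1 Jt; rewrite h1.
    rewrite -(ip_ae mJ l1.1 l2.1 l2.1 ae2) ipC -(ip_ae mJ l1.1 l2.1 l1.1 ae2).
    exact: ip_sqE.
  by apply: cvg_EFin; first exact: nearW.
Qed.

End TraceExists.

(** * Fourier coefficients of harmonic functions *)

Section TraceFourier.
Variable R : realType.
Local Notation mu := (@lebesgue_measure R).
Local Notation T2 := (measurableTypeR R * measurableTypeR R)%type.
Local Notation mu2 := (mu \x mu)%E.
Local Notation J := (`[-1, 1]%classic : set (measurableTypeR R)).
Local Notation Q := (@G1 R : set T2).
Let mJ := @mJ R.
Let muJ_lty := @muJ_lty R.
Let mQ := @mQ R.
Let muQ_lty := @muQ_lty R.
Hint Resolve mQ muQ_lty mJ muJ_lty : core.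

(** The definition of the trace bundles function and gradient into one extended-real integral; here
    it is split into real limits of square norms. *)
Lemma trace_cvg (h g : R * R -> R) : is_trace h g -> exists (hx hy : R * R -> R) (u : nat -> R * R -> R),
  [/\ H1_grad h hx hy, forall n, C1sq (u n),
    [/\ ip mu2 Q (fun x => u n x - h x) (fun x => u n x - h x) @[n --> \oo] --> (0 : R),
        ip mu2 Q (fun x => dx (u n) x - hx x) (fun x => dx (u n) x - hx x) @[n --> \oo] --> (0 : R) &
        ip mu2 Q (fun x => dy (u n) x - hy x) (fun x => dy (u n) x - hy x) @[n --> \oo] --> (0 : R)] &
    forall k, ip mu J (fun t => u n (@side R k t) - g (@side R k t))
      (fun t => u n (@side R k t) - g (@side R k t)) @[n --> \oo] --> (0 : R)].
Proof.
move=> [bg [hx [hy [u [H Hu c0 cs]]]]]; exists hx, hy, u; have [lh lhx lhy _] := H.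
have Cu n : C1sq (u n) by have [U [oU GU ku]] := Hu n; exact: Ck1_C1sq ku.
have lu n : L2on mu2 Q (u n) by apply: contsq_L2 => x y Jx Jy; case: (Cu n x y Jx Jy).
have lux n : L2on mu2 Q (dx (u n)) by apply: contsq_L2 => x y Jx Jy; case: (Cu n x y Jx Jy).
have luy n : L2on mu2 Q (dy (u n)) by apply: contsq_L2 => x y Jx Jy; case: (Cu n x y Jx Jy).
have lside n (k : 'I_4) : L2on mu J (fun t => u n (@side R k t)).
  have k0 : contsq (u n) by move=> x y Jx Jy; case: (Cu n x y Jx Jy).
  have ks : contsq (swp (u n)) by move=> x y Jx Jy; case: (C1sq_swp (Cu n) Jx Jy).
  have J1 : J 1 by rewrite /= in_itv /=; apply/andP; split; lra.
  have JN1 : J (-1) by rewrite /= in_itv /=; apply/andP; split; lra.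
  case: k => [[|[|[|[|//]]]] i]; rewrite /side /=.
  - exact: contsq_secy_L2 k0 J1.
  - exact: contsq_secy_L2 k0 JN1.
  - exact: contsq_secy_L2 ks J1.
  - exact: contsq_secy_L2 ks JN1.
split => //.
- pose F n p := (u n p - h p) ^+ 2 + (dx (u n) p - hx p) ^+ 2 + (dy (u n) p - hy p) ^+ 2.
  have l2 n := L2onB mQ (lu n) lh; have l3 n := L2onB mQ (lux n) lhx; have l4 n := L2onB mQ (luy n) lhy.
  pose a n := ip mu2 Q (fun x => u n x - h x) (fun x => u n x - h x).
  pose b n := ip mu2 Q (fun x => dx (u n) x - hx x) (fun x => dx (u n) x - hx x).
  pose c n := ip mu2 Q (fun x => dy (u n) x - hy x) (fun x => dy (u n) x - hy x).
  have E : (fun n => \int[mu2]_(p in Q) (F n p)%:E)%E = (fun n => (a n + b n + c n)%:E).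
    apply/funext => n; have q2 := (L2onP mu2 Q _).1 (l2 n).
    have q3 := ((L2onP mu2 Q _).1 (l3 n)).2; have q4 := ((L2onP mu2 Q _).1 (l4 n)).2.
    rewrite L1on_fin//; last by apply: L1onD => //; apply: L1onD => //; exact: q2.2.
    congr (_%:E); rewrite /a /b /c !ip_sq -!RintegralD//; try exact: q2.2.
    by apply: L1onD => //; exact: q2.2.
  have cabc : a n + b n + c n @[n --> \oo] --> (0 : R).
    have : (\int[mu2]_(p in Q) (F n p)%:E)%E @[n --> \oo] --> 0%E by exact: c0.
    by rewrite E => /fine_cvg.
  have a0 n : 0 <= a n by exact: ip_ge0.
  have b0 n : 0 <= b n by exact: ip_ge0.
  have d0 n : 0 <= c n by exact: ip_ge0.
  have z0 : (fun _ : nat => 0 : R) n @[n --> \oo] --> (0 : R) by exact: cvg_cst.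
  have sq (v : nat -> R) : (forall n, 0 <= v n <= a n + b n + c n) -> v n @[n --> \oo] --> (0 : R).
    by move=> hv; apply: (squeeze_cvgr _ z0 cabc); exact: nearW.
  split; apply: sq => n; move: (a0 n) (b0 n) (d0 n); rewrite -/(a n) -/(b n) -/(c n);
    move: (a n) (b n) (c n) => x y z *; apply/andP; split; lra.
- move=> k; have lk : L2on mu J (fun t => g (@side R k t)) by exact: bg.
  have : (fun n => \int[mu]_(t in J) ((u n (@side R k t) - g (@side R k t)) ^+ 2)%:E)%E @ \oo --> 0%E := cs k.
  have -> : (fun n => \int[mu]_(t in J) ((u n (@side R k t) - g (@side R k t)) ^+ 2)%:E)%E =
    (fun n => (ip mu J (fun t => u n (@side R k t) - g (@side R k t)) (fun t => u n (@side R k t) - g (@side R k t)))%:E).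
    by apply/funext => n; have l1 := L2onB mJ (lside n k) lk; exact: ip_sqE.
  by move=> /fine_cvg.
Qed.

Lemma green_y u (w w' v : R -> R) : C1sq u -> (forall x : R, is_derive x 1 w (w' x)) ->
  continuous w' -> continuous v ->
  ip mu2 Q (dy u) (fun p => v p.1 * w p.2) =
  w 1 * ip mu J (fun t => u (t, 1)) v - w (-1) * ip mu J (fun t => u (t, -1)) v
  - ip mu2 Q u (fun p => v p.1 * w' p.2).
Proof.
move=> cu dw cw' cv; have cw := is_derive_continuous dw.
have E (f : R * R -> R) (a : R -> R) : contsq f -> continuous a ->
    ip mu2 Q (swp f) (fun p => a p.1 * v p.2) = ip mu2 Q f (fun p => v p.1 * a p.2).
  move=> cf ca; rewrite -[RHS](@swp_int R (fun p => f p * (v p.1 * a p.2))); last first.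
    by apply: L2on_mul => //; [exact: contsq_L2|exact: prod_L2].
  by apply: ipQ_eq => // p _; rewrite mulrC.
have := green_x (C1sq_swp cu) dw cw' cv.
have -> : dx (swp u) = swp (dy u) by [].
rewrite !E//; by move=> x y Jx Jy; case: (cu x y Jx Jy).
Qed.

Section lim.
Variables (h g hx hy : R * R -> R) (w w' v v' : R -> R).
Hypothesis tg : is_trace h g.
Hypothesis Hh : H1_grad h hx hy.
Hypothesis dw : forall x : R, is_derive x 1 w (w' x).
Hypothesis cw' : continuous w'.
Hypothesis dv : forall x : R, is_derive x 1 v (v' x).
Hypothesis cv' : continuous v'.
Let cw := is_derive_continuous dw.
Let cv := is_derive_continuous dv.

(** [H1_grad_unique] exchanges the gradient attached to the trace for the given one; each term of
    [green_x] is then continuous along the approximants. *)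
Lemma green_lim_x : ip mu2 Q hx (fun p => w p.1 * v p.2) =
  w 1 * ip mu J (fun y => g (1, y)) v - w (-1) * ip mu J (fun y => g (-1, y)) v
  - ip mu2 Q h (fun p => w' p.1 * v p.2).
Proof.
have [hx' [hy' [u [H Cu [c0 cx cy] cs]]]] := trace_cvg tg.
have [-> _] := H1_grad_unique dw cw' dv cv' Hh H.
have [lh lhx lhy _] := H.
have lu n : L2on mu2 Q (u n) by apply: contsq_L2 => x y Jx Jy; case: (Cu n x y Jx Jy).
have lux n : L2on mu2 Q (dx (u n)) by apply: contsq_L2 => x y Jx Jy; case: (Cu n x y Jx Jy).
have J1 : J 1 by rewrite /= in_itv /=; apply/andP; split; lra.
have JN1 : J (-1) by rewrite /= in_itv /=; apply/andP; split; lra.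
have l0 n : L2on mu J (fun t => u n (1, t)).
  by apply: contsq_secy_L2 J1 => x y Jx Jy; case: (Cu n x y Jx Jy).
have l1 n : L2on mu J (fun t => u n (-1, t)).
  by apply: contsq_secy_L2 JN1 => x y Jx Jy; case: (Cu n x y Jx Jy).
have lv : L2on mu J v by exact: cont_L2.
have k0 := ip_cvgl mJ l0 (tg.1 0) lv (cs 0).
have k1 := ip_cvgl mJ l1 (tg.1 1) lv (cs 1).
have k2 := ip_cvgl mQ lu lh (prod_L2 cw' cv) c0.
have k3 := ip_cvgl mQ lux lhx (prod_L2 cw cv) cx.
apply: cvg_eq k3 (cvgB (cvgB (cvgM (cvg_cst (w 1)) k0) (cvgM (cvg_cst (w (-1))) k1)) k2) _.
by move=> n /=; exact: green_x.
Qed.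

Lemma green_lim_y : ip mu2 Q hy (fun p => w p.1 * v p.2) =
  v 1 * ip mu J (fun t => g (t, 1)) w - v (-1) * ip mu J (fun t => g (t, -1)) w
  - ip mu2 Q h (fun p => w p.1 * v' p.2).
Proof.
have [hx' [hy' [u [H Cu [c0 cx cy] cs]]]] := trace_cvg tg.
have [_ ->] := H1_grad_unique dw cw' dv cv' Hh H.
have [lh lhx lhy _] := H.
have lu n : L2on mu2 Q (u n) by apply: contsq_L2 => x y Jx Jy; case: (Cu n x y Jx Jy).
have luy n : L2on mu2 Q (dy (u n)) by apply: contsq_L2 => x y Jx Jy; case: (Cu n x y Jx Jy).
have J1 : J 1 by rewrite /= in_itv /=; apply/andP; split; lra.
have JN1 : J (-1) by rewrite /= in_itv /=; apply/andP; split; lra.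
have l0 n : L2on mu J (fun t => u n (t, 1)).
  by apply: (@contsq_secy_L2 _ (swp (u n))) J1 => x y Jx Jy; case: (C1sq_swp (Cu n) Jx Jy).
have l1 n : L2on mu J (fun t => u n (t, -1)).
  by apply: (@contsq_secy_L2 _ (swp (u n))) JN1 => x y Jx Jy; case: (C1sq_swp (Cu n) Jx Jy).
have lw : L2on mu J w by exact: cont_L2.
have k0 := ip_cvgl mJ l0 (tg.1 2%:R) lw (cs 2%:R).
have k1 := ip_cvgl mJ l1 (tg.1 3%:R) lw (cs 3%:R).
have k2 := ip_cvgl mQ lu lh (prod_L2 cw cv') c0.
have k3 := ip_cvgl mQ luy lhy (prod_L2 cw cv) cy.
apply: cvg_eq k3 (cvgB (cvgB (cvgM (cvg_cst (v 1)) k0) (cvgM (cvg_cst (v (-1))) k1)) k2) _.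
by move=> n /=; exact: green_y.
Qed.

End lim.

(** The factors on the right are minus the outward normal derivatives of the sine product at the
    four sides, which explains the signs [(-1) ^+ k.+1] at 1 and [+] at -1. *)
Lemma harmonic_fourier (h g : R * R -> R) k m : H1_harmonic h -> is_trace h g ->
  (fr R k ^+ 2 + fr R m ^+ 2) * ip mu2 Q h (fun p => sn k p.1 * sn m p.2) =
  fr R k * ((-1) ^+ k.+1 * ip mu J (fun t => g (1, t)) (sn m) + ip mu J (fun t => g (-1, t)) (sn m)) +
  fr R m * ((-1) ^+ m.+1 * ip mu J (fun t => g (t, 1)) (sn k) + ip mu J (fun t => g (t, -1)) (sn k)).
Proof.
move=> [hx [hy [H Hw]]] tg; have [lh lhx lhy _] := H.
have c1 l : continuous (fun x : R => fr R l * cn l x) by apply: contM => //; [exact: contC|exact: cn_cont].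
have c2 l : continuous (fun x : R => - fr R l ^+ 2 * sn l x) by apply: contM => //; [exact: contC|exact: sn_cont].
have E := harmonic_weak (is_derive_sn k) (c1 k) (is_derive_sn m) (c1 m) lhx lhy Hw (vanishing_sn R k) (vanishing_sn R m).
have Ex := green_lim_x tg H (is_derive_sn2 k) (c2 k) (is_derive_sn m) (c1 m).
have Ey := green_lim_y tg H (is_derive_sn k) (c1 k) (is_derive_sn2 m) (c2 m).
move: E; rewrite {}Ex {}Ey !cn1 !cnN1.
rewrite (@ipQ_eq R h (fun p => - fr R k ^+ 2 * sn k p.1 * sn m p.2) h
  (fun p => - fr R k ^+ 2 * (sn k p.1 * sn m p.2)))//; last by move=> p _; rewrite mulrA.
rewrite (@ipQ_eq R h (fun p => sn k p.1 * (- fr R m ^+ 2 * sn m p.2)) h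
  (fun p => - fr R m ^+ 2 * (sn k p.1 * sn m p.2)))//; last by move=> p _; ring.
have ls : L2on mu2 Q (fun p => sn k p.1 * sn m p.2) by apply: prod_L2; exact: sn_cont.
rewrite !ipZr// !exprS !mulN1r => e.
by apply/subr0_eq; rewrite -[RHS]e; ring.
Qed.

End TraceFourier.

(** * Series solution of the Dirichlet problem *)

Section RealSeries.
Variable R : realType.

Lemma abs_series (a b : nat -> R) (M : R) : (forall l, `|a l| <= b l) ->
  (forall n, \sum_(l < n) b l <= M) -> cvgn (series a) /\ `|limn (series a)| <= M.
Proof.
move=> ab bM.
have le n : [normed series a] n <= M.
  by rewrite /normed_series_of seriesEord; apply: le_trans (bM n); apply: ler_sum => i _; exact: ab.
have c : cvgn [normed series a].
  apply: nondecreasing_is_cvgn; last by exists M => _ [n _ <-].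
  by apply/nondecreasing_seqP => n; rewrite /normed_series_of seriesS lerDr /= normr_ge0.
split; first exact: normed_cvg.
apply: le_trans (lim_series_norm c) _; apply: limr_le => //; exact: nearW.
Qed.

Lemma lip_on (f f' : R -> R) (r B x y : R) : (forall t : R, is_derive t 1 f (f' t)) ->
  (forall t, `|t| <= r -> `|f' t| <= B) -> `|x| <= r -> `|y| <= r ->
  `|f y - f x| <= B * `|y - x|.
Proof.
move=> df bf; wlog xy : x y / x <= y.
  move=> H xr yr; case: (leP x y) => [|/ltW] h; first exact: H.
  by rewrite distrC [in leRHS]distrC; exact: H.
move=> xr yr; have [|c cI ->] := @MVT_segment R f f' x y xy (fun t _ => df t).
  by apply: continuous_subspaceT; exact: is_derive_continuous df.
rewrite normrM ler_wpM2r//; apply: bf.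
move: xr yr cI; rewrite !ler_norml in_itv /= => /andP[x1 x2] /andP[y1 y2] /andP[c1 c2].
by apply/andP; split; [exact: le_trans c1|exact: le_trans y2].
Qed.

Lemma taylor2 (f f' f'' : R -> R) (r B x y : R) : (forall t : R, is_derive t 1 f (f' t)) ->
  (forall t : R, is_derive t 1 f' (f'' t)) ->
  (forall t, `|t| <= r -> `|f'' t| <= B) -> `|x| <= r -> `|y| <= r ->
  `|f y - f x - f' x * (y - x)| <= B * (y - x) ^+ 2.
Proof.
move=> df df' bf xr yr.
pose g t := f t - f' x * t.
have B0 : 0 <= B by apply: le_trans (bf x xr).
have dg (t : R) : is_derive t 1 g (f' t - f' x).
  by have ? := df t; apply: is_derive_eq; rewrite /GRing.scale /=; ring.
have cg : continuous g by exact: is_derive_continuous dg.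
have bnd c : `|c| <= r -> `|c - x| <= `|y - x| -> `|f' c - f' x| <= B * `|y - x|.
  move=> cr cx; apply: le_trans (lip_on df' bf xr cr) _; exact: ler_wpM2l.
have -> : f y - f x - f' x * (y - x) = g y - g x by rewrite /g; ring.
have -> : (y - x) ^+ 2 = `|y - x| * `|y - x| by rewrite -normrM ger0_norm ?expr2 ?sqr_ge0 // -expr2 sqr_ge0.
rewrite mulrA.
have := xr; rewrite ler_norml => /andP[x1 x2]; have := yr; rewrite ler_norml => /andP[y1 y2].
case: (leP x y) => [xy|/ltW yx].
  have [|c cI ->] := @MVT_segment R g (fun t => f' t - f' x) x y xy (fun t _ => dg t).
    exact: continuous_subspaceT.
  move: cI; rewrite in_itv /= => /andP[c1 c2].
  rewrite normrM ler_wpM2r//; apply: bnd; first by rewrite ler_norml; apply/andP; split; lra.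
  by rewrite !ger0_norm; lra.
have [|c cI e] := @MVT_segment R g (fun t => f' t - f' x) y x yx (fun t _ => dg t).
  exact: continuous_subspaceT.
move: cI; rewrite in_itv /= => /andP[c1 c2].
rewrite distrC e normrM (distrC x y) ler_wpM2r//; apply: bnd; first by rewrite ler_norml; apply/andP; split; lra.
by rewrite !ler0_norm; lra.
Qed.

Local Notation fr := (fr R).

(** Absolute convergence of the exponential series on every strip [|x| <= r] with [r < 1]. *)
Definition adm (c : nat -> R) := forall r : R, r < 1 ->
  exists M, forall n, \sum_(l < n) `|c l| * expR (r * fr l) <= M.

Lemma adm_le (c d : nat -> R) : (forall l, `|d l| <= `|c l|) -> adm c -> adm d.
Proof.
move=> dc ac r r1; have [M hM] := ac r r1; exists M => n; apply: le_trans (hM n).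
by apply: ler_sum => i _; rewrite ler_wpM2r// expR_ge0.
Qed.

(** A derivative costs a factor [fr l], which [d * fr l <= expR (d * fr l)] absorbs; [d] is half of
    the margin [1 - r]. *)
Lemma adm_fr (c : nat -> R) : adm c -> adm (fun l => fr l * c l).
Proof.
move=> ac r r1; pose d := (1 - r) / 2; have d0 : 0 < d by rewrite /d divr_gt0//; lra.
have [|M hM] := ac (r + d); first by rewrite /d; lra.
exists (M / d) => n; rewrite ler_pdivlMr// mulr_suml; apply: le_trans (hM n); apply: ler_sum => i _.
have f0 := fr_ge0 R i; rewrite normrM ger0_norm// mulrDl expRD.
rewrite [leLHS](_ : _ = (d * fr i) * (`|c i| * expR (r * fr i))); last by ring.
rewrite [leRHS](_ : _ = expR (d * fr i) * (`|c i| * expR (r * fr i))); last by ring.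
rewrite ler_wpM2r//.
by apply: le_trans (expR_ge1Dx _); rewrite lerDr.
Qed.

(** * Smooth series of exponentials in [x] times sines in [y] *)

Section ZS.
Variable s : R.
Hypothesis s1 : `|s| <= 1.

(** The arbitrary phase [p] makes the family stable under both partial derivatives, a [y]-derivative
    advancing the phase by [pi / 2]; smoothness of every order is then one induction. The values
    [s = 1] and [s = -1] give the growing and the decaying modes. *)
Definition zt (c p : nat -> R) l (z : R * R) : R :=
  c l * expR (s * fr l * z.1) * sin (fr l * z.2 + p l).
Definition ZS c p z := limn (series (fun l => zt c p l z)).

Definition cx (c : nat -> R) l : R := s * fr l * c l.
Definition cy (c : nat -> R) l : R := fr l * c l.
Definition py (p : nat -> R) l : R := p l + pi / 2.

Lemma adm_cx c : adm c -> adm (cx c).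
Proof.
move=> /adm_fr; apply: adm_le => l; rewrite /cx -mulrA normrM -[leRHS]mul1r ler_wpM2r//.
Qed.

Lemma adm_cy c : adm c -> adm (cy c). Proof. exact: adm_fr. Qed.

Lemma is_derive_ztx c p l y (x : R) :
  is_derive x 1 (fun t => zt c p l (t, y)) (zt (cx c) p l (x, y)).
Proof.
have h := is_derive_exp_affine (s * fr l) 0 x.
have {}h : is_derive x 1 (fun t : R => expR (s * fr l * t)) (s * fr l * expR (s * fr l * x)).
  have -> : (fun t : R => expR (s * fr l * t)) = (fun t => expR (s * fr l * t + 0)).
    by apply/funext => t; rewrite addr0.
  by apply: is_derive_eq h _; rewrite addr0.
rewrite /zt /=; by apply: is_derive_eq; rewrite /cx /GRing.scale /=; ring.
Qed.

Lemma is_derive_zty c p l x (y : R) :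
  is_derive y 1 (fun t => zt c p l (x, t)) (zt (cy c) (py p) l (x, y)).
Proof.
have h := is_derive_sin_affine (fr l) (p l) y.
have e : sin (fr l * y + (p l + pi / 2)) = cos (fr l * y + p l).
  by rewrite addrA sinDpihalf.
rewrite /zt /=; by apply: is_derive_eq; rewrite /cy /py /GRing.scale /= e; ring.
Qed.

Lemma zt_bound c p l x y r : `|x| <= r -> `|zt c p l (x, y)| <= `|c l| * expR (r * fr l).
Proof.
move=> xr; rewrite /zt !normrM -[leRHS]mulr1 ler_pM ?mulr_ge0//; last first.
  by rewrite ler_norml sin_geN1 sin_le1.
rewrite ler_wpM2l// ger0_norm ?expR_ge0// ler_expR /= mulrAC ler_wpM2r ?fr_ge0//.
apply: le_trans (ler_norm _) _; rewrite normrM.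
by apply: le_trans xr; rewrite -[leRHS]mul1r ler_wpM2r.
Qed.

Lemma ZS_cvg c p (x y : R) : adm c -> `|x| < 1 ->
  series (fun l => zt c p l (x, y)) @ \oo --> ZS c p (x, y).
Proof.
move=> ac x1; have [M hM] := ac _ x1.
exact: (abs_series (fun l => @zt_bound c p l x y _ (lexx _)) hM).1.
Qed.

(** The second-order Taylor remainders of the terms sum to at most [M * h ^+ 2], where [M] bounds
    the twice differentiated series on the strip of half-width [(1 + |x|) / 2]. *)
Lemma is_derive_ZSx c p (x y : R) : adm c -> `|x| < 1 ->
  is_derive x 1 (fun t => ZS c p (t, y)) (ZS (cx c) p (x, y)).
Proof.
move=> ac x1; pose r := (1 + `|x|) / 2.
have r1 : r < 1 by rewrite /r; lra.
have [M hM] := adm_cx (adm_cx ac) r1.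
apply: (@is_derive_quad _ _ _ _ M (r - `|x|)); first by rewrite /r; lra.
move=> h hr.
have xr : `|x| <= r by rewrite /r; lra.
have xhr : `|x + h| <= r.
  by apply: le_trans (ler_normD _ _) _; lra.
have xh1 : `|x + h| < 1 by exact: le_lt_trans r1.
have c1 := @ZS_cvg _ p _ y ac xh1; have c2 := @ZS_cvg _ p _ y ac x1; have c3 := @ZS_cvg _ p _ y (adm_cx ac) x1.
pose a l := zt c p l (x + h, y) - zt c p l (x, y) - zt (cx c) p l (x, y) * h.
have [|n|_ ha] := @abs_series a (fun l => (`|cx (cx c) l| * expR (r * fr l)) * h ^+ 2) (M * h ^+ 2).
- move=> l; have e : h = x + h - x by ring.
  rewrite /a {2 3}e.
  exact: (@taylor2 _ _ (fun t => zt (cx (cx c)) p l (t, y)) r _ x (x + h)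
    (is_derive_ztx c p l y) (is_derive_ztx (cx c) p l y)
    (fun t => @zt_bound (cx (cx c)) p l t y r) xr xhr).
- by rewrite -mulr_suml ler_wpM2r// sqr_ge0.
suff <- : limn (series a) = ZS c p (x + h, y) - ZS c p (x, y) - ZS (cx c) p (x, y) * h by [].
apply/cvg_lim => //.
have -> : series a = (fun n => series (fun l => zt c p l (x + h, y)) n - series (fun l => zt c p l (x, y)) n
   - series (fun l => zt (cx c) p l (x, y)) n * h).
  by apply/funext => n; rewrite /series /= /a !sumrB mulr_suml.
by apply: cvgB; [exact: cvgB|apply: cvgM => //; exact: cvg_cst].
Qed.

Lemma is_derive_ZSy c p (x y : R) : adm c -> `|x| < 1 ->
  is_derive y 1 (fun t => ZS c p (x, t)) (ZS (cy c) (py p) (x, y)).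
Proof.
move=> ac x1.
have [M hM] := adm_cy (adm_cy ac) x1.
apply: (@is_derive_quad _ _ _ _ M 1 ltr01) => h _.
have c1 := @ZS_cvg _ p _ (y + h) ac x1; have c2 := @ZS_cvg _ p _ y ac x1.
have c3 := @ZS_cvg _ (py p) _ y (adm_cy ac) x1.
pose a l := zt c p l (x, y + h) - zt c p l (x, y) - zt (cy c) (py p) l (x, y) * h.
have [|n|_ ha] := @abs_series a (fun l => (`|cy (cy c) l| * expR (`|x| * fr l)) * h ^+ 2) (M * h ^+ 2).
- move=> l; have e : h = y + h - y by ring.
  rewrite /a {2 3}e.
  have y1 : `|y| <= `|y| + `|h| by rewrite lerDl.
  exact: (@taylor2 _ _ (fun t => zt (cy (cy c)) (py (py p)) l (x, t)) _ _ y (y + h)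
    (is_derive_zty c p l x) (is_derive_zty (cy c) (py p) l x)
    (fun t _ => @zt_bound (cy (cy c)) (py (py p)) l x t _ (lexx _)) y1 (ler_normD _ _)).
- by rewrite -mulr_suml ler_wpM2r// sqr_ge0.
suff <- : limn (series a) = ZS c p (x, y + h) - ZS c p (x, y) - ZS (cy c) (py p) (x, y) * h by [].
apply/cvg_lim => //.
have -> : series a = (fun n => series (fun l => zt c p l (x, y + h)) n - series (fun l => zt c p l (x, y)) n
   - series (fun l => zt (cy c) (py p) l (x, y)) n * h).
  by apply/funext => n; rewrite /series /= /a !sumrB mulr_suml.
by apply: cvgB; [exact: cvgB|apply: cvgM => //; exact: cvg_cst].
Qed.

Lemma ZS_cont c p (x y : R) : adm c -> `|x| < 1 -> {for (x, y), continuous (ZS c p)}.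
Proof.
move=> ac x1; pose r := (1 + `|x|) / 2.
have r1 : r < 1 by rewrite /r; lra.
have [M1 hM1] := adm_cx ac r1; have [M2 hM2] := adm_cy ac r1.
have M10 : 0 <= M1 by have := hM1 0%N; rewrite big_ord0.
have M20 : 0 <= M2 by have := hM2 0%N; rewrite big_ord0.
have lip x' y' : `|x' - x| <= r - `|x| ->
    `|ZS c p (x', y') - ZS c p (x, y)| <= M1 * `|x' - x| + M2 * `|y' - y|.
  move=> hx.
  have xr : `|x| <= r by rewrite /r; lra.
  have xhr : `|x'| <= r.
    by rewrite (_ : x' = x + (x' - x)); [apply: le_trans (ler_normD _ _) _; lra|ring].
  have x'1 : `|x'| < 1 by exact: le_lt_trans r1.
  have c1 := @ZS_cvg _ p _ y' ac x'1; have c2 := @ZS_cvg _ p _ y ac x1.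
  pose a l := zt c p l (x', y') - zt c p l (x, y).
  have [|n|_ ha] := @abs_series a (fun l => (`|cx c l| * expR (r * fr l)) * `|x' - x| +
     (`|cy c l| * expR (r * fr l)) * `|y' - y|) (M1 * `|x' - x| + M2 * `|y' - y|).
  - move=> l; rewrite /a (_ : zt c p l (x', y') - zt c p l (x, y) =
      (zt c p l (x', y') - zt c p l (x, y')) + (zt c p l (x, y') - zt c p l (x, y))); last by ring.
    apply: le_trans (ler_normD _ _) _; apply: lerD.
      exact: (@lip_on _ (fun t => zt (cx c) p l (t, y')) r _ x x' (is_derive_ztx c p l y')
        (fun t => @zt_bound (cx c) p l t y' r) xr xhr).
    have y1 : `|y| <= `|y| + `|y'| by rewrite lerDl.
    have y2 : `|y'| <= `|y| + `|y'| by rewrite lerDr.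
    exact: (@lip_on _ (fun t => zt (cy c) (py p) l (x, t)) _ _ y y' (is_derive_zty c p l x)
      (fun t _ => @zt_bound (cy c) (py p) l x t r xr) y1 y2).
  - by rewrite big_split /= -!mulr_suml; apply: lerD; apply: ler_wpM2r => //; [exact: hM1|exact: hM2].
  suff <- : limn (series a) = ZS c p (x', y') - ZS c p (x, y) by [].
  apply/cvg_lim => //.
  have -> : series a = (fun n => series (fun l => zt c p l (x', y')) n - series (fun l => zt c p l (x, y)) n).
    by apply/funext => n; rewrite /series /= /a sumrB.
  exact: cvgB.
apply/cvgrPdist_le => e e0 /=.
pose d := Num.min (r - `|x|) (e / (M1 + M2 + 1)).
have d0 : 0 < d.
  by rewrite lt_min; apply/andP; split; [rewrite /r; lra|rewrite divr_gt0//; lra].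
exists (ball x d, ball y d) => /=; first by split; exact: nbhsx_ballx.
move=> -[x' y'] [/= h1 h2].
move: h1 h2; rewrite /ball /= (distrC x x') (distrC y y') => /ltW h1 /ltW h2.
rewrite distrC; apply: le_trans (lip x' y' _) _; first by apply: le_trans h1 _; rewrite ge_min lexx.
apply: (@le_trans _ _ ((M1 + M2 + 1) * d)).
  have := ler_wpM2l M10 h1; have := ler_wpM2l M20 h2; lra.
have de : d <= e / (M1 + M2 + 1) by rewrite ge_min lexx orbT.
by rewrite mulrC -ler_pdivlMr//; lra.
Qed.

Lemma ZS_Ck k c p : adm c -> Ck k (@G1 R) (ZS c p).
Proof.
have QN (z : R * R) : G1 z -> `|z.1| < 1.
  by case: z => x y /QP[xI _]; rewrite ltr_norml.
have ct c' p' : adm c' -> forall z, G1 z -> {for z, continuous (ZS c' p')}.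
  by move=> ac' [x y] /QN x1; exact: ZS_cont.
elim: k c p => [|k IH] c p ac; split=> //; first exact: ct; first exact: ct.
split.
- by move=> [x y] /QN x1; case: (@is_derive_ZSx c p x y ac x1).
- by move=> [x y] /QN x1; case: (@is_derive_ZSy c p x y ac x1).
- apply: Ck_ext (IH _ p (adm_cx ac)); first exact: open_Q.
  move=> [x y] /QN x1; rewrite /dx derive1E.
  by case: (@is_derive_ZSx c p x y ac x1) => _ ->.
- apply: Ck_ext (IH _ (py p) (adm_cy ac)); first exact: open_Q.
  move=> [x y] /QN x1; rewrite /dy derive1E.
  by case: (@is_derive_ZSy c p x y ac x1) => _ ->.
Qed.

End ZS.
End RealSeries.

(** * Separated series for square-summable boundary data *)

Section Poisson.
Variable R : realType.
Local Notation mu := (@lebesgue_measure R).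
Local Notation T2 := (measurableTypeR R * measurableTypeR R)%type.
Local Notation mu2 := (mu \x mu)%E.
Local Notation J := (`[-1, 1]%classic : set (measurableTypeR R)).
Local Notation Q := (@G1 R : set T2).
Let mJ := @mJ R.
Let muJ_lty := @muJ_lty R.
Let mQ := @mQ R.
Let muQ_lty := @muQ_lty R.
Hint Resolve mQ muQ_lty mJ muJ_lty : core.
Local Notation fr := (fr R).

Lemma series_delta (a : nat -> R) (m : nat) (v : R) : (forall l, a l = if l == m then v else 0) ->
  series a @ \oo --> v.
Proof.
move=> h; apply: cvg_near_cst; near=> n.
have mn : (m < n)%N by near: n; exact: nbhs_infty_gt.
rewrite /series /= big_mkord (bigD1 (Ordinal mn))//= h eqxx big1 ?addr0// => i.
by rewrite -val_eqE /= => im; rewrite h (negbTE im).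
Unshelve. all: by end_near. Qed.

Lemma geo_sum (q : R) n : 0 <= q < 1 -> \sum_(l < n) q ^+ l <= (1 - q)^-1.
Proof.
move=> /andP[q0 q1]; have q' : 0 < 1 - q by rewrite subr_gt0.
rewrite -div1r ler_pdivlMr//.
suff -> : (\sum_(l < n) q ^+ l) * (1 - q) = 1 - q ^+ n by rewrite gerBl exprn_ge0.
elim: n => [|n IH]; first by rewrite big_ord0 mul0r expr0 subrr.
by rewrite big_ord_recr /= mulrDl IH exprSr; ring.
Qed.

(** Telescoping with [1 / l^2 <= 1 / (l - 1) - 1 / l]; the index 0 contributes 0 because
    [0^-1 = 0]. *)
Lemma inv_sq_sum n : \sum_(l < n) ((l%:R : R)^-1) ^+ 2 <= 2.
Proof.
have H k : \sum_(l < k.+2) ((l%:R : R)^-1) ^+ 2 <= 2 - (k.+1%:R)^-1.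
  elim: k => [|k IH]; first by rewrite !big_ord_recr big_ord0 !(invr0, invr1, expr0n, expr1n) /=; lra.
  rewrite big_ord_recr /=; apply: le_trans (lerD IH (lexx _)) _.
  have p1 : (0 : R) < k.+1%:R by rewrite ltr0n.
  rewrite -(natr1 k.+1); set x := k.+1%:R in p1 *.
  have i1 : x * x^-1 = 1 by rewrite divff ?gt_eqF.
  have i2 : (x + 1) * (x + 1)^-1 = 1 by rewrite divff ?gt_eqF// ltr_pwDr.
  have u0 : 0 < x^-1 by rewrite invr_gt0.
  have v0 : 0 < (x + 1)^-1 by rewrite invr_gt0; lra.
  set u := x^-1 in i1 u0 *; set v := (x + 1)^-1 in i2 v0 *.
  have e : u - v = u * v by nra.
  have vu : v <= u by nra.
  nra.
case: n => [|[|k]]; first by rewrite big_ord0.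
  by rewrite big_ord_recr big_ord0 /= invr0 expr0n add0r.
by apply: le_trans (H k) _; rewrite gerBl invr_ge0.
Qed.

(** The determinant of the system that fits [c1 e^(f x) + c2 e^(- f x)] to prescribed values at 1
    and -1; [cA] and [cB] are the entries of Cramer's solution. At [l = 0] it vanishes, and the
    convention for inverses makes both entries 0, in accordance with [sn 0 = 0]. *)
Definition den l : R := expR (fr l) * expR (fr l) - expR (- fr l) * expR (- fr l).
Definition cA l : R := expR (fr l) / den l.
Definition cB l : R := expR (- fr l) / den l.

Lemma exp_fr l : [/\ 0 < expR (fr l), 0 < expR (- fr l), expR (fr l) * expR (- fr l) = 1 &
  ((0 < l)%N -> 2 <= expR (fr l))].
Proof.
split; rewrite ?expR_gt0//; first by rewrite -expRD subrr expR0.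
move=> l0; apply: le_trans (expR_ge1Dx _); have := fr_ge R l.
have : (1 : R) <= l%:R by rewrite ler1n.
lra.
Qed.

Lemma den_gt0 l : (0 < l)%N -> 0 < den l.
Proof.
by move=> l0; have [E0 F0 EF1 /(_ l0) E2] := exp_fr l; rewrite /den; nra.
Qed.

Lemma cAB l : [/\ 0 <= cB l, cB l <= cA l & cA l <= 2 * expR (- fr l)].
Proof.
have [E0 F0 EF1 E2] := exp_fr l; case: (posnP l) => [l0|l0].
  have d0 : den l = 0 by rewrite /den l0 fr0 oppr0 expR0 subrr.
  by rewrite /cA /cB d0 invr0 !mulr0 lexx mulr_ge0// ltW.
have {}E2 := E2 l0; have d0 := den_gt0 l0; rewrite /cA /cB.
have FE : expR (- fr l) <= expR (fr l) by nra.
split; first by rewrite divr_ge0// ltW.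
  by rewrite ler_pM2r// invr_gt0.
rewrite ler_pdivrMr// /den; set E := expR (fr l) in E0 EF1 E2 FE *; set F := expR (- fr l) in F0 EF1 FE *.
have -> : 2 * F * (E * E - F * F) = 2 * E * (E * F) - 2 * F * F * F by ring.
rewrite EF1; have F1 : F <= 2^-1 by nra.
nra.
Qed.

Section half.
Variables a1 a2 : nat -> R.
Variables K1 K2 : R.
Hypothesis sq1 : forall n, \sum_(l < n) a1 l ^+ 2 <= K1.
Hypothesis sq2 : forall n, \sum_(l < n) a2 l ^+ 2 <= K2.

Definition c1 l : R := a1 l * cA l - a2 l * cB l.
Definition c2 l : R := a2 l * cA l - a1 l * cB l.

Lemma c12_le l : `|c1 l| <= (`|a1 l| + `|a2 l|) * cA l /\ `|c2 l| <= (`|a1 l| + `|a2 l|) * cA l.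
Proof.
have [B0 BA AE] := cAB l; have A0 : 0 <= cA l by exact: le_trans BA.
have n1 := normr_ge0 (a1 l); have n2 := normr_ge0 (a2 l).
have m1 := ler_wpM2l n1 BA; have m2 := ler_wpM2l n2 BA.
split; rewrite /c1 /c2; apply: le_trans (ler_normB _ _) _; rewrite mulrDl.
  by rewrite (normrM (a1 l)) (normrM (a2 l)) (ger0_norm A0) (ger0_norm B0) lerD2l.
by rewrite (normrM (a1 l)) (normrM (a2 l)) (ger0_norm A0) (ger0_norm B0) addrC lerD2r.
Qed.

Lemma sq_bnd (a : nat -> R) K l : (forall n, \sum_(l < n) a l ^+ 2 <= K) -> `|a l| <= 1 + K.
Proof.
move=> h; have := h l.+1; rewrite big_ord_recr /= => h1.
have : 0 <= \sum_(i < l) a i ^+ 2 by apply: sumr_ge0 => i _; exact: sqr_ge0.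
have := sqr_ge0 (`|a l| - 2^-1); rewrite -(real_normK (num_real (a l))) in h1; nra.
Qed.

Lemma adm_exp (c : nat -> R) K : (forall l, `|c l| <= K * expR (- fr l)) -> adm c.
Proof.
move=> h r r1; pose q : R := expR (r - 1).
have q1 : 0 <= q < 1 by rewrite expR_ge0 /= expR_lt1; lra.
have K0 : 0 <= K by have := h 0%N; rewrite fr0 oppr0 expR0 mulr1; exact: le_trans.
exists (K * (1 - q)^-1) => n; apply: le_trans (_ : _ <= \sum_(l < n) K * q ^+ l) _; last first.
  by rewrite -mulr_sumr ler_wpM2l// geo_sum.
apply: ler_sum => i _; apply: le_trans (ler_wpM2r (expR_ge0 _) (h i)) _.
rewrite -mulrA ler_wpM2l// -expRD /q -expRM_natl ler_expR.
have := fr_ge R i; nra.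
Qed.

Lemma adm_c12 : adm c1 /\ adm c2.
Proof.
pose K := (2 + K1 + K2) * 2.
have H l : (`|a1 l| + `|a2 l|) * cA l <= K * expR (- fr l).
  have [B0 BA AE] := cAB l; have A0 : 0 <= cA l by exact: le_trans BA.
  have s1 := sq_bnd l sq1; have s2 := sq_bnd l sq2.
  rewrite /K -mulrA; apply: ler_pM => //.
  by apply: le_trans (lerD s1 s2) _; lra.
split; apply: (@adm_exp _ K) => l; apply: le_trans (H l).
  exact: (c12_le l).1.
exact: (c12_le l).2.
Qed.

Definition strip_mode l (x : R) : R := c1 l * expR (fr l * x) + c2 l * expR (- fr l * x).
Definition strip_mode' l (x : R) : R := fr l * (c1 l * expR (fr l * x) - c2 l * expR (- fr l * x)).

Lemma is_derive_expx (a x : R) : is_derive x 1 (fun t : R => expR (a * t)) (a * expR (a * x)).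
Proof.
have h := is_derive_exp_affine a 0 x.
have -> : (fun t : R => expR (a * t)) = (fun t => expR (a * t + 0)).
  by apply/funext => t; rewrite addr0.
by apply: is_derive_eq h _; rewrite addr0.
Qed.

Lemma is_derive_strip_mode l (x : R) : is_derive x 1 (strip_mode l) (strip_mode' l x).
Proof.
have ? := is_derive_expx (fr l) x; have ? := is_derive_expx (- fr l) x.
by rewrite /strip_mode; apply: is_derive_eq; rewrite /strip_mode' /GRing.scale /=; ring.
Qed.

Lemma is_derive_strip_mode' l (x : R) : is_derive x 1 (strip_mode' l) (fr l ^+ 2 * strip_mode l x).
Proof.
have ? := is_derive_expx (fr l) x; have ? := is_derive_expx (- fr l) x.
by rewrite /strip_mode'; apply: is_derive_eq; rewrite /strip_mode /GRing.scale /=; ring.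
Qed.

Lemma strip_mode_cont l : continuous (strip_mode l). Proof. exact: is_derive_continuous (is_derive_strip_mode l). Qed.

Lemma strip_mode_ends l : (0 < l)%N -> strip_mode l 1 = a1 l /\ strip_mode l (-1) = a2 l.
Proof.
move=> l0; have d0 := den_gt0 l0; have [E0 F0 EF1 _] := exp_fr l.
rewrite /strip_mode /c1 /c2 /cA /cB !mulr1 !mulrN1 opprK.
have d1 : (den l)^-1 * den l = 1 by rewrite mulVf// gt_eqF.
have h : (den l)^-1 * (expR (fr l) * expR (fr l) - expR (- fr l) * expR (- fr l)) = 1 by exact: d1.
move: h EF1; move: (den l)^-1 (expR (fr l)) (expR (- fr l)) => D E F h EF1.
split; last first.
  rewrite -[RHS]mulr1 -h; ring.
by rewrite -[RHS]mulr1 -h; ring.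
Qed.

Lemma ip_strip_mode l k : (0 < l)%N ->
  (fr l ^+ 2 + fr k ^+ 2) * ip mu J (strip_mode l) (sn k) = fr k * ((-1) ^+ k.+1 * a1 l + a2 l).
Proof.
move=> l0; have [e1 e2] := strip_mode_ends l0.
have := int_green (is_derive_strip_mode l) (is_derive_strip_mode' l) (is_derive_sn k) (is_derive_sn2 k).
rewrite opprK => ->; rewrite e1 e2 sn1 snN1 cn1 cnN1 exprS; ring.
Qed.

Definition strip_sol (z : R * R) : R := ZS 1 c1 fr z + ZS (-1) c2 fr z.

Lemma strip_sol_term l z : zt 1 c1 fr l z + zt (-1) c2 fr l z = strip_mode l z.1 * sn l z.2.
Proof. by rewrite /zt /strip_mode /sn mul1r mulN1r; ring. Qed.

Lemma strip_sol_cvg z : Q z -> series (fun l => strip_mode l z.1 * sn l z.2) @ \oo --> strip_sol z.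
Proof.
case: z => x y /QP[/andP[x1 x2] _]; have [ad1 ad2] := adm_c12.
have ax : `|x| < 1 by rewrite ltr_norml x1 x2.
have n1 : `|1 : R| <= 1 by rewrite normr1.
have n2 : `|-1 : R| <= 1 by rewrite normrN1.
have k1 := @ZS_cvg R 1 n1 c1 fr x y ad1 ax; have k2 := @ZS_cvg R (-1) n2 c2 fr x y ad2 ax.
have -> : series (fun l => strip_mode l (x, y).1 * sn l (x, y).2) = (fun n =>
   series (fun l => zt 1 c1 fr l (x, y)) n + series (fun l => zt (-1) c2 fr l (x, y)) n).
  apply/funext => n; rewrite /series /= -big_split /=; apply: eq_bigr => i _.
  by rewrite (strip_sol_term i (x, y)).
exact: cvgD.
Qed.

Lemma strip_sol_smooth k : Ck k (@G1 R) strip_sol.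
Proof.
have [ad1 ad2] := adm_c12.
have n1 : `|1 : R| <= 1 by rewrite normr1.
have n2 : `|-1 : R| <= 1 by rewrite normrN1.
by apply: Ck_add; [exact: open_Q|exact: ZS_Ck|exact: ZS_Ck].
Qed.

(** Integrating the exponentials gains [1 / fr l], and Young's inequality makes
    [(|a1 l| + |a2 l|) / l] summable for square-summable data. The series thus converges in [L1],
    enough to read off its Fourier coefficients. *)
Lemma int_strip_mode_le l : \int[mu2]_(z in Q) `|strip_mode l z.1 * sn l z.2| <=
  2 * a1 l ^+ 2 + 2 * a2 l ^+ 2 + 4 * ((l%:R : R)^-1) ^+ 2.
Proof.
have gen (u v w : R) : 2 * (w * (2 * (u + v))) <= 2 * u ^+ 2 + 2 * v ^+ 2 + 4 * w ^+ 2.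
  by have := sqr_ge0 (u - w); have := sqr_ge0 (v - w); nra.
case: (posnP l) => [l0|l0].
  have -> : \int[mu2]_(z in Q) `|strip_mode l z.1 * sn l z.2| = \int[mu2]_(z in Q) (0 : R).
    by apply: Rint_eq => z _; rewrite l0 sn0 mulr0 normr0.
  have -> : \int[mu2]_(z in Q) (0 : R) = 0 by rewrite /Rintegral integral0.
  by rewrite !addr_ge0// mulr_ge0// sqr_ge0.
have f1 : 0 < fr l by exact: fr_gt0.
pose p (x : R) : R := `|c1 l| * expR (fr l * x) + `|c2 l| * expR (- fr l * x).
have dp (x : R) : is_derive x 1 (fun x => (fr l)^-1 * (`|c1 l| * expR (fr l * x) - `|c2 l| * expR (- fr l * x))) (p x).
  have ? := is_derive_expx (fr l) x; have ? := is_derive_expx (- fr l) x.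
  apply: is_derive_eq; rewrite /p /GRing.scale /=; field.
  by rewrite gt_eqF.
have cexp (a : R) : continuous (fun x : R => expR (a * x)).
  exact: is_derive_continuous (is_derive_expx a).
have cp : continuous p by apply: contD; apply: contM => //; exact: contC.
have c1' : continuous (fun _ : R => 1 : R) by exact: contC.
have lt : L1on mu2 Q (fun z => strip_mode l z.1 * sn l z.2).
  by apply: L2on_L1 => //; apply: prod_L2; [exact: strip_mode_cont|exact: sn_cont].
have lp : L1on mu2 Q (fun z => p z.1 * 1).
  by apply: L2on_L1 => //; exact: (@prod_L2 R p (fun=> 1) cp c1').
apply: (@le_trans _ _ (\int[mu2]_(z in Q) (p z.1 * 1))).
  apply: le_Rintegral => //; first exact: L1on_norm.
  move=> z _; rewrite normrM; apply: ler_pM => //; last exact: sn_le1.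
  rewrite /strip_mode; apply: le_trans (ler_normD _ _) _.
  by rewrite !normrM !(ger0_norm (expR_ge0 _)).
have -> : \int[mu2]_(z in Q) (p z.1 * 1) = 2 * ((fr l)^-1 * ((`|c1 l| + `|c2 l|) * (expR (fr l) - expR (- fr l)))).
  transitivity (ip mu2 Q (fun z => p z.1 * 1) (fun z => 1 * 1)).
    by apply: Rint_eq => z _; rewrite !mulr1.
  rewrite (ip_prod (q := fun=> 1) (p' := fun=> 1) (q' := fun=> 1))//.
  have -> : ip mu J (fun=> 1) (fun=> 1) = 2.
    have d (x : R) : is_derive x 1 (fun x : R => x) (1 * 1 : R) by rewrite mulr1; exact: is_derive_id.
    by rewrite /ip (FTC_J d)//; [ring|rewrite mulr1].
  have d2 (x : R) : is_derive x 1 (fun x => (fr l)^-1 * (`|c1 l| * expR (fr l * x) - `|c2 l| * expR (- fr l * x))) (p x * 1).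
    by rewrite mulr1.
  rewrite /ip (FTC_J d2); last by under eq_fun do rewrite mulr1.
  by rewrite !mulr1 !mulrN1 opprK; ring.
have [b1 b2] := c12_le l; have [E0 F0 EF1 /(_ l0) E2] := exp_fr l; have d0 := den_gt0 l0.
have EmF : 0 <= expR (fr l) - expR (- fr l) by nra.
have AE : cA l * (expR (fr l) - expR (- fr l)) <= 1.
  rewrite /cA mulrAC ler_pdivrMr// mul1r /den; nra.
set n1 := `|a1 l| in b1 b2 *; set n2 := `|a2 l| in b1 b2 *.
have n10 : 0 <= n1 by exact: normr_ge0.
have n20 : 0 <= n2 by exact: normr_ge0.
have s1 : a1 l ^+ 2 = n1 ^+ 2 by rewrite real_normK ?num_real.
have s2 : a2 l ^+ 2 = n2 ^+ 2 by rewrite real_normK ?num_real.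
have i0 : 0 <= (fr l)^-1 by rewrite invr_ge0 ltW.
have il : (fr l)^-1 <= l%:R^-1 by rewrite lef_pV2 ?posrE ?ltr0n//; exact: fr_ge.
have h1 : (`|c1 l| + `|c2 l|) * (expR (fr l) - expR (- fr l)) <= 2 * (n1 + n2).
  apply: le_trans (ler_wpM2r EmF (lerD b1 b2)) _.
  have -> : ((n1 + n2) * cA l + (n1 + n2) * cA l) * (expR (fr l) - expR (- fr l)) =
    2 * (n1 + n2) * (cA l * (expR (fr l) - expR (- fr l))) by ring.
  by rewrite -[leRHS]mulr1 ler_wpM2l// mulr_ge0// addr_ge0.
apply: (@le_trans _ _ (2 * (l%:R^-1 * (2 * (n1 + n2))))).
  rewrite ler_pM2l//; apply: (le_trans (ler_wpM2l i0 h1)).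
  by rewrite ler_wpM2r// mulr_ge0// addr_ge0.
by rewrite s1 s2; exact: gen.
Qed.

Lemma strip_sol_L1 : L1on mu2 Q strip_sol /\ forall k m, (0 < m)%N ->
  (fr k ^+ 2 + fr m ^+ 2) * ip mu2 Q strip_sol (fun z => sn k z.1 * sn m z.2) =
  fr k * ((-1) ^+ k.+1 * a1 m + a2 m).
Proof.
have lf l : L1on mu2 Q (fun z => strip_mode l z.1 * sn l z.2).
  by apply: L2on_L1 => //; apply: prod_L2; [exact: strip_mode_cont|exact: sn_cont].
have [||lU hU] := @L1_series _ _ _ mu2 Q mQ muQ_lty (fun l z => strip_mode l z.1 * sn l z.2) strip_sol
   (2 * K1 + 2 * K2 + 4 * 2) lf.
- move=> n; apply: (@le_trans _ _ (\sum_(i < n) (2 * a1 i ^+ 2 + 2 * a2 i ^+ 2 + 4 * ((i%:R : R)^-1) ^+ 2))).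
    by apply: ler_sum => i _; exact: int_strip_mode_le.
  rewrite !big_split /= -!mulr_sumr; apply: lerD; first apply: lerD.
  + by rewrite ler_pM2l// sq1.
  + by rewrite ler_pM2l// sq2.
  + by rewrite ler_pM2l// inv_sq_sum.
- exact: strip_sol_cvg.
split=> // k m m0.
have cs := @sn_cont R.
have := hU (fun z => sn k z.1 * sn m z.2) (meas2 (prod_cont (@cs k) (@cs m))) (prod_bounded (@cs k) (@cs m)).
have dl l : \int[mu2]_(z in Q) (strip_mode l z.1 * sn l z.2 * (sn k z.1 * sn m z.2)) =
    if l == m then ip mu J (strip_mode m) (sn k) else 0.
  rewrite (_ : \int[mu2]_(z in Q) _ = ip mu J (strip_mode l) (sn k) * ip mu J (sn l) (sn m)); last first.
    by rewrite -ip_prod//; exact: strip_mode_cont.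
  by rewrite ip_sn; case: eqP => [->|_] /=; rewrite ?m0 ?mulr1 ?mulr0.
move=> h; have e := cvg_unique _ h (series_delta dl).
by rewrite /ip e// addrC; exact: ip_strip_mode.
Qed.

(** At [x = 0] the mode is [c1 l + c2 l], and [cA l - cB l = 1 / (2 cosh (fr l))] for [l > 0]. *)
Lemma strip_sol_00 : series (fun l => (a1 l + a2 l) * (sn l 0 / (2 * cosh (fr l)))) @ \oo --> strip_sol (0, 0).
Proof.
have Q0 : Q (0, 0) by apply/QP; split; apply/andP; split; lra.
have := strip_sol_cvg Q0; rewrite (_ : (fun l => strip_mode l (0, 0).1 * sn l (0, 0).2) =
  (fun l => (a1 l + a2 l) * (sn l 0 / (2 * cosh (fr l)))))//.
apply/funext => l /=; case: (posnP l) => [->|l0]; first by rewrite sn0 mul0r !mulr0.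
have [E0 F0 EF1 /(_ l0) E2] := exp_fr l; have d0 := den_gt0 l0.
rewrite /strip_mode /c1 /c2 /cA /cB !mulr0 expR0 /cosh /den in d0 *.
move: d0 E0 F0; move: (expR (fr l)) (expR (- fr l)) => E F d0 E0 F0.
field.
by rewrite (gt_eqF d0) /= gt_eqF// addr_gt0.
Qed.

End half.

Section whole.
Variables a1 a2 b1 b2 : nat -> R.
Variable K : R.
Hypothesis sqa1 : forall n, \sum_(l < n) a1 l ^+ 2 <= K.
Hypothesis sqa2 : forall n, \sum_(l < n) a2 l ^+ 2 <= K.
Hypothesis sqb1 : forall n, \sum_(l < n) b1 l ^+ 2 <= K.
Hypothesis sqb2 : forall n, \sum_(l < n) b2 l ^+ 2 <= K.

Definition poisson z : R := strip_sol a1 a2 z + swp (strip_sol b1 b2) z.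

Lemma poisson_smooth : smooth_on (@G1 R) poisson.
Proof.
move=> k; apply: Ck_add; [exact: open_Q|exact: (strip_sol_smooth sqa1 sqa2 k)|].
have := Ck_swp (strip_sol_smooth sqb1 sqb2 k).
suff -> : [set p : R * R | G1 (p.2, p.1)] = @G1 R by [].
by apply/seteqP; split=> -[x y] /= /QP[? ?]; apply/QP.
Qed.

Lemma poisson_00 : series (fun l => (a1 l + a2 l + b1 l + b2 l) * (sn l 0 / (2 * cosh (fr l)))) @ \oo -->
  poisson (0, 0).
Proof.
have c := cvgD (strip_sol_00 sqa1 sqa2) (strip_sol_00 sqb1 sqb2).
set u := series _; have -> : u = series (fun l => (a1 l + a2 l) * (sn l 0 / (2 * cosh (fr l)))) +
    series (fun l => (b1 l + b2 l) * (sn l 0 / (2 * cosh (fr l)))); last exact: c.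
apply/funext => n; rewrite /u /series /= -[RHS]big_split /=; apply: eq_bigr => i _; ring.
Qed.

Lemma poisson_L1 : L1on mu2 Q poisson.
Proof.
by apply: L1onD => //; [exact: (strip_sol_L1 sqa1 sqa2).1|exact: swp_L1 (strip_sol_L1 sqb1 sqb2).1].
Qed.

Lemma poisson_fourier k m : (0 < k)%N -> (0 < m)%N ->
  (fr k ^+ 2 + fr m ^+ 2) * ip mu2 Q poisson (fun z => sn k z.1 * sn m z.2) =
  fr k * ((-1) ^+ k.+1 * a1 m + a2 m) + fr m * ((-1) ^+ m.+1 * b1 k + b2 k).
Proof.
move=> k0 m0; have cs := @sn_cont R.
have M i j : measurable_fun Q (fun z : R * R => sn i z.1 * sn j z.2) by apply: meas2; exact: prod_cont.
have B i j : bounded_on Q (fun z : R * R => sn i z.1 * sn j z.2 : R) by apply: prod_bounded.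
have [l1 h1] := strip_sol_L1 sqa1 sqa2; have [l2 h2] := strip_sol_L1 sqb1 sqb2.
have e : ip mu2 Q (swp (strip_sol b1 b2)) (fun z => sn k z.1 * sn m z.2) =
    ip mu2 Q (strip_sol b1 b2) (fun z => sn m z.1 * sn k z.2).
  rewrite -[RHS](@swp_int R (fun p => strip_sol b1 b2 p * (sn m p.1 * sn k p.2))); last exact: L1onM.
  by apply: ipQ_eq => // p _; rewrite mulrC.
rewrite -(h1 k m m0) -(h2 m k k0) [in RHS](addrC (fr m ^+ 2)) -mulrDr -e; congr (_ * _).
rewrite /ip -RintegralD//; last 2 first.
- exact: L1onM.
- by apply: L1onM => //; exact: swp_L1.
by apply: Rint_eq => z _; rewrite mulrDl.
Qed.

(** The difference has vanishing coefficients against the complete products of sines. Besides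
    harmonic functions with their traces, this serves the explicit separated solution in
    [ip_phiv_P]. *)
Lemma poisson_ae (h : R * R -> R) : L1on mu2 Q h ->
  (forall k m, (fr k ^+ 2 + fr m ^+ 2) * ip mu2 Q h (fun z => sn k z.1 * sn m z.2) =
    fr k * ((-1) ^+ k.+1 * a1 m + a2 m) + fr m * ((-1) ^+ m.+1 * b1 k + b2 k)) ->
  {ae mu2, forall z, Q z -> h z = poisson z}.
Proof.
move=> lh H; have cs := @sn_cont R; have cc := complete_sn.
have M i j : measurable_fun Q (fun z : R * R => sn i z.1 * sn j z.2) by apply: meas2; exact: prod_cont.
have B i j : bounded_on Q (fun z : R * R => sn i z.1 * sn j z.2 : R) by apply: prod_bounded.
have ld : L1on mu2 Q (fun z => h z - poisson z) by apply: L1onB => //; exact: poisson_L1.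
have := @prod_complete R _ _ _ ld (@sn_cont R) (@sn_cont R) (@complete_sn R) (@complete_sn R).
have FF := ae_filter_ringOfSetsType mu2.
suff h0 k l : ip mu2 Q (fun z => h z - poisson z) (fun z => sn k z.1 * sn l z.2) = 0.
  move=> /(_ h0); apply: filterS => z hz Qz; apply/eqP; rewrite -subr_eq0; apply/eqP; exact: hz.
have [->|k0] := posnP k.
  by rewrite (@ipQ_eq R _ _ (fun z => h z - poisson z) (fun=> 0)) ?ip0r// => z _; rewrite sn0 mul0r.
have [->|m0] := posnP l.
  by rewrite (@ipQ_eq R _ _ (fun z => h z - poisson z) (fun=> 0)) ?ip0r// => z _; rewrite sn0 mulr0.
have f0 : fr k ^+ 2 + fr l ^+ 2 != 0 by rewrite gt_eqF// addr_gt0// exprn_gt0// fr_gt0.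
apply: (mulfI f0); rewrite mulr0.
have -> : ip mu2 Q (fun z => h z - poisson z) (fun z => sn k z.1 * sn l z.2) =
  ip mu2 Q h (fun z => sn k z.1 * sn l z.2) - ip mu2 Q poisson (fun z => sn k z.1 * sn l z.2).
  rewrite /ip -RintegralB//; last 2 first.
  - exact: L1onM.
  - by apply: L1onM => //; exact: poisson_L1.
  by apply: Rint_eq => z _; rewrite mulrBl.
by rewrite mulrBr H poisson_fourier// subrr.
Qed.

End whole.
End Poisson.

(** * Steklov profiles *)

Section Beam.
Variable R : realType.
Local Notation mu := (@lebesgue_measure R).
Local Notation T2 := (measurableTypeR R * measurableTypeR R)%type.
Local Notation mu2 := (mu \x mu)%E.
Local Notation J := (`[-1, 1]%classic : set (measurableTypeR R)).
Local Notation Q := (@G1 R : set T2).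
Let mJ := @mJ R.
Let muJ_lty := @muJ_lty R.
Let mQ := @mQ R.
Let muQ_lty := @muQ_lty R.
Hint Resolve mQ muQ_lty mJ muJ_lty : core.
Local Notation fr := (fr R).

Lemma int_green2 (u u1 u2 v v1 v2 : R -> R) : (forall x : R, is_derive x 1 u (u1 x)) ->
  (forall x : R, is_derive x 1 u1 (u2 x)) -> (forall x : R, is_derive x 1 v (v1 x)) ->
  (forall x : R, is_derive x 1 v1 (v2 x)) -> continuous u2 -> continuous v2 ->
  ip mu J u2 v - ip mu J u v2 = (u1 1 * v 1 - u 1 * v1 1) - (u1 (-1) * v (-1) - u (-1) * v1 (-1)).
Proof.
move=> du du1 dv dv1 cu2 cv2.
have cu := is_derive_continuous du; have cv := is_derive_continuous dv.
have dF (x : R) : is_derive x 1 (fun x => u1 x * v x - u x * v1 x) (u2 x * v x - u x * v2 x).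
  have ? := du x; have ? := du1 x; have ? := dv x; have ? := dv1 x.
  by apply: is_derive_eq; rewrite /GRing.scale /=; ring.
have c1 : continuous (fun x => u2 x * v x) by exact: contM.
have c2 : continuous (fun x => u x * v2 x) by exact: contM.
rewrite -(FTC_J dF); last by move=> x; apply: cvgB; [exact: c1|exact: c2].
by rewrite /ip RintegralB//; exact: cont_L1.
Qed.

Lemma cosh_gt0 (x : R) : 0 < cosh x.
Proof. by rewrite /cosh divr_gt0// addr_gt0// expR_gt0. Qed.

Lemma coshN (x : R) : cosh (- x) = cosh x.
Proof. by rewrite /cosh opprK addrC. Qed.

Lemma sinhN (x : R) : sinh (- x) = - sinh x.
Proof. by rewrite /sinh opprK; ring. Qed.

Lemma cosh0 : cosh (0 : R) = 1.
Proof. by rewrite /cosh oppr0 expR0; field. Qed.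

Lemma cosh2Dsinh2 (x : R) : cosh x ^+ 2 - sinh x ^+ 2 = 1.
Proof.
have e : expR x * expR (- x) = 1 by rewrite -expRD subrr expR0.
rewrite /cosh /sinh.
have -> : ((expR x + expR (- x)) / 2) ^+ 2 - ((expR x - expR (- x)) / 2) ^+ 2 = expR x * expR (- x).
  by field.
by [].
Qed.

Lemma is_derive_cosx (v x : R) : is_derive x 1 (fun t : R => cos (v * t)) (- v * sin (v * x)).
Proof.
have h := is_derive_cos_affine v 0 x.
have -> : (fun t : R => cos (v * t)) = (fun t => cos (v * t + 0)).
  by apply/funext => t; rewrite addr0.
by apply: is_derive_eq h _; rewrite addr0.
Qed.

Lemma is_derive_sinx (v x : R) : is_derive x 1 (fun t : R => sin (v * t)) (v * cos (v * x)).
Proof.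
have h := is_derive_sin_affine v 0 x.
have -> : (fun t : R => sin (v * t)) = (fun t => sin (v * t + 0)).
  by apply/funext => t; rewrite addr0.
by apply: is_derive_eq h _; rewrite addr0.
Qed.

Lemma is_derive_coshx (v x : R) : is_derive x 1 (fun t : R => cosh (v * t)) (v * sinh (v * x)).
Proof.
have ? := is_derive_expx v x; have ? := is_derive_expx (- v) x.
rewrite /cosh (_ : (fun t : R => _) = (fun t : R => 2^-1 * (expR (v * t) + expR (- v * t)))).
  by apply: is_derive_eq; rewrite /sinh /GRing.scale /= !mulNr; field.
by apply/funext => t; rewrite mulNr mulrC.
Qed.

Lemma is_derive_sinhx (v x : R) : is_derive x 1 (fun t : R => sinh (v * t)) (v * cosh (v * x)).
Proof.
have ? := is_derive_expx v x; have ? := is_derive_expx (- v) x.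
rewrite /sinh (_ : (fun t : R => _) = (fun t : R => 2^-1 * (expR (v * t) - expR (- v * t)))).
  by apply: is_derive_eq; rewrite /cosh /GRing.scale /= !mulNr; field.
by apply/funext => t; rewrite mulNr mulrC.
Qed.

Lemma cosx_cont (v : R) : continuous (fun t : R => cos (v * t)).
Proof. exact: is_derive_continuous (is_derive_cosx v). Qed.
Lemma coshx_cont (v : R) : continuous (fun t : R => cosh (v * t)).
Proof. exact: is_derive_continuous (is_derive_coshx v). Qed.

Lemma is_derive_scale (c : R) (f : R -> R) (d x : R) : is_derive x 1 f d ->
  is_derive x 1 (fun t => c * f t) (c * d).
Proof. by move=> ?; apply: is_derive_eq; rewrite /GRing.scale /=. Qed.

(** Twice the indicator of odd indices, which are those of the even sines. *)
Definition eo l : R := 1 - (-1) ^+ l.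

(** Kept undivided, since [v] may coincide with a frequency [fr l]. *)
Lemma ip_cos_sn (v : R) l : (fr l ^+ 2 - v ^+ 2) * ip mu J (fun t => cos (v * t)) (sn l) =
  fr l * cos v * eo l.
Proof.
have d2 (x : R) : is_derive x 1 (fun t : R => - v * sin (v * t)) (- v ^+ 2 * cos (v * x)).
  by apply: is_derive_eq (is_derive_scale (- v) (is_derive_sinx v x)) _; ring.
have := int_green (is_derive_cosx v) d2 (is_derive_sn l) (is_derive_sn2 l).
rewrite sn1 snN1 cn1 cnN1 !mulr1 !mulrN1 cosN => e.
rewrite -[LHS]opprK -mulNr opprB (_ : v ^+ 2 - fr l ^+ 2 = - (- v ^+ 2 - - fr l ^+ 2)); last by ring.
by rewrite mulNr opprK e /eo; ring.
Qed.

Lemma ip_cosh_sn (v : R) l : (fr l ^+ 2 + v ^+ 2) * ip mu J (fun t => cosh (v * t)) (sn l) =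
  fr l * cosh v * eo l.
Proof.
have d2 (x : R) : is_derive x 1 (fun t : R => v * sinh (v * t)) (v ^+ 2 * cosh (v * x)).
  by apply: is_derive_eq (is_derive_scale v (is_derive_sinhx v x)) _; ring.
have := int_green (is_derive_coshx v) d2 (is_derive_sn l) (is_derive_sn2 l).
rewrite sn1 snN1 cn1 cnN1 !mulr1 !mulrN1 coshN => e.
rewrite (_ : fr l ^+ 2 + v ^+ 2 = v ^+ 2 - - fr l ^+ 2); last by ring.
by rewrite e /eo; ring.
Qed.

Lemma ip_1_sn l : fr l * ip mu J (fun=> 1) (sn l) = eo l.
Proof.
have [->|l0] := posnP l; first by rewrite fr0 mul0r /eo expr0 subrr.
have := ip_cos_sn 0 l; rewrite cos0 expr0n subr0 mulr1 expr2 -mulrA => /(mulfI _) <-.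
  by congr (_ * _); apply: ipJ_eq => // x _; rewrite mul0r cos0.
by rewrite gt_eqF// fr_gt0.
Qed.

Definition phiv (v t : R) : R := cosh v * cos (v * t) + cos v * cosh (v * t).
Definition phiv' (v t : R) : R := v * (- cosh v * sin (v * t) + cos v * sinh (v * t)).
(** The second derivative of [phiv v] divided by [v^2]. It vanishes at both ends, and at a root so
    does its derivative: [psiv v] is then a mode of the clamped beam. *)
Definition psiv (v t : R) : R := - cosh v * cos (v * t) + cos v * cosh (v * t).
Definition psiv' (v t : R) : R := v * (cosh v * sin (v * t) + cos v * sinh (v * t)).
(** The function [tan + tanh] with its denominators cleared. *)
Definition root_fun (v : R) : R := sin v * cosh v + cos v * sinh v.

Lemma is_derive_phiv v (x : R) : is_derive x 1 (phiv v) (phiv' v x).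
Proof.
have ? := is_derive_cosx v x; have ? := is_derive_coshx v x.
by rewrite /phiv; apply: is_derive_eq; rewrite /phiv' /GRing.scale /=; ring.
Qed.
Lemma is_derive_phiv' v (x : R) : is_derive x 1 (phiv' v) (v ^+ 2 * psiv v x).
Proof.
have ? := is_derive_sinx v x; have ? := is_derive_sinhx v x.
by rewrite /phiv'; apply: is_derive_eq; rewrite /psiv /GRing.scale /=; ring.
Qed.
Lemma is_derive_psiv v (x : R) : is_derive x 1 (psiv v) (psiv' v x).
Proof.
have ? := is_derive_cosx v x; have ? := is_derive_coshx v x.
by rewrite /psiv; apply: is_derive_eq; rewrite /psiv' /GRing.scale /=; ring.
Qed.
Lemma is_derive_psiv' v (x : R) : is_derive x 1 (psiv' v) (v ^+ 2 * phiv v x).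
Proof.
have ? := is_derive_sinx v x; have ? := is_derive_sinhx v x.
by rewrite /psiv'; apply: is_derive_eq; rewrite /phiv /GRing.scale /=; ring.
Qed.

Lemma phiv_cont v : continuous (phiv v). Proof. exact: is_derive_continuous (is_derive_phiv v). Qed.
Lemma psiv_cont v : continuous (psiv v). Proof. exact: is_derive_continuous (is_derive_psiv v). Qed.

Lemma psiv_ends v : [/\ psiv v 1 = 0, psiv v (-1) = 0, psiv' v 1 = v * root_fun v & psiv' v (-1) = - (v * root_fun v)].
Proof.
by rewrite /psiv /psiv' /root_fun !mulr1 !mulrN1 cosN sinN coshN sinhN; split; ring.
Qed.

Lemma ip_phiv_1 v : v * ip mu J (phiv v) (fun=> 1) = 2 * root_fun v.
Proof.
have [->|v0] := eqVneq v 0; first by rewrite mul0r /root_fun sin0 /sinh oppr0 subrr !mul0r mulr0 addr0 mulr0.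
have [_ _ e1 e2] := psiv_ends v.
have c2 : continuous (fun x : R => v ^+ 2 * phiv v x) by apply: contM; [exact: contC|exact: phiv_cont].
have E := FTC_J (is_derive_psiv' v) c2; rewrite e1 e2 in E.
apply: (mulfI v0); rewrite mulrA -expr2 -ipZl; last 2 first.
- exact: cont_L2 (@phiv_cont v).
- exact: cont_L2 (@contC R 1).
rewrite (_ : ip _ _ _ _ = \int[mu]_(x in J) (v ^+ 2 * phiv v x)).
  by rewrite E; ring.
  by apply: intJ_eq => x _; rewrite mulr1.
exact: mJ.
Qed.

(** At a root [psiv v] satisfies the clamped conditions, so two integrations by parts leave no
    boundary term. With the roles of two roots exchanged, this yields
    [(v^4 - w^4) <phiv v, phiv w> = 0]. *)
Lemma ip_phiv_psiv v w : root_fun v = 0 -> v ^+ 2 * ip mu J (phiv v) (phiv w) = w ^+ 2 * ip mu J (psiv v) (psiv w).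
Proof.
move=> D0; have [p1 p2 p3 p4] := psiv_ends v; rewrite D0 mulr0 ?oppr0 in p3 p4.
have c1 u : continuous (fun x : R => u ^+ 2 * phiv u x) by apply: contM; [exact: contC|exact: phiv_cont].
have c2 u : continuous (fun x : R => u ^+ 2 * psiv u x) by apply: contM; [exact: contC|exact: psiv_cont].
have := int_green2 (is_derive_psiv v) (is_derive_psiv' v) (is_derive_phiv w) (is_derive_phiv' w) (c1 v) (c2 w).
rewrite p1 p2 p3 p4 !mul0r !subr0.
have L u := cont_L2 (@phiv_cont u); have M u := cont_L2 (@psiv_cont u).
by rewrite ipZl// ipZr// => /eqP; rewrite subr_eq0 => /eqP.
Qed.

Lemma ip_phiv_orth v w : 0 < v -> 0 < w -> v != w -> root_fun v = 0 -> root_fun w = 0 -> ip mu J (phiv v) (phiv w) = 0.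
Proof.
move=> v0 w0 vw Dv Dw; have e1 := ip_phiv_psiv w Dv; have e2 := ip_phiv_psiv v Dw.
rewrite (ipC mu J (phiv w)) (ipC mu J (psiv w)) in e2.
have : (v ^+ 4 - w ^+ 4) * ip mu J (phiv v) (phiv w) = 0.
  rewrite (_ : (v ^+ 4 - w ^+ 4) * _ = v ^+ 2 * (v ^+ 2 * ip mu J (phiv v) (phiv w)) -
    w ^+ 2 * (w ^+ 2 * ip mu J (phiv v) (phiv w))); last by ring.
  by rewrite e1 e2; ring.
move=> /eqP; rewrite mulf_eq0 => /orP[|/eqP//].
rewrite subr_eq0 => /eqP h; have : v = w by apply/eqP; rewrite -(eqrXn2 (n := 4)) ?(ltW v0) ?(ltW w0)// h.
by move=> e; rewrite e eqxx in vw.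
Qed.

Lemma int_cos2 v : 0 < v -> ip mu J (fun t => cos (v * t)) (fun t => cos (v * t)) = 1 + sin v * cos v / v.
Proof.
move=> v0; have d2 (x : R) : is_derive x 1 (fun t : R => - v * sin (v * t)) (- v ^+ 2 * cos (v * x)).
  by apply: is_derive_eq (is_derive_scale (- v) (is_derive_sinx v x)) _; ring.
have e (x : R) : (- v * sin (v * x)) ^+ 2 - (- v ^+ 2) * cos (v * x) ^+ 2 = v ^+ 2.
  have := cos2Dsin2 (v * x) => h; rewrite -[RHS]mulr1 -h; ring.
have := int_square (is_derive_cosx v) d2 e.
rewrite !mulr1 !mulrN1 cosN sinN => h.
have v2 : 2 * - v ^+ 2 != 0 by rewrite mulf_neq0// oppr_eq0 expf_neq0// gt_eqF.
apply: (mulfI v2); rewrite h; field; exact: lt0r_neq0.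
Qed.

Lemma int_cosh2 v : 0 < v -> ip mu J (fun t => cosh (v * t)) (fun t => cosh (v * t)) = 1 + sinh v * cosh v / v.
Proof.
move=> v0; have d2 (x : R) : is_derive x 1 (fun t : R => v * sinh (v * t)) (v ^+ 2 * cosh (v * x)).
  by apply: is_derive_eq (is_derive_scale v (is_derive_sinhx v x)) _; ring.
have e (x : R) : (v * sinh (v * x)) ^+ 2 - (v ^+ 2) * cosh (v * x) ^+ 2 = - v ^+ 2.
  have := cosh2Dsinh2 (v * x) => h; rewrite -[RHS]mulr1 -h; ring.
have := int_square (is_derive_coshx v) d2 e.
rewrite !mulr1 !mulrN1 coshN sinhN => h.
have v2 : 2 * v ^+ 2 != 0 by rewrite mulf_neq0// expf_neq0// gt_eqF.
apply: (mulfI v2); rewrite h; field; exact: lt0r_neq0.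
Qed.

Lemma ip_lin2 (f g : R -> R) (a b : R) : L2on mu J f -> L2on mu J g ->
  ip mu J (fun t => a * f t + b * g t) (fun t => a * f t + b * g t) =
  a ^+ 2 * ip mu J f f + 2 * a * b * ip mu J f g + b ^+ 2 * ip mu J g g.
Proof.
move=> lf lg; have l1 := L2onZ mJ a lf; have l2 := L2onZ mJ b lg; have l3 := L2onD mJ l1 l2.
by rewrite ipDl// !ipDr// !ipZl// !ipZr// (ipC mu J g f); ring.
Qed.

(** [ip_phiv_psiv] with [w = v] gives [phiv v] and [psiv v] the same norm, so the mixed term between
    cosine and hyperbolic cosine drops out; the root equation cancels the remaining terms in
    [1 / v]. *)
Lemma ip_phiv_phiv v : 0 < v -> root_fun v = 0 -> ip mu J (phiv v) (phiv v) = cosh v ^+ 2 + cos v ^+ 2.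
Proof.
move=> v0 D0.
have v2 : v ^+ 2 != 0 by rewrite expf_neq0// gt_eqF.
have e := mulfI v2 (ip_phiv_psiv v D0).
have Lc := cont_L2 (@cosx_cont v); have Lh := cont_L2 (@coshx_cont v).
have e1 : ip mu J (phiv v) (phiv v) = cosh v ^+ 2 * ip mu J (fun t => cos (v * t)) (fun t => cos (v * t)) +
  2 * cosh v * cos v * ip mu J (fun t => cos (v * t)) (fun t => cosh (v * t)) +
  cos v ^+ 2 * ip mu J (fun t => cosh (v * t)) (fun t => cosh (v * t)).
  exact: (ip_lin2 _ _ Lc Lh).
have e2 : ip mu J (psiv v) (psiv v) = cosh v ^+ 2 * ip mu J (fun t => cos (v * t)) (fun t => cos (v * t)) -
  2 * cosh v * cos v * ip mu J (fun t => cos (v * t)) (fun t => cosh (v * t)) +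
  cos v ^+ 2 * ip mu J (fun t => cosh (v * t)) (fun t => cosh (v * t)).
  by have := ip_lin2 (- cosh v) (cos v) Lc Lh; rewrite -/(psiv v) => ->; ring.
rewrite -e in e2.
move: e1 e2; rewrite int_cos2// int_cosh2//.
move: (ip mu J (phiv v) (phiv v)) (ip mu J (fun t => cos (v * t)) _) => X M e1 e2.
have two : (2 : R) != 0 by rewrite pnatr_eq0.
apply: (mulfI two); transitivity (X + X); first by ring.
rewrite {1}e1 e2 -[RHS]addr0 -(mulr0 (2 * (cosh v * cos v / v))) -D0 /root_fun; field; exact: lt0r_neq0.
Qed.

Lemma ip_phiv_sn v l : (fr l ^+ 4 - v ^+ 4) * ip mu J (phiv v) (sn l) =
  2 * fr l ^+ 3 * cos v * cosh v * eo l.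
Proof.
have Lc := cont_L2 (@cosx_cont v); have Lh := cont_L2 (@coshx_cont v).
have l1 := L2onZ mJ (cosh v) Lc; have l2 := L2onZ mJ (cos v) Lh.
have ls := cont_L2 (@sn_cont R l).
rewrite /phiv ipDl// !ipZl//.
have e1 := ip_cos_sn v l; have e2 := ip_cosh_sn v l.
transitivity (cosh v * (fr l ^+ 2 + v ^+ 2) * ((fr l ^+ 2 - v ^+ 2) * ip mu J (fun t => cos (v * t)) (sn l)) +
  cos v * (fr l ^+ 2 - v ^+ 2) * ((fr l ^+ 2 + v ^+ 2) * ip mu J (fun t => cosh (v * t)) (sn l))).
  by ring.
by rewrite e1 e2; ring.
Qed.

Lemma pos_solution_root_fun (v : R) : pos_solution v -> [/\ 0 < v, cos v != 0 & root_fun v = 0].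
Proof.
move=> [v0 e]; have th : 0 < tanh v.
  rewrite /tanh divr_gt0 ?cosh_gt0// /sinh divr_gt0// subr_gt0 ltr_expR; lra.
have c0 : cos v != 0.
  by apply: contraTneq th => c0; move: e; rewrite /tan c0 invr0 mulr0 add0r => ->; rewrite ltxx.
split=> //; have h0 := cosh_gt0 v.
have : (tan v + tanh v) * (cos v * cosh v) = 0 by rewrite e mul0r.
rewrite /tan /tanh /root_fun => <-; field.
by rewrite c0 lt0r_neq0.
Qed.

Lemma root_fun_pos_solution (v : R) : 0 < v -> cos v != 0 -> root_fun v = 0 -> pos_solution v.
Proof.
move=> v0 c0 D0; split=> //; have h0 := cosh_gt0 v.
have : (tan v + tanh v) * (cos v * cosh v) = 0.
  by rewrite -D0 /tan /tanh /root_fun; field; rewrite c0 lt0r_neq0.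
by move=> /eqP; rewrite mulf_eq0 => /orP[/eqP//|]; rewrite mulf_eq0 (negbTE c0) /= gt_eqF.
Qed.

(** The same cancellation as in [ip_phiv_phiv]: the normalising integral is twice the square norm of
    the profile. *)
Lemma I1_root (v : R) : 0 < v -> root_fun v = 0 -> I1 v = 2 * (cosh v ^+ 2 + cos v ^+ 2).
Proof.
move=> v0 D0; rewrite /I1 /sinc.
have -> : sin (2 * v) = 2 * (sin v * cos v) by rewrite mulr_natl mulr2n sinD; ring.
have -> : sinh (2 * v) = 2 * (sinh v * cosh v).
  by rewrite mulr_natl mulr2n /sinh /cosh opprD !expRD; field.
rewrite -[RHS]addr0 -(mulr0 (2 * (cosh v * cos v / v))) -D0 /root_fun; field; exact: lt0r_neq0.
Qed.

End Beam.

(** * Completeness of the Steklov profiles *)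

Section Spectral.
Variable R : realType.
Local Notation mu := (@lebesgue_measure R).
Local Notation J := (`[-1, 1]%classic : set (measurableTypeR R)).
Let mJ := @mJ R.
Let muJ_lty := @muJ_lty R.
Hint Resolve mJ muJ_lty : core.
Local Notation fr := (fr R).
Implicit Types d e : R -> R.

Definition X d l : R := ip mu J d (sn l).
Let ls l := cont_L2 (@sn_cont R l).

Lemma X0 d : X d 0 = 0.
Proof.
rewrite /X (@ipJ_eq R d (sn 0) d (fun=> 0)) ?ip0r// => x _; exact: sn0.
Qed.

Lemma XD d e l : L2on mu J d -> L2on mu J e -> X (fun x => d x + e x) l = X d l + X e l.
Proof. by move=> ld le; rewrite /X ipDl. Qed.
Lemma XZ (c : R) d l : L2on mu J d -> X (fun x => c * d x) l = c * X d l.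
Proof. by move=> ld; rewrite /X ipZl. Qed.

Lemma sn_orth i j : i != j -> ip mu J (@sn R i) (sn j) = 0.
Proof. by move=> ij; rewrite ip_sn (negbTE ij). Qed.
Lemma sn_unit i : ip mu J (@sn R i) (sn i) = 1 \/ ip mu J (@sn R i) (sn i) = 0.
Proof. by rewrite ip_sn eqxx /=; case: ifP; auto. Qed.

Lemma X_bessel d n : L2on mu J d -> \sum_(l < n) X d l ^+ 2 <= ip mu J d d.
Proof. by move=> ld; apply: bessel => //; [exact: sn_orth|exact: sn_unit]. Qed.

Lemma X_le1 d l : L2on mu J d -> ip mu J d d <= 1 -> `|X d l| <= 1.
Proof.
move=> ld d1; have := X_bessel l.+1 ld; rewrite big_ord_recr /= => h.
have h0 : 0 <= \sum_(i < l) X d i ^+ 2 by apply: sumr_ge0 => i _; exact: sqr_ge0.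
rewrite -[leRHS](expr1n R 2) -(@ler_pXn2r R 2)// ?nnegrE//.
by rewrite expr1n real_normK ?num_real//; lra.
Qed.

Lemma X_parseval d e : L2on mu J d -> L2on mu J e ->
  series (fun l => X d l * X e l) @ \oo --> ip mu J d e.
Proof.
move=> ld le; apply: parseval => //; [exact: sn_orth|exact: sn_unit|].
move=> g lg g0; have h0 := sn_complete (L2on_L1 mJ muJ_lty lg) g0.
rewrite (@ip_ae _ _ _ _ _ mJ g (fun=> 0) d) => //; [|exact: lg.1|exact: ld.1].
by rewrite ip0l.
Qed.

Lemma X_proj_cvg d : L2on mu J d ->
  ip mu J (fun x => proj mu J (@sn R) d n x - d x) (fun x => proj mu J (@sn R) d n x - d x)
  @[n --> \oo] --> (0 : R).
Proof.
move=> ld; apply: proj_cvg => //; [exact: sn_orth|exact: sn_unit|].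
move=> g lg g0; have h0 := sn_complete (L2on_L1 mJ muJ_lty lg) g0.
rewrite (@ip_ae _ _ _ _ _ mJ g (fun=> 0) d) => //; [|exact: lg.1|exact: ld.1].
by rewrite ip0l.
Qed.

(** The surjective half of the isometry onto square-summable sequences, from which [Aop], weak
    limits and the kernel [P] are built by their coefficients. The condition at 0 reflects
    [sn 0 = 0]. *)
Lemma l2_exists (x : nat -> R) (K : R) : x 0%N = 0 -> (forall n, \sum_(l < n) x l ^+ 2 <= K) ->
  exists2 f, L2on mu J f & forall l, X f l = x l.
Proof.
move=> x0 xK; pose f_ n (t : R) := \sum_(l < n) x l * sn l t.
have lf n : L2on mu J (f_ n) by apply: L2on_sum => // i; exact: L2onZ.
have Xf n i : ip mu J (f_ n) (sn i) = if (i < n)%N then x i else 0.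
  rewrite /f_ ip_suml//; last by move=> j; exact: L2onZ.
  case: ltnP => ni.
    rewrite (bigD1 (Ordinal ni))//= big1 ?addr0; last first.
      by move=> j; rewrite -val_eqE /= => ji; rewrite ipZl// sn_orth ?mulr0.
    rewrite ipZl// ip_sn eqxx /=; case: (posnP i) => [i0|i0]; [by rewrite i0 /= x0 mul0r|by rewrite mulr1].
  rewrite big1// => j _; rewrite ipZl// sn_orth ?mulr0//.
  by apply: contraTneq ni => <-; rewrite -ltnNge.
pose s n := \sum_(i < n) x i ^+ 2.
have ff n m : (n <= m)%N -> ip mu J (f_ n) (f_ m) = s n.
  move=> nm; rewrite {1}/f_ ip_suml//; last by move=> j; exact: L2onZ.
  by apply: eq_bigr => i _; rewrite ipZl// ipC Xf (leq_trans (ltn_ord i) nm) expr2.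
have scvg : cvgn s.
  apply: nondecreasing_is_cvgn; last by exists K => _ [n _ <-]; exact: xK.
  by apply/nondecreasing_seqP => n; rewrite /s big_ord_recr /= lerDl sqr_ge0.
have snd : {homo s : n m / (n <= m)%N >-> n <= m}.
  by apply/nondecreasing_seqP => n; rewrite /s big_ord_recr /= lerDl sqr_ge0.
have pp n m : (n <= m)%N -> ip mu J (fun t => f_ n t - f_ m t) (fun t => f_ n t - f_ m t) = s m - s n.
  move=> nm; have lnm := L2onB mJ (lf n) (lf m).
  by rewrite ipBl// !ipBr// (ipC mu J (f_ m) (f_ n)) !ff//; ring.
have [] := @Riesz_Fischer _ _ _ mu J mJ muJ_lty f_ lf.
  move=> e e0; have /cvgrPdist_le/(_ e e0)[N _ hN] := scvg.
  exists N; suff H n m : (N <= n)%N -> (n <= m)%N ->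
      ip mu J (fun t => f_ n t - f_ m t) (fun t => f_ n t - f_ m t) <= e.
    move=> n m Nn Nm; have [nm|/ltnW mn] := leqP n m; first exact: H.
    have -> : ip mu J (fun t => f_ n t - f_ m t) (fun t => f_ n t - f_ m t) =
      ip mu J (fun t => f_ m t - f_ n t) (fun t => f_ m t - f_ n t) by apply: intJ_eq => t _; ring.
    exact: H.
  move=> Nn nm; rewrite pp//; apply: le_trans (hN n Nn).
  apply: le_trans (ler_norm _); rewrite lerD2r; exact: nondecreasing_cvgn_le.
move=> f lf' cf; exists f => // l.
have c1 := ip_cvgl mJ lf lf' (ls l) cf.
apply: cvg_unique c1 _ => //; apply: cvg_near_cst; near=> n.
rewrite Xf ifT//; near: n; exact: nbhs_infty_gt.
Unshelve. all: by end_near. Qed.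

Definition al l : R := if odd l then (fr l ^+ 4)^-1 else 0.

Lemma al_bound l : 0 <= al l <= 1.
Proof.
rewrite /al; case: ifP => ol; last by rewrite lexx ler01.
have l0 : (0 < l)%N by case: l ol.
have f1 : 1 <= fr l by apply: le_trans (fr_ge R l); rewrite ler1n.
by rewrite invr_ge0 exprn_ge0 ?invf_le1 ?exprn_ege1 ?exprn_gt0// ?(lt_le_trans ltr01)// (le_trans ler01).
Qed.

(** Decay of the eigenvalues, the source of the compactness of [Aop]. *)
Lemma al_tail N l : (0 < N)%N -> (N <= l)%N -> al l <= N%:R^-1.
Proof.
move=> N0 Nl; rewrite /al; case: ifP => ol; last by rewrite invr_ge0.
have l0 : (0 < l)%N by case: l ol {Nl}.
have f1 : 1 <= fr l by apply: le_trans (fr_ge R l); rewrite ler1n.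
have f0 : 0 < fr l by apply: lt_le_trans f1.
rewrite lef_pV2 ?posrE ?ltr0n ?exprn_gt0//.
apply: (@le_trans _ _ (fr l)); first by apply: le_trans (fr_ge R l); rewrite ler_nat.
by rewrite ler_eXnr.
Qed.

(* [Aop] inverts the fourth derivative on the even sines (those of odd index). As
   [phiv v] solves [u'''' = v^4 u], the profiles are its eigenvectors up to constants. *)
Definition Aop d : R -> R :=
  xget (fun=> 0) [set e | L2on mu J e /\ forall l, X e l = al l * X d l].

Lemma AopP d : L2on mu J d -> L2on mu J (Aop d) /\ forall l, X (Aop d) l = al l * X d l.
Proof.
move=> ld; rewrite /Aop; have [||e le he] := @l2_exists (fun l => al l * X d l) (ip mu J d d).
- by rewrite X0 mulr0.
- move=> n; apply: le_trans (X_bessel n ld); apply: ler_sum => i _.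
  have /andP[a0 a1] := al_bound i; rewrite exprMn ler_piMl ?sqr_ge0//.
  by rewrite exprn_ile1.
- by apply: (@xgetPex _ (fun=> 0) [set e | L2on mu J e /\ forall l, X e l = al l * X d l]); exists e.
Qed.

Lemma Aop_cvg d e : L2on mu J d -> L2on mu J e ->
  series (fun l => al l * (X d l * X e l)) @ \oo --> ip mu J (Aop d) e.
Proof.
move=> ld le; have [l1 h1] := AopP ld; have := X_parseval l1 le.
by rewrite (_ : (fun l => X (Aop d) l * X e l) = (fun l => al l * (X d l * X e l)))//;
  apply/funext => l; rewrite h1 mulrA.
Qed.

Definition q d := ip mu J (Aop d) d.

Lemma q_add d e : L2on mu J d -> L2on mu J e ->
  q (fun x => d x + e x) = q d + 2 * ip mu J (Aop d) e + q e.
Proof.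
move=> ld le; have lde := L2onD mJ ld le; rewrite /q.
apply: cvg_eq (Aop_cvg lde lde) (cvgD (cvgD (Aop_cvg ld ld) (cvgM (cvg_cst (2 : R)) (Aop_cvg ld le))) (Aop_cvg le le)) _ => n.
rewrite -[RHS]/(series _ n + 2 * series _ n + series _ n).
rewrite /series /= mulr_sumr -!big_split /=; apply: eq_bigr => i _.
by rewrite !XD//; ring.
Qed.

Lemma q_scale (c : R) d : L2on mu J d -> q (fun x => c * d x) = c ^+ 2 * q d.
Proof.
move=> ld; have lc := L2onZ mJ c ld; rewrite /q.
apply: cvg_eq (Aop_cvg lc lc) (cvgM (cvg_cst (c ^+ 2)) (Aop_cvg ld ld)) _ => n.
by rewrite /= /series /= mulr_sumr; apply: eq_bigr => i _; rewrite !XZ//; ring.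
Qed.

(** The truncation error is at most [1 / N] uniformly on the unit ball, so [q] behaves like a
    function of finitely many coefficients and passes to weak limits. *)
Lemma q_tail d N : L2on mu J d -> \sum_(l < N) al l * X d l ^+ 2 <= q d /\
  ((0 < N)%N -> ip mu J d d <= 1 -> q d <= \sum_(l < N) al l * X d l ^+ 2 + N%:R^-1).
Proof.
move=> ld; have c := Aop_cvg ld ld.
have t0 l : 0 <= al l * (X d l * X d l).
  by rewrite -expr2 mulr_ge0 ?sqr_ge0//; case/andP: (al_bound l).
have nd : {homo series (fun l => al l * (X d l * X d l)) : n m / (n <= m)%N >-> n <= m}.
  by apply/nondecreasing_seqP => n; rewrite seriesS lerDr t0.
have e n : series (fun l => al l * (X d l * X d l)) n = \sum_(l < n) al l * X d l ^+ 2.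
  by rewrite /series /= big_mkord; apply: eq_bigr => i _; rewrite expr2.
split.
  rewrite -e /q -(cvg_lim _ c)//; apply: nondecreasing_cvgn_le => //.
  by apply/cvg_ex; eexists; exact: c.
move=> N0 d1; rewrite /q -(cvg_lim _ c)//; apply: limr_le; first by apply/cvg_ex; eexists; exact: c.
near=> n; have Nn : (N <= n)%N by near: n; exact: nbhs_infty_ge.
rewrite e -(subnKC Nn) big_split_ord /= lerD2l.
apply: (@le_trans _ _ (N%:R^-1 * \sum_(i < n - N) X d (N + i) ^+ 2)).
  rewrite mulr_sumr; apply: ler_sum => i _; rewrite ler_wpM2r ?sqr_ge0// al_tail// leq_addr//.
rewrite -[leRHS]mulr1 ler_wpM2l ?invr_ge0//; apply: le_trans d1; apply: le_trans (X_bessel n ld).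
rewrite -[in leRHS](subnKC Nn) big_split_ord /= lerDr; apply: sumr_ge0 => i _; exact: sqr_ge0.
Unshelve. all: by end_near. Qed.

Lemma q_ge0 d : L2on mu J d -> 0 <= q d.
Proof. by move=> ld; have [h _] := q_tail 0 ld; rewrite big_ord0 in h. Qed.

Lemma q_le d : L2on mu J d -> q d <= ip mu J d d.
Proof.
move=> ld; have c := Aop_cvg ld ld; have c2 := X_parseval ld ld.
rewrite /q -(cvg_lim _ c)// -[leRHS](cvg_lim _ c2)//; apply: ler_lim.
- by apply/cvg_ex; eexists; exact: c.
- by apply/cvg_ex; eexists; exact: c2.
apply: nearW => n; rewrite /series /=; apply: ler_sum => i _.
by rewrite -expr2 ler_piMl ?sqr_ge0//; case/andP: (al_bound i).
Qed.

Definition phi_perp d := [/\ L2on mu J d, ip mu J d (fun=> 1) = 0 &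
  forall v, pos_solution v -> ip mu J d (phiv v) = 0].

Let l1 : L2on mu J (fun=> 1 : R) := cont_L2 (@contC R 1).
Let lphi v := cont_L2 (@phiv_cont R v).

Lemma ip_add2 d e : L2on mu J d -> L2on mu J e ->
  ip mu J (fun x => d x + e x) (fun x => d x + e x) = ip mu J d d + 2 * ip mu J d e + ip mu J e e.
Proof.
move=> ld le; have lde := L2onD mJ ld le; rewrite ipDl// !ipDr// (ipC mu J e d); ring.
Qed.

Lemma phi_perp_add d e : phi_perp d -> phi_perp e -> phi_perp (fun x => d x + e x).
Proof.
move=> [ld d1 dv] [le e1 ev]; split; first exact: L2onD.
  by rewrite ipDl// d1 e1 addr0.
by move=> v hv; rewrite ipDl// dv// ev// addr0.
Qed.

Lemma phi_perp_scale (c : R) d : phi_perp d -> phi_perp (fun x => c * d x).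
Proof.
move=> [ld d1 dv]; split; first exact: L2onZ.
  by rewrite ipZl// d1 mulr0.
by move=> v hv; rewrite ipZl// dv// mulr0.
Qed.

Lemma cvg_le_bound (F : set_system nat) {FF : ProperFilter F} (u : nat -> R) (l b : R) :
  u n @[n --> F] --> l -> (\forall n \near F, u n <= b) -> l <= b.
Proof.
move=> c h; rewrite -(cvg_lim _ c)//; apply: limr_le => //.
by apply/cvg_ex; exists l.
Qed.

Lemma cvg_ge_bound (F : set_system nat) {FF : ProperFilter F} (u : nat -> R) (l b : R) :
  u n @[n --> F] --> l -> (\forall n \near F, b <= u n) -> b <= l.
Proof.
move=> c h; rewrite -(cvg_lim _ c)//; apply: limr_ge => //.
by apply/cvg_ex; exists l.
Qed.

Lemma cvg_sum_ord (F : set_system nat) (f : nat -> nat -> R) (x : nat -> R) N : Filter F ->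
  (forall l, f n l @[n --> F] --> x l) ->
  \sum_(l < N) f n l @[n --> F] --> \sum_(l < N) x l.
Proof.
move=> FF h; elim: N => [|N IH].
  rewrite big_ord0 (_ : (fun n => _) = (fun=> 0)); first exact: cvg_cst.
  by apply/funext => n; rewrite big_ord0.
rewrite big_ord_recr (_ : (fun n => _) = (fun n => \sum_(l < N) f n l + f n N)); first exact: cvgD.
by apply/funext => n; rewrite big_ord_recr.
Qed.

(** Each coefficient stays in [[-1, 1]] and therefore converges along the ultrafilter; this takes
    the place of a diagonal subsequence. *)
Lemma weak_compact (d_ : nat -> R -> R) (U : set_system nat) : UltraFilter U -> 
  (forall n, L2on mu J (d_ n) /\ ip mu J (d_ n) (d_ n) <= 1) ->
  exists d, [/\ L2on mu J d, ip mu J d d <= 1,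
    forall l, X (d_ n) l @[n --> U] --> X d l &
    forall e, L2on mu J e -> (forall n, ip mu J (d_ n) e = 0) -> ip mu J d e = 0].
Proof.
move=> UU hd; have ld n := (hd n).1; have d1 n := (hd n).2.
have bX n l : `|X (d_ n) l| <= 1 by apply: X_le1.
have cX l : exists x : R, X (d_ n) l @[n --> U] --> x.
  have := @segment_compact R (-1) 1; rewrite compact_ultra => hc.
  have UF : ProperFilter (X (d_ n) l @[n --> U]) by exact: fmap_proper_filter.
  have := @segment_compact R (-1) 1 _ UF; case.
    have h : U [set n | (`[-1, 1]%classic : set R) (X (d_ n) l)].
      by apply: filterE => n /=; rewrite in_itv /= -ler_norml.
    exact: h.
  move=> x [_ hx]; exists x.
  move=> A Ax; apply: contrapT => nA.
  have UnA : U [set n | ~ A (X (d_ n) l)].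
    have [|//] := in_ultra_setVsetC [set n | A (X (d_ n) l)] UU; first by move=> /nA.
  have [|y [ny /interior_subset Ay]] := hx (~` A) (interior A) UnA.
    by apply: open_nbhs_nbhs; split; [exact: open_interior|exact: Ax].
  exact: ny.
have [x hx] := choice cX.
have x0 : x 0%N = 0.
  have e : (fun n => X (d_ n) 0) = (fun=> 0) by apply/funext => n; exact: X0.
  by have := hx 0%N; rewrite e => h; apply: cvg_unique h _ => //; exact: cvg_cst.
have sx N : (\sum_(l < N) X (d_ n) l ^+ 2) @[n --> U] --> \sum_(l < N) x l ^+ 2.
  apply: (@cvg_sum_ord U (fun n l => X (d_ n) l ^+ 2) (fun l => x l ^+ 2)) => l.
  under eq_fun do rewrite expr2; rewrite expr2; apply: cvgM; exact: hx.
have [|d ldd Xd] := @l2_exists x 1 x0.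
  move=> N; apply: (cvg_le_bound (sx N)).
  by apply: filterE => n /=; apply: le_trans (X_bessel N (ld n)) (d1 n).
exists d; split => //.
- have c := X_parseval ldd ldd; rewrite -(cvg_lim _ c)//; apply: limr_le.
    by apply/cvg_ex; eexists; exact: c.
  apply: nearW => N; rewrite /series /= big_mkord.
  have -> : \sum_(i < N) X d i * X d i = \sum_(l < N) x l ^+ 2.
    by apply: eq_bigr => i _; rewrite Xd expr2.
  apply: (cvg_le_bound (sx N)).
  by apply: filterE => n /=; apply: le_trans (X_bessel N (ld n)) (d1 n).
- by move=> l; rewrite Xd; exact: hx.
- move=> e le he.
  (* Orthogonality to [e] involves infinitely many coefficients: [e] is replaced by its first [N]
     sines, at a cost [r N] that is uniform in [n]. *)
  pose r N := ip mu J (fun t => proj mu J (@sn R) e N t - e t) (fun t => proj mu J (@sn R) e N t - e t).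
  have cr : r N @[N --> \oo] --> (0 : R) by exact: X_proj_cvg.
  have lp N : L2on mu J (proj mu J (@sn R) e N) by exact: L2on_proj.
  have pe N g : L2on mu J g -> ip mu J (proj mu J (@sn R) e N) g = \sum_(l < N) X e l * X g l.
    by move=> lg; rewrite ip_projr.
  have small N : (\sum_(l < N) X e l * x l) ^+ 2 <= r N.
    have cs : (\sum_(l < N) X e l * X (d_ n) l) ^+ 2 @[n --> U] --> (\sum_(l < N) X e l * x l) ^+ 2.
      have cs1 : \sum_(l < N) X e l * X (d_ n) l @[n --> U] --> \sum_(l < N) X e l * x l.
        apply: (@cvg_sum_ord U (fun n l => X e l * X (d_ n) l) (fun l => X e l * x l)) => l.
        by apply: cvgM; [exact: cvg_cst|exact: hx].
      under eq_fun do rewrite expr2; rewrite expr2; exact: cvgM.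
    apply: (cvg_le_bound cs).
    apply: filterE => n /=; rewrite -pe//.
    have le' := L2onB mJ (lp N) le.
    have -> : ip mu J (proj mu J (@sn R) e N) (d_ n) = ip mu J (fun t => proj mu J (@sn R) e N t - e t) (d_ n).
      by rewrite ipBl// (ipC mu J e) he subr0.
    apply: le_trans (ip_CS mJ le' (ld n)) _; rewrite -[leRHS]mulr1 ler_wpM2l//; exact: ip_ge0.
  have c1 := X_parseval le ldd; rewrite ipC.
  have c2 : (\sum_(l < N) X e l * x l) ^+ 2 @[N --> \oo] --> ip mu J e d ^+ 2.
    rewrite expr2; under eq_fun do rewrite expr2.
    have -> : (fun N => (\sum_(l < N) X e l * x l) * (\sum_(l < N) X e l * x l)) =
      (fun N => series (fun l => X e l * X d l) N * series (fun l => X e l * X d l) N).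
      apply/funext => N; rewrite /series /= big_mkord.
      by congr (_ * _); apply: eq_bigr => i _; rewrite Xd.
    exact: cvgM.
  have z : ip mu J e d ^+ 2 <= 0.
    have c3 : r N - (\sum_(l < N) X e l * x l) ^+ 2 @[N --> \oo] --> 0 - ip mu J e d ^+ 2 by exact: cvgB.
    rewrite -oppr_ge0 -sub0r; apply: (cvg_ge_bound c3); apply: nearW => N.
    by rewrite subr_ge0; exact: small.
  by apply/eqP; rewrite -sqrf_eq0 eq_le z sqr_ge0.
Qed.

Lemma sin_fr_even l : ~~ odd l -> sin (fr l) = 0.
Proof.
move=> el; have := sn1 R l./2; rewrite /sn mulr1 => <-; congr sin.
by rewrite -[in LHS](even_halfK el) -addnn /fr natrD mulrDl.
Qed.

Lemma eo_even l : ~~ odd l -> eo R l = 0.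
Proof. by move=> el; rewrite /eo -signr_odd (negbTE el) expr0 subrr. Qed.

Lemma eo_odd l : odd l -> eo R l = 2.
Proof. by move=> ol; rewrite /eo -signr_odd ol expr1 opprK. Qed.

Lemma X1_even l : ~~ odd l -> X (fun=> 1) l = 0.
Proof.
move=> el; have [->|lp] := posnP l; first exact: X0.
have f0 : fr l != 0 by rewrite gt_eqF// fr_gt0.
by apply: (mulfI f0); rewrite mulr0 -(eo_even el) -ip_1_sn.
Qed.

(** [ip_phiv_sn] is inconclusive only if [fr l = v]; then [sin v = 0], and the root equation would
    force [sinh v = 0]. *)
Lemma Xphi_even v l : pos_solution v -> ~~ odd l -> X (phiv v) l = 0.
Proof.
move=> hv el; have [v0 c0 D0] := pos_solution_root_fun hv.
have := ip_phiv_sn v l; rewrite eo_even// mulr0 => /eqP; rewrite mulf_eq0 => /orP[|/eqP//].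
rewrite subr_eq0 => /eqP h; have e : fr l = v.
  by apply/eqP; rewrite -(@eqrXn2 _ 4) ?fr_ge0 ?(ltW v0)// h.
move: D0; rewrite /root_fun -e sin_fr_even// mul0r add0r => /eqP; rewrite mulf_eq0 e (negbTE c0) /=.
rewrite /sinh mulf_eq0 invr_eq0 pnatr_eq0 orbF subr_eq0 => /eqP /expR_inj; lra.
Qed.

(** Termwise from [ip_phiv_sn]. For [d] in [phi_perp] the right side is 0, so [Aop d] is again
    orthogonal to the profiles and returns to [phi_perp] once its mean is subtracted. *)
Lemma Aop_phi d v : L2on mu J d -> pos_solution v ->
  ip mu J (Aop d) (phiv v) = (v ^+ 4)^-1 * (ip mu J d (phiv v) - 2 * cos v * cosh v * ip mu J d (fun=> 1)).
Proof.
move=> ld hv; have [v0 _ _] := pos_solution_root_fun hv; have v4 : v ^+ 4 != 0 by rewrite expf_neq0// gt_eqF.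
apply: (mulfI v4); rewrite mulrA mulfV// mul1r.
apply: cvg_eq (cvgM (cvg_cst (v ^+ 4)) (Aop_cvg ld (lphi v)))
  (cvgB (X_parseval ld (lphi v)) (cvgM (cvg_cst (2 * cos v * cosh v)) (X_parseval ld l1))) _ => n.
rewrite -[RHS]/(series _ n - _ * series _ n) -[LHS]/(_ * series _ n).
rewrite /series /= !mulr_sumr -sumrB; apply: eq_bigr => l _.
have e1 := ip_phiv_sn v l; have e2 := ip_1_sn R l.
rewrite -/(X (phiv v) l) in e1; rewrite -/(X (fun=> 1) l) in e2.
rewrite /al; case: ifP => ol; last first.
  by rewrite Xphi_even ?ol// X1_even ?ol//; ring.
have lp : (0 < l)%N by case: l ol {e1 e2}.
have f0 : fr l != 0 by rewrite gt_eqF// fr_gt0.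
have f4 : fr l ^+ 4 != 0 by rewrite expf_neq0.
apply: (mulfI f4).
have -> : fr l ^+ 4 * (v ^+ 4 * ((fr l ^+ 4)^-1 * (X d l * X (phiv v) l))) = v ^+ 4 * (X d l * X (phiv v) l).
  by field.
have e3 : fr l ^+ 4 * X (phiv v) l = v ^+ 4 * X (phiv v) l + 2 * fr l ^+ 3 * cos v * cosh v * eo R l.
  by rewrite -e1; ring.
have -> : fr l ^+ 4 * (X d l * X (phiv v) l - 2 * cos v * cosh v * (X d l * X (fun=> 1) l)) =
  X d l * (fr l ^+ 4 * X (phiv v) l) - 2 * cos v * cosh v * fr l ^+ 3 * X d l * (fr l * X (fun=> 1) l) by ring.
by rewrite e3 e2; ring.
Qed.

(** * The extremal problem on the complement of the profiles *)

Section extremal.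
Variables (d0 : R -> R) (l0 : nat).
Hypothesis Vd0 : phi_perp d0.
Hypothesis ol0 : odd l0.
Hypothesis Xd0 : X d0 l0 != 0.

Let E := [set q d | d in [set d | phi_perp d /\ ip mu J d d <= 1]].
Let S := sup E.

Let supE : has_sup E.
Proof.
split.
  exists (q (fun x => 0 * d0 x)), (fun x => 0 * d0 x) => //; split; first exact: phi_perp_scale.
  by have [ld _ _] := Vd0; rewrite ipZl ?mul0r//; exact: L2onZ.
by exists 1 => _ [d [[ld _ _] d1] <-]; apply: le_trans (q_le ld) d1.
Qed.

Let S_ub d : phi_perp d -> q d <= S * ip mu J d d.
Proof.
move=> Vd; have [ld _ _] := Vd; have n0 := ip_ge0 mu J d.
have [e0|nz] := eqVneq (ip mu J d d) 0; first by rewrite e0 mulr0 -e0; exact: q_le.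
have np : 0 < ip mu J d d by rewrite lt0r nz.
pose c := (Num.sqrt (ip mu J d d))^-1.
have c2 : c ^+ 2 = (ip mu J d d)^-1 by rewrite /c exprVn sqr_sqrtr.
have : q (fun x => c * d x) <= S.
  apply: ub_le_sup; first exact: supE.2.
  exists (fun x => c * d x) => //; split; first exact: phi_perp_scale.
  by rewrite ipZl ?ipZr//; [rewrite mulrA -expr2 c2 mulVf|exact: L2onZ].
by rewrite q_scale// c2 mulrC ler_pdivrMr.
Qed.

Let S_gt0 : 0 < S.
Proof.
have [ld _ _] := Vd0; have h := S_ub Vd0.
have q0 : 0 < q d0.
  have [t _] := q_tail l0.+1 ld; apply: lt_le_trans t; rewrite big_ord_recr /=.
  apply: (@lt_le_trans _ _ (al l0 * X d0 l0 ^+ 2)).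
    have p0 : (0 < l0)%N by case: l0 ol0.
    by rewrite mulr_gt0 ?exprn_even_gt0// /al ol0 invr_gt0 exprn_gt0// fr_gt0.
  rewrite lerDr; apply: sumr_ge0 => i _; rewrite mulr_ge0 ?sqr_ge0//.
  by case/andP: (al_bound i).
have := lt_le_trans q0 h; have := ip_ge0 mu J d0; move: (ip mu J d0 d0) => n n0 Sn.
by rewrite ltNge; apply/negP => S0; have := mulr_le0_ge0 S0 n0; rewrite leNgt Sn.
Qed.

Let S_le1 : S <= 1.
Proof.
apply: ge_sup; first exact: supE.1.
by move=> _ [d [[ld _ _] d1] <-]; apply: le_trans (q_le ld) d1.
Qed.

(** A maximising sequence has a weak limit in the unit ball of the complement, and the uniform tails
    of [q] show that no value is lost in the limit. *)
Lemma extremal : exists d, [/\ phi_perp d, ip mu J d d <= 1 & S <= q d].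
Proof.
have H n : exists d, phi_perp d /\ ip mu J d d <= 1 /\ S - n.+1%:R^-1 < q d.
  have e0 : (0 : R) < n.+1%:R^-1 by rewrite invr_gt0 ltr0n.
  by have [_ [d [Vd d1] <-] h] := sup_adherent e0 supE; exists d.
have [d_ hd] := choice H.
have [U [UU FU]] := @ultraFilterLemma nat \oo _.
have hd' n : L2on mu J (d_ n) /\ ip mu J (d_ n) (d_ n) <= 1.
  by have [[ld _ _] [d1 _]] := hd n.
have [d [ld d1 dX dw]] := weak_compact UU hd'.
exists d; split => //.
  split => //; first by apply: dw => // n; have [[_ h _] _] := hd n.
  by move=> v hv; apply: dw => // n; have [[_ _ h] _] := hd n; exact: h.
(* One [1 / (N + 1)] pays for the tail of [q], the other for the defect of the maximising
   sequence. *)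
suff H2 N : S - 2 * N.+1%:R^-1 <= q d.
  have c : S - 2 * N.+1%:R^-1 @[N --> \oo] --> S - 2 * 0.
    by apply: cvgB; [exact: cvg_cst|apply: cvgM; [exact: cvg_cst|exact: cvg_harmonic]].
  rewrite mulr0 subr0 in c; rewrite -(cvg_lim _ c)//; apply: limr_le; last exact: nearW.
  by apply/cvg_ex; eexists; exact: c.
have [t _] := q_tail N.+1 ld; apply: le_trans t.
have cs : \sum_(l < N.+1) al l * X (d_ n) l ^+ 2 @[n --> U] --> \sum_(l < N.+1) al l * X d l ^+ 2.
  apply: (@cvg_sum_ord U (fun n l => al l * X (d_ n) l ^+ 2) (fun l => al l * X d l ^+ 2)) => l.
  apply: cvgM; first exact: cvg_cst.
  under eq_fun do rewrite expr2; rewrite expr2; apply: cvgM; exact: dX.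
apply: (cvg_ge_bound cs).
apply: FU; exists N => // n /= Nn.
have [[ldn _ _] [dn1 hn]] := hd n; have [_ /(_ isT dn1) t] := q_tail N.+1 ldn.
have : (n.+1%:R : R)^-1 <= N.+1%:R^-1 by rewrite lef_pV2 ?posrE ?ltr0n// ler_nat.
move: hn t; move: (\sum_(l < N.+1) _) (q _) (n.+1%:R^-1) (N.+1%:R^-1) S => a b c e s *; lra.
Qed.

(* The maximiser of [q] satisfies [(Aop - S) d = const], so its coefficients are those of a multiple
   of [phiv v] with [v^4 = 1 / S]; then [d _|_ 1] makes [v] a root, against [d _|_ phiv v]. *)
Lemma extremal_absurd : False.
Proof.
have [d [Vd d1 Sq]] := extremal; have [ld dl1 dphi] := Vd.
have S0 := S_gt0; have S1 := S_le1.
have qS : q d = S by apply/eqP; rewrite eq_le Sq andbT; apply: le_trans (S_ub Vd) _; rewrite -[leRHS]mulr1 ler_pM2l.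
have dd : ip mu J d d = 1.
  apply/eqP; rewrite eq_le d1 /=; have := S_ub Vd; rewrite qS.
  by rewrite -[leLHS]mulr1 ler_pM2l.
have [lAd XA] := AopP ld.
pose g := ip mu J (Aop d) (fun=> 1) / 2.
have n1 : ip mu J (fun=> 1) (fun=> 1) = 2.
  rewrite /ip; have dx1 (x : R) : is_derive x 1 (fun x : R => x) (1 * 1 : R) by rewrite mulr1; exact: is_derive_id.
  by rewrite (FTC_J dx1); [ring|exact: (@contC R (1 * 1))].
pose y t := (Aop d t + (- g) * 1) + (- S) * d t.
have lg : L2on mu J (fun=> - g * 1) by exact: L2onZ.
have lSd : L2on mu J (fun t => - S * d t) by exact: L2onZ.
have lAg : L2on mu J (fun t => Aop d t + (- g) * 1) by exact: L2onD.
have ly : L2on mu J y by exact: L2onD.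
have ipy e : L2on mu J e -> ip mu J y e = ip mu J (Aop d) e - g * ip mu J (fun=> 1) e - S * ip mu J d e.
  by move=> le; rewrite /y ipDl// ipDl// ipZl// ipZl//; ring.
have Vy : phi_perp y.
  split=> //; first by rewrite ipy// n1 dl1 /g; field.
  move=> v hv; have [v0 c0 D0] := pos_solution_root_fun hv.
  rewrite ipy// Aop_phi// dphi// dl1 (ipC mu J (fun=> 1)).
  have -> : ip mu J (phiv v) (fun=> 1) = 0.
    by apply: (mulfI (lt0r_neq0 v0)); rewrite ip_phiv_1 D0 !mulr0.
  ring.
(* The variation is in the direction [y] itself: [q (d + y) <= S |d + y|^2] reduces to
   [2 |y|^2 + q y <= S |y|^2], and [S <= 1] then leaves only [y = 0]. *)
have y0 : ip mu J y y = 0.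
  have h := S_ub (phi_perp_add Vd Vy); rewrite q_add// in h.
  have e1 : ip mu J y y = ip mu J (Aop d) y - S * ip mu J d y.
    rewrite ipy// (ipC mu J (fun=> 1)); have [_ -> _] := Vy; ring.
  have e2 : ip mu J (fun x => d x + y x) (fun x => d x + y x) =
    ip mu J d d + 2 * ip mu J d y + ip mu J y y.
    exact: ip_add2.
  rewrite e2 dd qS in h; have qy := q_ge0 ly; have Y0 := ip_ge0 mu J y.
  move: h e1 qy Y0; move: (ip mu J y y) (ip mu J (Aop d) y) (ip mu J d y) (q y) => Y A B qy h e1 q0 Y0.
  by apply/eqP; rewrite eq_le Y0 andbT; nra.
have Xy l : X y l = 0.
  have := X_bessel l.+1 ly; rewrite y0 big_ord_recr /= => h.
  have s0 : 0 <= \sum_(i < l) X y i ^+ 2 by apply: sumr_ge0 => i _; exact: sqr_ge0.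
  by apply/eqP; rewrite -sqrf_eq0 eq_le sqr_ge0 andbT; lra.
have key l : (al l - S) * X d l = g * X (fun=> 1) l.
  have := Xy l; rewrite /X ipy// -!/(X _ l) XA => h.
  by apply/eqP; rewrite -subr_eq0 -[X in _ == X]h; apply/eqP; ring.
have even0 l : ~~ odd l -> X d l = 0.
  move=> el; have := key l; rewrite X1_even// mulr0 /al (negbTE el) sub0r => /eqP.
  by rewrite mulf_eq0 oppr_eq0 gt_eqF//= => /eqP.
have frp l : odd l -> 0 < fr l by move=> ol; apply: fr_gt0; case: l ol.
have X1_odd l : odd l -> X (fun=> 1) l = 2 / fr l.
  move=> ol; have f0 : fr l != 0 by rewrite gt_eqF// frp.
  by apply: (mulfI f0); rewrite ip_1_sn eo_odd//; field.
have [g0|gn] := eqVneq g 0.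
  (* Only one coordinate of d could survive, contradicting d _|_ 1. *)
  have z l : odd l -> al l != S -> X d l = 0.
    move=> ol aS; have := key l; rewrite g0 mul0r => /eqP; rewrite mulf_eq0 subr_eq0 (negbTE aS) /=.
    by move=> /eqP.
  have dsum : series (fun l => X d l * X (fun=> 1) l) @ \oo --> (0 : R).
    by have := X_parseval ld l1; rewrite dl1.
  have allz l : X d l = 0.
    have [el|ol] := boolP (~~ odd l); first exact: even0.
    rewrite negbK in ol; have [aS|/z] := eqVneq (al l) S; last exact.
    have others m : X d m * X (fun=> 1) m = if m == l then X d l * X (fun=> 1) l else 0.
      case: eqP => [->//|/eqP ml]; have [em|om] := boolP (~~ odd m); first by rewrite even0// mul0r.
      rewrite negbK in om; rewrite z ?mul0r//; apply: contra_neq ml => am.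
      move: aS; rewrite -am /al om ol => /invr_inj h.
      by apply: (@fr_inj R); apply/eqP; rewrite -(@eqrXn2 _ 4) ?fr_ge0// h.
    have /eqP := cvg_eq (series_delta others) dsum (fun=> erefl).
    rewrite mulf_eq0 X1_odd// => /orP[/eqP//|].
    by rewrite mulf_eq0 pnatr_eq0 /= invr_eq0 gt_eqF// frp.
  have := X_parseval ld ld; rewrite dd (_ : (fun l => _) = (fun=> 0)); last first.
    by apply/funext => l; rewrite allz mul0r.
  have c0 : series (fun=> 0 : R) @ \oo --> (0 : R) by apply: (@series_delta R _ 0%N) => l; case: ifP.
  by move=> c; have /eqP := cvg_eq c c0 (fun=> erefl); rewrite oner_eq0.
have aS l : odd l -> al l != S.
  move=> ol; apply: contra_neq gn => e; have := key l; rewrite e subrr mul0r X1_odd// => /esym/eqP.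
  rewrite mulf_eq0 => /orP[/eqP//|].
  by rewrite mulf_eq0 pnatr_eq0 /= invr_eq0 gt_eqF// frp.
pose v := Num.sqrt (Num.sqrt S^-1).
have v0 : 0 < v by rewrite !sqrtr_gt0 invr_gt0.
have v4 : v ^+ 4 = S^-1.
  by rewrite (exprM v 2 2) sqr_sqrtr ?sqrtr_ge0// sqr_sqrtr// invr_ge0 ltW.
have frv l : odd l -> fr l ^+ 4 - v ^+ 4 != 0.
  move=> ol; have := aS l ol; rewrite /al ol v4; apply: contra_neq => /eqP.
  by rewrite subr_eq0 => /eqP ->; rewrite invrK.
(* If [cos v = 0], all sine coefficients of [cos (v t)] vanish although its square norm is 1. The
   coincidence [fr l = v] is excluded by [frv] for odd [l], and by [sin v = 0] for even [l]. *)
have cv0 : cos v != 0.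
  apply/eqP => cv.
  have Xc l : ip mu J (fun t => cos (v * t)) (sn l) = 0.
    have := ip_cos_sn v l; rewrite cv mulr0 mul0r => /eqP; rewrite mulf_eq0 => /orP[|/eqP//].
    rewrite subr_eq0 => /eqP h; have e : fr l = v.
      by apply/eqP; rewrite -(@eqrXn2 _ 2) ?fr_ge0 ?(ltW v0)// h.
    have [ol|el] := boolP (odd l); first by have := frv l ol; rewrite e subrr eqxx.
    have := cos2Dsin2 v; rewrite cv -e sin_fr_even// !expr0n addr0 => /esym/eqP.
    by rewrite oner_eq0.
  have lc := cont_L2 (@cosx_cont R v).
  have := X_parseval lc lc; rewrite int_cos2// cv mulr0 mul0r addr0 (_ : (fun l => _) = (fun=> 0)); last first.
    by apply/funext => l; rewrite /X Xc mul0r.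
  have c0 : series (fun=> 0 : R) @ \oo --> (0 : R) by apply: (@series_delta R _ 0%N) => l; case: ifP.
  by move=> c; have /eqP := cvg_eq c c0 (fun=> erefl); rewrite oner_eq0.
have hv0 := lt0r_neq0 (cosh_gt0 v).
(* The ratio of the coefficients of [d] and [phiv v]: on odd indices both are
   [fr l ^+ 3 / (fr l ^+ 4 - v ^+ 4)] up to factors that do not depend on [l]. *)
pose K := - g / (2 * S * (cos v * cosh v)).
have Sn : S != 0 by rewrite gt_eqF.
have two : (2 : R) != 0 by rewrite pnatr_eq0.
have k1 := mulf_neq0 (mulf_neq0 two Sn) (mulf_neq0 cv0 hv0).
have K0 : K != 0 by rewrite /K mulf_neq0 ?oppr_eq0// invr_eq0.
have XK l : odd l -> X d l = K * X (phiv v) l.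
  move=> ol; have fl := frv l ol; apply: (mulfI fl).
  rewrite mulrCA [X in K * X]ip_phiv_sn eo_odd// /K.
  have f0 : fr l != 0 by rewrite gt_eqF// frp.
  have f4 : fr l ^+ 4 != 0 by rewrite expf_neq0.
  have k := key l; rewrite X1_odd// /al ol in k.
  have -> : (fr l ^+ 4 - v ^+ 4) * X d l = - (fr l ^+ 4 / S) * (((fr l ^+ 4)^-1 - S) * X d l).
    by rewrite v4; field; rewrite Sn f0.
  rewrite k; field.
  by rewrite Sn f0 hv0 cv0.
have dK : ip mu J d d = K * ip mu J d (phiv v).
  apply: cvg_eq (X_parseval ld ld) (cvgM (cvg_cst K) (X_parseval ld (lphi v))) _ => n.
  rewrite -[RHS]/(K * series _ n) /series /= mulr_sumr; apply: eq_bigr => l _.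
  have [el|ol] := boolP (~~ odd l); first by rewrite even0// !mul0r mulr0.
  rewrite negbK in ol; rewrite [X in X * _ = _]XK//; ring.
have oneK : ip mu J d (fun=> 1) = K * ip mu J (phiv v) (fun=> 1).
  apply: cvg_eq (X_parseval ld l1) (cvgM (cvg_cst K) (X_parseval (lphi v) l1)) _ => n.
  rewrite -[RHS]/(K * series _ n) /series /= mulr_sumr; apply: eq_bigr => l _.
  have [el|ol] := boolP (~~ odd l); first by rewrite X1_even// !mulr0.
  rewrite negbK in ol; rewrite XK//; ring.
have Dv : root_fun v = 0.
  have h : K * ip mu J (phiv v) (fun=> 1) = 0 by rewrite -oneK.
  move: h => /eqP; rewrite mulf_eq0 (negbTE K0) /= => /eqP h.
  by have := ip_phiv_1 v; rewrite h mulr0 => /esym/eqP; rewrite mulf_eq0 pnatr_eq0 /= => /eqP.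
have hv := root_fun_pos_solution v0 cv0 Dv.
by move: dK; rewrite dphi// mulr0 dd => /eqP; rewrite oner_eq0.
Qed.

End extremal.

(* [sn l] is an even function exactly when [l] is odd. *)
Lemma steklov_spectral d l : phi_perp d -> odd l -> X d l = 0.
Proof.
move=> Vd ol; apply/eqP/negP => /negP h; exact: extremal_absurd Vd ol h.
Qed.

End Spectral.

(** * Positive roots of tan + tanh *)

Section Roots.
Variable R : realType.

Lemma root_fun_cos_neq0 (v : R) : root_fun v = 0 -> cos v != 0.
Proof.
move=> D0; apply/eqP => c0; move: D0; rewrite /root_fun c0 mul0r addr0 => /eqP.
rewrite mulf_eq0 (gt_eqF (cosh_gt0 v)) orbF => /eqP s0.
by have := cos2Dsin2 v; rewrite c0 s0 expr0n addr0 => /esym/eqP; rewrite oner_eq0.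
Qed.

Lemma sin_cos_piquarter : 0 < cos (pi / 4 : R) /\ sin (pi / 4 : R) = cos (pi / 4).
Proof.
have c0 : 0 < cos (pi / 4 : R).
  have p0 := pi_gt0 R; apply: cos_gt0_pihalf; apply/andP; split; lra.
split=> //; have := tan_piquarter R; rewrite /tan => h.
exact: divr1_eq h.
Qed.

(** A form free of division of [tan (v + pi/4) = e^(-2v)], which exhibits the large roots as slight
    perturbations of the points [n pi - pi/4]. *)
Lemma root_fun_rootP (v : R) : root_fun v = 0 <-> sin (v + pi / 4) = expR (- (2 * v)) * cos (v + pi / 4).
Proof.
have [k0 ks] := sin_cos_piquarter; have E0 := expR_gt0 v; have F0 := expR_gt0 (- v).
have EF1 : expR v * expR (- v) = 1 by rewrite -expRD subrr expR0.
have -> : expR (- (2 * v)) = expR (- v) * expR (- v) by rewrite -expRD; congr expR; ring.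
rewrite sinD cosD ks /root_fun /cosh /sinh.
move: k0 E0 F0 EF1; move: (cos (pi / 4)) (expR v) (expR (- v)) (sin v) (cos v) => k E F s c k0 E0 F0 EF1.
have e : 2 * k * F * (s * ((E + F) / 2) + c * ((E - F) / 2)) =
   (s * k + c * k) * (E * F) - F * F * (c * k - s * k) by field.
rewrite EF1 mulr1 in e; split=> h.
  by apply/eqP; rewrite -subr_eq0 -e h mulr0.
have k1 : 2 * k * F != 0 by rewrite !mulf_neq0 ?pnatr_eq0// gt_eqF.
by apply: (mulfI k1); rewrite e h subrr mulr0.
Qed.

Lemma trig_npi (x : R) n : sin (n%:R * pi + x) = (-1) ^+ n * sin x /\
  cos (n%:R * pi + x) = (-1) ^+ n * cos x.
Proof.
elim: n => [|n [IHs IHc]]; first by rewrite !mul0r !add0r expr0 !mul1r.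
have -> : n.+1%:R * pi + x = (n%:R * pi + x) + pi by rewrite -natr1; ring.
by rewrite sinDpi cosDpi IHs IHc exprS; split; ring.
Qed.

(** [t] is the offset from [n pi - pi/4]. The index 0 carries the trivial solution 0, so the
    positive solutions are numbered from 1. *)
Definition root_at n (v : R) := exists t, [/\ 0 < t < pi / 2, v = n%:R * pi - pi / 4 + t &
  sin t = expR (- (2 * v)) * cos t].

Lemma root_atP n (v t : R) : v = n%:R * pi - pi / 4 + t ->
  (root_fun v = 0 <-> sin t = expR (- (2 * v)) * cos t).
Proof.
move=> e; have [s c] := trig_npi t n.
have -> : root_fun v = 0 <-> sin (v + pi / 4) = expR (- (2 * v)) * cos (v + pi / 4) by exact: root_fun_rootP.
have -> : v + pi / 4 = n%:R * pi + t by rewrite e; ring.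
have n0 : (-1) ^+ n != 0 :> R by rewrite signr_eq0.
by rewrite s c; split=> h; [apply: (mulfI n0); rewrite h; ring|rewrite h; ring].
Qed.

Lemma root_at_pos n (v : R) : (0 < n)%N -> root_at n v -> pos_solution v.
Proof.
move=> n0 [t [/andP[t0 t1] e h]]; have p0 := pi_gt0 R.
have D0 : root_fun v = 0 by apply/(root_atP e).
have v0 : 0 < v.
  have : (1 : R) <= n%:R by rewrite ler1n.
  by rewrite e; nra.
by apply: root_fun_pos_solution => //; exact: root_fun_cos_neq0.
Qed.

Lemma pos_root_at (v : R) : pos_solution v -> exists2 n, (0 < n)%N & root_at n v.
Proof.
move=> hv; have [v0 c0 D0] := pos_solution_root_fun hv; have p0 := pi_gt0 R.
have w0 : 0 <= (v + pi / 4) / pi by rewrite divr_ge0 ?(ltW p0)//; lra.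
pose n := Num.truncn ((v + pi / 4) / pi).
have /andP[n1 n2] := truncn_itv w0; rewrite -/n ler_pdivlMr// in n1; rewrite -/n ltr_pdivrMr// in n2.
pose t := v + pi / 4 - n%:R * pi.
have t0 : 0 <= t by rewrite subr_ge0.
have t1 : t < pi by rewrite /t; move: n2; rewrite -natr1; lra.
have e : v = n%:R * pi - pi / 4 + t by rewrite /t; ring.
have h := (root_atP e).1 D0.
have E0 := expR_gt0 (- (2 * v)).
have s0 : 0 <= sin t by apply: sin_ge0_pi; rewrite t0 ltW.
have tn0 : t != 0.
  apply/eqP => z; move: h; rewrite z sin0 cos0 mulr1 => /esym/eqP; by rewrite gt_eqF.
have tp : 0 < t by rewrite lt0r tn0.
have sp : 0 < sin t by apply: sin_gt0_pi; rewrite tp.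
have cp : 0 < cos t by rewrite -(pmulr_rgt0 _ E0) -h.
have t2 : t < pi / 2.
  rewrite ltNge; apply/negP => h2; move: cp.
  have -> : t = (t - pi / 2) + pi / 2 by ring.
  rewrite cosDpihalf oppr_gt0 ltNge => /negP; apply; apply: sin_ge0_pi; apply/andP; split; lra.
exists n; last by exists t; rewrite tp t2.
rewrite lt0n; apply/eqP => n0; move: e; rewrite n0 mul0r sub0r => e.
have : expR (- (2 * v)) < 1 by rewrite expR_lt1; lra.
(* [n = 0] would give [t > pi/4], hence [tan t > 1]. *)
have tq : pi / 4 < t by lra.
have [k0 ks] := sin_cos_piquarter.
have s1 : sin (pi / 4) < sin t by rewrite ltr_sin// in_itv /=; apply/andP; split; lra.
have c1 : cos t < cos (pi / 4) by rewrite ltr_cos// in_itv /=; apply/andP; split; lra.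
move: h; rewrite ks in s1; move: s1 c1 k0 cp E0.
move: (expR _) (cos t) (sin t) (cos (pi / 4)) => E c s k *; nra.
Qed.

Lemma root_at_exists n : exists v, root_at n v.
Proof.
have p0 := pi_gt0 R.
pose f (t : R) := sin t - expR (- (2 * (n%:R * pi - pi / 4 + t))) * cos t.
have cf : continuous f.
  have ? := @is_derive_exp_affine R; have ds := @is_derive_sinx R 1.
  have df (t : R) : is_derive t 1 (fun t : R => expR (- (2 * (n%:R * pi - pi / 4 + t))))
      (- 2 * expR (- (2 * (n%:R * pi - pi / 4 + t)))).
    have := is_derive_exp_affine (- 2) (- (2 * (n%:R * pi - pi / 4))) t.
    rewrite (_ : (fun t : R => expR (- 2 * t + _)) = (fun t : R => expR (- (2 * (n%:R * pi - pi / 4 + t))))).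
      by move=> h; apply: is_derive_eq h _; congr (_ * expR _); ring.
    by apply/funext => x; congr expR; ring.
  have cE := is_derive_continuous df.
  move=> t; apply: cvgB; first exact: continuous_sin.
  by apply: cvgM; [exact: cE|exact: continuous_cos].
have f0 : f 0 < 0 by rewrite /f sin0 cos0 mulr1 sub0r oppr_lt0 expR_gt0.
have f1 : f (pi / 2) = 1 by rewrite /f sin_pihalf cos_pihalf mulr0 subr0.
have [|||t tI ft] := @IVT R f 0 (pi / 2) 0.
- lra.
- exact: continuous_subspaceT.
- by rewrite f1 ge_min le_max (ltW f0) ler01 orbT.
exists (n%:R * pi - pi / 4 + t), t; split=> //; last first.
  by apply/eqP; rewrite -subr_eq0; apply/eqP; exact: ft.
move: tI; rewrite in_itv /= => /andP[t0 t1]; apply/andP; split; rewrite lt_neqAle ?t0 ?t1 andbT.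
  by apply/eqP => z; move: f0; rewrite [X in f X]z ft ltxx.
by apply/eqP => z; move: ft; rewrite z f1 => /eqP; rewrite oner_eq0.
Qed.

(** For offsets [t < u] one has [sin (u - t) = cos t * cos u * (e^(-2w) - e^(-2v))], positive on the
    left and nonpositive on the right. *)
Lemma root_at_uniq n v w : root_at n v -> root_at n w -> v = w.
Proof.
wlog vw : v w / v <= w.
  by move=> H hv hw; case: (leP v w) => [|/ltW] h; [exact: H|apply/esym; exact: H].
move=> [t [/andP[t0 t1] ev ht]] [u [/andP[u0 u1] ew hu]].
apply/eqP; rewrite eq_le vw leNgt; apply/negP => lt.
have tu : t < u by lra.
have p0 := pi_gt0 R.
have s : 0 < sin (u - t) by apply: sin_gt0_pi; apply/andP; split; lra.
have ct : 0 < cos t by apply: cos_gt0_pihalf; apply/andP; split; lra.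
have cu : 0 < cos u by apply: cos_gt0_pihalf; apply/andP; split; lra.
have E : expR (- (2 * w)) <= expR (- (2 * v)) by rewrite ler_expR; lra.
move: s; rewrite sinB ht hu; move: E ct cu; move: (expR _) (expR _) (cos t) (cos u) => a b c d E c0 d0 h.
have := mulr_gt0 c0 d0; nra.
Qed.

Definition rt n : R := xget 0 (root_at n).

Lemma rtP n : root_at n (rt n).
Proof. by have [v hv] := root_at_exists n; apply: (@xgetPex _ 0 (root_at n)); exists v. Qed.

Lemma rt_itv n : n%:R * pi - pi / 4 < rt n < n%:R * pi + pi / 4.
Proof. by have [t [/andP[t0 t1] -> _]] := rtP n; apply/andP; split; lra. Qed.

Lemma rt_mono m n : (m < n)%N -> rt m < rt n.
Proof.
move=> mn; have /andP[_ h1] := rt_itv m; have /andP[h2 _] := rt_itv n.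
have p0 := pi_gt0 R; have : m.+1%:R <= n%:R :> R by rewrite ler_nat.
rewrite -natr1 => h; apply: (lt_trans h1); apply: le_lt_trans h2; nra.
Qed.

Lemma rt_le m n : (rt m <= rt n) = (m <= n)%N.
Proof.
case: leqP => h; last by apply/negbTE; rewrite -ltNge; exact: rt_mono.
by move: h; rewrite leq_eqVlt => /orP[/eqP ->|/rt_mono/ltW//]; rewrite lexx.
Qed.

Lemma rt_pos n : (0 < n)%N -> pos_solution (rt n).
Proof. by move=> n0; apply: root_at_pos (rtP n). Qed.

Lemma pos_rt (v : R) : pos_solution v -> exists2 n, (0 < n)%N & v = rt n.
Proof. by move=> /pos_root_at[n n0 h]; exists n => //; exact: root_at_uniq h (rtP n). Qed.

Lemma rt_card j : ([set y : R | pos_solution y /\ y <= rt j] #= `I_j)%card.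
Proof.
have -> : [set y : R | pos_solution y /\ y <= rt j] = (fun i => rt i.+1) @` `I_j.
  apply/seteqP; split=> y /=.
    move=> [/pos_rt[[//|n] _ ->]]; rewrite rt_le => nj; by exists n.
  by move=> [n nj <-]; split; [exact: rt_pos|rewrite rt_le].
by apply: inj_card_eq => m n _ _ /eqP; rewrite eq_le !rt_le -eqn_leq eqSS => /eqP.
Qed.

(** [nu] selects a solution by counting those below it; [rt_card] performs the count, and distinct
    initial segments of the naturals are not equinumerous. *)
Lemma nu_rt j : (0 < j)%N -> nu R j = rt j.
Proof.
move=> j0; rewrite /nu.
have P : (pos_solution (rt j) /\ ([set y : R | pos_solution y /\ y <= rt j] #= `I_j)%card).
  by split; [exact: rt_pos|exact: rt_card].
case: xgetP => [y _ [/pos_rt[n n0 ->] hn]|/(_ (rt j))]; last by case.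
by have /card_eq_II -> := card_eq_trans (card_esym (rt_card n)) hn.
Qed.

(** * Numerical bounds for [pi], the exponential and the roots *)

Lemma cos_ge (x : R) : 1 - x ^+ 2 / 2 <= cos x.
Proof.
have s : `|sin (x / 2)| <= `|x / 2|.
  have := @lip_on R (@sin R) (@cos R) `|x / 2| 1 0 (x / 2) (fun t => is_derive_sin t).
  rewrite sin0 !subr0 mul1r; apply => //; last by rewrite normr0.
  by move=> t _; rewrite ler_norml cos_geN1 cos_le1.
have s2 : sin (x / 2) ^+ 2 <= (x / 2) ^+ 2.
  by rewrite -(real_normK (num_real (sin _))) -(real_normK (num_real (x / 2))) lerXn2r ?nnegrE.
have -> : cos x = 1 - 2 * sin (x / 2) ^+ 2.
  rewrite [in LHS](_ : x = x / 2 + x / 2); last by field.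
  by rewrite cosD -!expr2; have := cos2Dsin2 (x / 2); lra.
have -> : x ^+ 2 / 2 = 2 * (x / 2) ^+ 2 by field.
lra.
Qed.

(** [cos_ge] at [pi / 2] gives [pi^2 >= 8 > 2.8^2]. The value [2.8] is four times the exponent of
    [expR_ge2]. *)
Lemma pi_ge14 : 28 / 10 <= pi :> R.
Proof.
have h := cos_ge (pi / 2); rewrite cos_pihalf in h.
have p0 := pi_gt0 R; rewrite leNgt; apply/negP => lt; nra.
Qed.

(** [1 + x <= expR x] at [x = 7/400], raised to the power 40 by repeated squaring. Since [1.0175^40]
    barely exceeds 2, each rounding down to a simple fraction has to be sharp. *)
Lemma expR_ge2 : 2 <= expR (7 / 10 : R).
Proof.
pose e (k : nat) := expR (k%:R * (7 / 400) : R).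
have D (m n : nat) (a b c : R) : 0 <= a -> 0 <= b -> a <= e m -> b <= e n -> c <= a * b -> c <= e (m + n)%N.
  move=> a0 b0 am bn cab; apply: le_trans cab _.
  by rewrite /e natrD mulrDl expRD; apply: ler_pM.
have h1 : 407 / 400 <= e 1%N by rewrite /e mul1r; apply: le_trans (expR_ge1Dx _); lra.
have h2 : 88 / 85 <= e 2%N by apply: (D 1 1 _ _ _ _ _ h1 h1)%N; lra.
have h4 : 209 / 195 <= e 4%N by apply: (D 2 2 _ _ _ _ _ h2 h2)%N; lra.
have h8 : 224 / 195 <= e 8%N by apply: (D 4 4 _ _ _ _ _ h4 h4)%N; lra.
have h16 : 351 / 266 <= e 16%N by apply: (D 8 8 _ _ _ _ _ h8 h8)%N; lra.
have h32 : 148 / 85 <= e 32%N by apply: (D 16 16 _ _ _ _ _ h16 h16)%N; lra.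
have h40 : 2 <= e 40%N by apply: (D 32 8 _ _ _ _ _ h32 h8)%N; lra.
by apply: le_trans h40 _; rewrite /e ler_expR; lra.
Qed.

Lemma expR_pi_ge16 : 16 <= expR (pi : R).
Proof.
have e := expR_ge2; have e4 : expR (7 / 10 * 4 : R) = expR (7 / 10) ^+ 4 by rewrite mulrC expRM_natl.
apply: (@le_trans _ _ (expR (7 / 10 * 4))); last by rewrite ler_expR; have := pi_ge14; lra.
rewrite e4 (_ : 16 = 2 ^+ 4); last by ring.
by rewrite lerXn2r// nnegrE ltW// expR_gt0.
Qed.

(* The offset [t] solves [tan t = e^(-2v)], whence [t <= e^(-2v) <= 1/16]. *)
Lemma rt_upper m : (0 < m)%N -> rt m <= m%:R * pi - pi / 4 + 1 / 16.
Proof.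
move=> m0; have [t [/andP[t0 t1] e h]] := rtP m; rewrite [leLHS]e lerD2l.
have p14 := pi_ge14.
have ct : 0 < cos t by apply: cos_gt0_pihalf; apply/andP; split; lra.
(* The mean value theorem and the monotonicity of cosine give [t * cos t <= sin t]; the factor
   [cos t] cancels at the end. *)
have [|c cI es] := @MVT_segment R (@sin R) (@cos R) 0 t (ltW t0) (fun x _ => is_derive_sin x).
  by apply: continuous_subspaceT; exact: continuous_sin.
rewrite sin0 !subr0 in es; move: cI; rewrite in_itv /= => /andP[c0 c1].
have cc : cos t <= cos c.
  have [->//|ne] := eqVneq t c; apply: ltW; rewrite ltr_cos ?in_itv /=.
  - by rewrite lt_neqAle c1 eq_sym ne.
  - by apply/andP; split; lra.
  - by apply/andP; split; lra.
have m1 : (1 : R) <= m%:R by rewrite ler1n.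
have v2 : 2 <= rt m by have /andP[h1 _] := rt_itv m; nra.
have E : expR (- (2 * rt m)) <= 1 / 16.
  apply: (@le_trans _ _ (expR (- (4 : R)))); first by rewrite ler_expR; lra.
  have e1 : 2 <= expR (1 : R) by have := expR_ge1Dx (1 : R); lra.
  have e4 : 16 <= expR (4 : R).
    rewrite (_ : (4 : R) = 4%:R * 1); last by rewrite mulr1.
    rewrite expRM_natl (_ : 16 = 2 ^+ 4); last by ring.
    by rewrite lerXn2r// nnegrE ltW// expR_gt0.
  by rewrite expRN div1r lef_pV2 ?posrE ?expR_gt0//; lra.
have tc : t * cos t <= expR (- (2 * rt m)) * cos t.
  by rewrite -h es mulrC ler_wpM2r// ltW.
by rewrite ler_pM2r// in tc; exact: le_trans E.
Qed.

(* Consecutive roots are [pi] apart up to [1 / 16], and [e^pi >= 16]: the constant is [16/15 * 1/15]. *)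
Lemma tail_sum m n : (0 < m)%N ->
  \sum_(m.+1 <= j < n) expR (- rt j) <= expR (- rt m) * (16 / 225).
Proof.
move=> m0; pose q : R := expR (- pi).
have q16 : q <= 1 / 16.
  have := expR_pi_ge16; have := expR_gt0 (pi : R) => e0 e16.
  by rewrite /q expRN div1r lef_pV2 ?posrE//; lra.
have q0 : 0 < q by exact: expR_gt0.
(* Measured from the left end [m pi - pi/4] of the interval of [rt m], the later roots lie beyond
   full multiples of [pi], which produces an exact geometric series. *)
pose A := expR (- (m%:R * pi - pi / 4)) : R.
have A0 : 0 < A by exact: expR_gt0.
(* [16/15] is [1 / (1 - 1/16)], an upper bound for [expR (1 / 16)]. *)
have AE : A <= expR (- rt m) * (16 / 15).
  have h := rt_upper m0.
  apply: (@le_trans _ _ (expR (- rt m) * expR (1 / 16))).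
    by rewrite -expRD /A ler_expR; lra.
  rewrite ler_pM2l ?expR_gt0//.
  have := expR_ge1Dx (- (1 / 16) : R); rewrite expRN => h1.
  have E0 := expR_gt0 (1 / 16 : R).
  have := ler_wpM2r (ltW E0) h1; rewrite mulVf ?gt_eqF//; lra.
have S : \sum_(m.+1 <= j < n) expR (- rt j) <= A * (q * \sum_(i < n - m.+1) q ^+ i).
  rewrite -{1}[m.+1]add0n big_addn big_mkord mulrA mulr_sumr.
  case: (leqP m.+1 n) => mn; last first.
    have -> : (n - m.+1 = 0)%N by apply/eqP; rewrite subn_eq0 ltnW.
    by rewrite !big_ord0.
  apply: ler_sum => i _; rewrite /A /q -expRM_natl -!expRD ler_expR.
  have /andP[h _] := rt_itv (i + m.+1)%N; move: h; rewrite natrD -natr1; lra.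
have G : \sum_(i < n - m.+1) q ^+ i <= (1 - q)^-1.
  by apply: geo_sum; apply/andP; split; lra.
have q1 : q * (1 - q)^-1 <= 1 / 15.
  by rewrite ler_pdivrMr; lra.
apply: le_trans S _; apply: (@le_trans _ _ (A * (1 / 15))).
  by rewrite ler_pM2l//; apply: le_trans q1; rewrite ler_pM2l.
move: AE A0; have := expR_gt0 (- rt m); move: (expR _) A => E a *; lra.
Qed.

End Roots.

(** * The value at the centre *)

Section Assembly.
Variable R : realType.
Local Notation mu := (@lebesgue_measure R).
Local Notation T2 := (measurableTypeR R * measurableTypeR R)%type.
Local Notation mu2 := (mu \x mu)%E.
Local Notation J := (`[-1, 1]%classic : set (measurableTypeR R)).
Local Notation Q := (@G1 R : set T2).
Let mJ := @mJ R.
Let muJ_lty := @muJ_lty R.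
Let mQ := @mQ R.
Let muQ_lty := @muQ_lty R.
Hint Resolve mQ muQ_lty mJ muJ_lty : core.
Local Notation fr := (fr R).
Let l1 : L2on mu J (fun=> 1 : R) := cont_L2 (@contC R 1).
Let lphi v := cont_L2 (@phiv_cont R v).
Let ls l := cont_L2 (@sn_cont R l).

(** Continuous functions that differ at one point of the square differ on a product of two balls,
    whose measure is positive. *)
Lemma ae_cont_eq (f g : R * R -> R) p : (forall z, Q z -> {for z, continuous f}) ->
  (forall z, Q z -> {for z, continuous g}) -> {ae mu2, forall z, Q z -> f z = g z} -> Q p -> f p = g p.
Proof.
move=> cf cg ae Qp; apply/eqP; apply: contrapT => /negP nfg.
have d0 : 0 < `|f p - g p| by rewrite normr_gt0 subr_eq0.
have c : (fun z => f z - g z) @ p --> f p - g p by apply: cvgB; [exact: cf|exact: cg].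
have n1 : \forall z \near p, f z != g z.
  have /cvgrPdist_lt/(_ _ d0) := c; apply: filterS => z h; apply/eqP => e.
  by move: h; rewrite e subrr subr0 ltxx.
have n2 : \forall z \near p, Q z by apply: open_nbhs_nbhs; split; [exact: open_Q|].
have [[A B] [/= nA nB] AB] := filterI n1 n2.
move: nA nB; rewrite -!nbhs_ballE => -[a /= a0 hA] [b /= b0 hB].
case: ae => N [mN N0 hN].
have sub : ball p.1 a `*` ball p.2 b `<=` N.
  move=> z [/hA za /hB zb]; apply: hN => /= h.
  have [/eqP ne Qz] := AB z (conj za zb); exact: ne (h Qz).
have mA : measurable (ball p.1 a : set (measurableTypeR R)) by exact: measurable_ball.
have mB : measurable (ball p.2 b : set (measurableTypeR R)) by exact: measurable_ball.
have : (mu2 (ball p.1 a `*` ball p.2 b) <= 0)%E.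
  by rewrite -N0; apply: le_measure => //; rewrite ?inE//; exact: measurableX.
have -> : mu2 (ball p.1 a `*` ball p.2 b) = ((a *+ 2)%:E * (b *+ 2)%:E)%E.
  rewrite product_measure1E//; congr (_ * _)%E; apply: lebesgue_measure_ball; exact: ltW.
rewrite -EFinM lee_fin leNgt => /negP; apply; apply: mulr_gt0; exact: mulrn_wgt0.
Qed.

(** The value at the centre of the harmonic mode with boundary values [sn l] on one side and 0 on
    the three others. *)
Definition wt l : R := sn l 0 / (2 * cosh (fr l)).

Lemma wt_le l : `|wt l| <= l%:R^-1.
Proof.
rewrite /wt; have [->|l0] := posnP l; first by rewrite sn0 mul0r normr0 invr0.
have c0 := cosh_gt0 (fr l); have lp : (0 : R) < l%:R by rewrite ltr0n.
rewrite normrM normfV (gtr0_norm (mulr_gt0 _ c0))//.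
apply: (@le_trans _ _ (1 * (2 * cosh (fr l))^-1)).
  by rewrite ler_wpM2r ?invr_ge0 ?mulr_ge0 ?(ltW c0)// sn_le1.
have q0 : 0 < 2 * cosh (fr l) by apply: mulr_gt0.
rewrite mul1r lef_pV2 ?posrE//; apply: (@le_trans _ _ (fr l)); first exact: fr_ge.
have -> : 2 * cosh (fr l) = expR (fr l) + expR (- fr l) by rewrite /cosh; field.
have := expR_ge1Dx (fr l); have := expR_gt0 (- fr l); lra.
Qed.

(* [P] represents the value at the centre: [h(0, 0)] is the inner product of [P] with the sum of the
   boundary values over the four sides. *)
Lemma kernel_exists : exists2 P : R -> R, L2on mu J P & forall l, X P l = wt l.
Proof.
apply: (@l2_exists R wt 2); first by rewrite /wt sn0 mul0r.
move=> n; apply: le_trans (inv_sq_sum R n); apply: ler_sum => i _.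
by rewrite -(real_normK (num_real (wt i))) lerXn2r ?nnegrE ?invr_ge0// wt_le.
Qed.

(** * The Steklov expansion of the centre value *)

Section kernel.
Variable P : R -> R.
Hypothesis lP : L2on mu J P.
Hypothesis XP : forall l, X P l = wt l.

Lemma ip_P_cvg d : L2on mu J d -> series (fun l => X d l * wt l) @ \oo --> ip mu J d P.
Proof.
move=> ld; have := X_parseval ld lP.
by rewrite (_ : (fun l => X d l * X P l) = (fun l => X d l * wt l))//; apply/funext => l; rewrite XP.
Qed.

(** The harmonic function [cosh (v x) cos (v y)] has value 1 at the centre, and its boundary values
    on the four sides add up to [2 * phiv v]. The argument covers every real [v], roots or not. *)
Lemma ip_phiv_P v : ip mu J (phiv v) P = 2^-1.
Proof.
have lc := cont_L2 (@cosx_cont R v); have lh := cont_L2 (@coshx_cont R v).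
pose a l := cosh v * X (fun t => cos (v * t)) l.
pose b l := cos v * X (fun t => cosh (v * t)) l.
pose K := cosh v ^+ 2 * ip mu J (fun t => cos (v * t)) (fun t => cos (v * t)) +
  cos v ^+ 2 * ip mu J (fun t => cosh (v * t)) (fun t => cosh (v * t)).
have sqa n : \sum_(l < n) a l ^+ 2 <= K.
  rewrite (eq_bigr (fun l : 'I_n => cosh v ^+ 2 * X (fun t => cos (v * t)) l ^+ 2)); last first.
    by move=> i _; rewrite /a exprMn.
  rewrite -mulr_sumr; apply: (@le_trans _ _ (cosh v ^+ 2 * ip mu J (fun t => cos (v * t)) (fun t => cos (v * t)))).
    by rewrite ler_wpM2l ?sqr_ge0//; exact: X_bessel.
  by rewrite lerDl mulr_ge0 ?sqr_ge0 ?ip_ge0.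
have sqb n : \sum_(l < n) b l ^+ 2 <= K.
  rewrite (eq_bigr (fun l : 'I_n => cos v ^+ 2 * X (fun t => cosh (v * t)) l ^+ 2)); last first.
    by move=> i _; rewrite /b exprMn.
  rewrite -mulr_sumr; apply: (@le_trans _ _ (cos v ^+ 2 * ip mu J (fun t => cosh (v * t)) (fun t => cosh (v * t)))).
    by rewrite ler_wpM2l ?sqr_ge0//; exact: X_bessel.
  by rewrite lerDr mulr_ge0 ?sqr_ge0 ?ip_ge0.
pose h (z : R * R) := cosh (v * z.1) * cos (v * z.2).
have ch : continuous h by exact: (prod_cont (@coshx_cont R v) (@cosx_cont R v)).
have lh2 : L1on mu2 Q h by apply: contsq_L1; exact: cont_contsq.
have H k m : (fr k ^+ 2 + fr m ^+ 2) * ip mu2 Q h (fun z => sn k z.1 * sn m z.2) =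
    fr k * ((-1) ^+ k.+1 * a m + a m) + fr m * ((-1) ^+ m.+1 * b k + b k).
  have e0 : ip mu2 Q h (fun z => sn k z.1 * sn m z.2) =
      ip mu J (fun t => cosh (v * t)) (sn k) * ip mu J (fun t => cos (v * t)) (sn m).
    exact: (@ip_prod R (fun t => cosh (v * t)) (fun t => cos (v * t)) (sn k) (sn m) (@coshx_cont R v) (@cosx_cont R v) (@sn_cont R k) (@sn_cont R m)).
  rewrite e0.
  have e1 := ip_cosh_sn v k; have e2 := ip_cos_sn v m.
  rewrite /a /b /X !exprS; move: e1 e2; rewrite /eo.
  move: (ip mu J (fun t => cosh (v * t)) (sn k)) (ip mu J (fun t => cos (v * t)) (sn m)) => C D e1 e2.
  transitivity (((fr k ^+ 2 + v ^+ 2) * C) * D + ((fr m ^+ 2 - v ^+ 2) * D) * C); first by ring.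
  by rewrite e1 e2; ring.
have ae := poisson_ae sqa sqa sqb sqb lh2 H.
have Q0 : Q (0, 0) by apply/QP; split; apply/andP; split; lra.
have sm := poisson_smooth sqa sqa sqb sqb.
have e0 : h (0, 0) = poisson a a b b (0, 0).
  apply: ae_cont_eq ae Q0 => z Qz; first exact: ch.
  by have [c _] := sm 0%N; exact: c.
have c1 := poisson_00 sqa sqa sqb sqb; rewrite -e0 /h /= !mulr0 cosh0 cos0 mulr1 in c1.
have two : (2 : R) != 0 by rewrite pnatr_eq0.
apply: (mulfI two); rewrite mulfV//.
apply: cvg_eq (cvgM (cvg_cst (2 : R)) (ip_P_cvg (lphi v))) c1 _ => n.
rewrite -[LHS]/(2 * series _ n) /series /= mulr_sumr; apply: eq_bigr => l _.
rewrite -/(wt l) /a /b /X /phiv ipDl; [|exact: mJ|exact: L2onZ|exact: L2onZ|exact: ls].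
by rewrite ipZl// ipZl//; ring.
Qed.

Lemma ip_1_P : ip mu J (fun=> 1) P = 4^-1.
Proof.
have two : (2 : R) != 0 by rewrite pnatr_eq0.
apply: (mulfI two); rewrite -ipZl//.
rewrite (@ipJ_eq R _ _ (phiv 0) P)//; last first.
  by move=> x _; rewrite /phiv mul0r cosh0 cos0; ring.
by rewrite ip_phiv_P; field.
Qed.

(** Every term of the series vanishes: the coefficient of [d] for odd [l], the weight [wt l] for
    even [l]. *)
Lemma phi_perp_ip_P d : phi_perp d -> ip mu J d P = 0.
Proof.
move=> Vd; have [ld _ _] := Vd.
have c0 : series (fun=> 0 : R) @ \oo --> (0 : R) by apply: (@series_delta R _ 0%N) => l; case: ifP.
apply: cvg_eq (ip_P_cvg ld) c0 _ => n; rewrite /series /=; apply: eq_bigr => l _.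
have [ol|el] := boolP (odd l); first by rewrite steklov_spectral// mul0r.
by rewrite /wt /sn mulr0 add0r sin_fr_even// mul0r mulr0.
Qed.

(** Normalising factors for the system [es], in which the constant takes index 0, so that index
    [j >= 1] belongs to the root [rt R j]. *)
Definition nphi j : R := (Num.sqrt (ip mu J (phiv (rt R j)) (phiv (rt R j))))^-1.
Definition es j (t : R) : R := if j == 0%N then (Num.sqrt 2)^-1 * 1 else nphi j * phiv (rt R j) t.

Lemma es_L2 j : L2on mu J (es j).
Proof. by rewrite /es; case: eqP => _; exact: L2onZ. Qed.

Lemma es0 : es 0 = (fun t => (Num.sqrt 2)^-1 * 1). Proof. by []. Qed.
Lemma esS j : (0 < j)%N -> es j = (fun t => nphi j * phiv (rt R j) t).
Proof. by case: j. Qed.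

Lemma ip_1_1 : ip mu J (fun=> 1) (fun=> 1) = 2.
Proof.
rewrite /ip; have dx1 (x : R) : is_derive x 1 (fun x : R => x) (1 * 1 : R).
  by rewrite mulr1; exact: is_derive_id.
by rewrite (FTC_J dx1); [ring|exact: (@contC R (1 * 1))].
Qed.

Lemma rt_facts j : (0 < j)%N -> [/\ 0 < rt R j, root_fun (rt R j) = 0,
  ip mu J (phiv (rt R j)) (phiv (rt R j)) = cosh (rt R j) ^+ 2 + cos (rt R j) ^+ 2 &
  0 < ip mu J (phiv (rt R j)) (phiv (rt R j))].
Proof.
move=> j0; have [v0 c0 D0] := pos_solution_root_fun (rt_pos R j0).
have e := ip_phiv_phiv v0 D0; split=> //; rewrite e ltr_pwDl ?sqr_ge0// exprn_gt0//; exact: cosh_gt0.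
Qed.

Lemma ip_phi_1 j : (0 < j)%N -> ip mu J (phiv (rt R j)) (fun=> 1) = 0.
Proof.
move=> j0; have [v0 D0 _ _] := rt_facts j0.
by apply: (mulfI (lt0r_neq0 v0)); rewrite ip_phiv_1 D0 !mulr0.
Qed.

Lemma es_orth i j : i != j -> ip mu J (es i) (es j) = 0.
Proof.
wlog ij : i j / (i < j)%N.
  move=> H; rewrite neq_ltn => /orP[h|h]; first by apply: H => //; rewrite neq_ltn h.
  by rewrite ipC; apply: H => //; rewrite neq_ltn h.
move=> _; have j0 : (0 < j)%N by exact: leq_ltn_trans ij.
rewrite (esS j0) ipZr//; last exact: es_L2.
have [->|i0] := posnP i; first by rewrite es0 ipZl// (ipC mu J (fun=> 1)) ip_phi_1// !mulr0.
have [vi Di _ _] := rt_facts i0; have [vj Dj _ _] := rt_facts j0.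
have ne : rt R i != rt R j by rewrite lt_eqF//; exact: rt_mono.
rewrite (esS i0) ipZl; last exact: lphi.
- have gen (a b c : R) : c = 0 -> a * (b * c) = 0 by move=> ->; rewrite !mulr0.
  apply: gen; exact: (ip_phiv_orth vi vj ne Di Dj).
- exact: mJ.
- exact: lphi.
Qed.

Lemma es_unit i : ip mu J (es i) (es i) = 1 \/ ip mu J (es i) (es i) = 0.
Proof.
left; have [->|i0] := posnP i.
  rewrite es0 ipZl ?ipZr//; last exact: L2onZ.
  by rewrite ip_1_1 mulrA -expr2 exprVn sqr_sqrtr// mulVf// pnatr_eq0.
have [_ _ _ p0] := rt_facts i0.
rewrite (esS i0) ipZl ?ipZr//; last exact: L2onZ.
by rewrite mulrA -expr2 /nphi exprVn sqr_sqrtr ?(ltW p0)// mulVf// gt_eqF.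
Qed.

(** The vector that is expanded is [P], not [g]; completeness relative to it is exactly
    [phi_perp_ip_P], and [g] may be any square-integrable function. *)
Lemma es_parseval g : L2on mu J g ->
  series (fun i => ip mu J P (es i) * ip mu J g (es i)) @ \oo --> ip mu J g P.
Proof.
move=> lg; rewrite (ipC mu J g); apply: parseval => //; [exact: es_L2|exact: es_orth|exact: es_unit|].
move=> d ld hd; apply: phi_perp_ip_P; split=> //.
  have := hd 0%N; rewrite es0 ipZr// => /eqP; rewrite mulf_eq0 invr_eq0 sqrtr_eq0 leNgt ltr0n /= => /eqP //.
move=> v /pos_rt[j j0 ->]; have := hd j; rewrite (esS j0) ipZr// => /eqP.
have [_ _ _ p0] := rt_facts j0.
by rewrite mulf_eq0 invr_eq0 sqrtr_eq0 leNgt p0 /= => /eqP.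
Qed.

Lemma ip_P_es0 g : L2on mu J g -> ip mu J P (es 0) * ip mu J g (es 0) = 8^-1 * ip mu J g (fun=> 1).
Proof.
move=> lg; rewrite es0 !ipZr// (ipC mu J P) ip_1_P.
have s2 : (Num.sqrt 2 : R) ^+ 2 = 2 by rewrite sqr_sqrtr.
have s0 : (Num.sqrt 2 : R) != 0 by rewrite sqrtr_eq0 leNgt ltr0n.
rewrite [LHS](_ : _ = ((Num.sqrt 2 : R) ^+ 2)^-1 * 4^-1 * ip mu J g (fun=> 1)); last by field.
by rewrite s2; field.
Qed.

Lemma ip_P_es j g : (0 < j)%N -> L2on mu J g -> ip mu J P (es j) * ip mu J g (es j) =
  (I1 (rt R j))^-1 * ip mu J g (phiv (rt R j)).
Proof.
move=> j0 lg; have [v0 D0 e p0] := rt_facts j0.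
rewrite (esS j0) !ipZr// (ipC mu J P) ip_phiv_P I1_root// -e.
have s2 : nphi j ^+ 2 = (ip mu J (phiv (rt R j)) (phiv (rt R j)))^-1.
  by rewrite /nphi exprVn sqr_sqrtr// ltW.
rewrite [LHS](_ : _ = nphi j ^+ 2 * 2^-1 * ip mu J g (phiv (rt R j))); last by ring.
by rewrite s2 invfM; ring.
Qed.

Lemma ip_P_es_bound j g : (0 < j)%N -> L2on mu J g ->
  `|ip mu J P (es j) * ip mu J g (es j)| <= expR (- rt R j) * Num.sqrt (ip mu J g g).
Proof.
move=> j0 lg; rewrite normrM; apply: ler_pM => //; last first.
  apply: le_trans (ip_CS_abs mJ lg (es_L2 j)) _; rewrite -[leRHS]mulr1 ler_wpM2l ?sqrtr_ge0//.
  by case: (es_unit j) => ->; rewrite ?sqrtr1 ?sqrtr0.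
have [v0 D0 e p0] := rt_facts j0.
have s0 : 0 < Num.sqrt (ip mu J (phiv (rt R j)) (phiv (rt R j))) by rewrite sqrtr_gt0.
rewrite (esS j0) ipZr// (ipC mu J P) ip_phiv_P ger0_norm; last first.
  by rewrite mulr_ge0 ?invr_ge0 ?sqrtr_ge0.
rewrite /nphi -invfM expRN lef_pV2 ?posrE ?expR_gt0 ?mulr_gt0//.
apply: (@le_trans _ _ (cosh (rt R j) * 2)).
  rewrite /cosh; have := expR_gt0 (- rt R j); lra.
rewrite ler_wpM2r//; have c0 := cosh_gt0 (rt R j).
rewrite -[leLHS](ger0_norm (ltW c0)) -sqrtr_sqr ler_sqrt ?(ltW p0)// e lerDl sqr_ge0//.
Qed.

End kernel.
End Assembly.

(** * Comparison with the Steklov approximation *)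

Section Harmonic.
Variable R : realType.
Local Notation mu := (@lebesgue_measure R).
Local Notation T2 := (measurableTypeR R * measurableTypeR R)%type.
Local Notation mu2 := (mu \x mu)%E.
Local Notation J := (`[-1, 1]%classic : set (measurableTypeR R)).
Local Notation Q := (@G1 R : set T2).
Let mJ := @mJ R.
Let muJ_lty := @muJ_lty R.
Let mQ := @mQ R.
Let muQ_lty := @muQ_lty R.
Hint Resolve mQ muQ_lty mJ muJ_lty : core.
Local Notation fr := (fr R).
Let l1 : L2on mu J (fun=> 1 : R) := cont_L2 (@contC R 1).
Let lphi v := cont_L2 (@phiv_cont R v).

(** Two smooth representatives agree by [ae_cont_eq], so the choice made in [smooth_value] is
    immaterial. *)
Lemma smooth_value_eq (h hs : R * R -> R) (p : R * R) : @G1 R p -> smooth_on (@G1 R) hs ->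
  {ae mu2, forall z, Q z -> h z = hs z} -> smooth_value h p = hs p.
Proof.
move=> Qp sm ae; rewrite /smooth_value; set A := [set v | _].
have Av : A (hs p) by exists hs; split.
have [ks [sk aek ->]] := @xgetPex _ 0 A (ex_intro _ _ Av).
apply: ae_cont_eq Qp => [z Qz|z Qz|].
- by have [c _] := sk 0%N; exact: c.
- by have [c _] := sm 0%N; exact: c.
- by apply: filterS2 ae aek => z e1 e2 Qz; rewrite -(e1 Qz) -(e2 Qz).
Qed.

Lemma ip_add_le (d e : R -> R) : L2on mu J d -> L2on mu J e ->
  ip mu J (fun x => d x + e x) (fun x => d x + e x) <= 2 * (ip mu J d d + ip mu J e e).
Proof.
move=> ld le; have lN := L2onZ mJ (-1) le.
have := ip_ge0 mu J (fun x => d x + -1 * e x).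
rewrite (ip_add2 ld lN) (ip_add2 ld le) !ipZr// ipZl//.
have G (a b c : R) : 0 <= a + 2 * (-1 * b) + -1 * (-1 * c) -> a + 2 * b + c <= 2 * (a + c) by lra.
exact: G.
Qed.

Variables h g : R * R -> R.
Hypothesis Hh : H1_harmonic h.
Hypothesis Hg : is_trace h g.

Definition side_sum (t : R) : R := (g (1, t) + g (-1, t)) + (g (t, 1) + g (t, -1)).
Local Notation gh := side_sum.

Let lg1 : L2on mu J (fun t => g (1, t)) := Hg.1 (@Ordinal 4 0 isT).
Let lg2 : L2on mu J (fun t => g (-1, t)) := Hg.1 (@Ordinal 4 1 isT).
Let lg3 : L2on mu J (fun t => g (t, 1)) := Hg.1 (@Ordinal 4 2 isT).
Let lg4 : L2on mu J (fun t => g (t, -1)) := Hg.1 (@Ordinal 4 3 isT).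

Lemma side_sum_L2 : L2on mu J gh.
Proof. by apply: L2onD => //; apply: L2onD. Qed.

Lemma ip_side_sum w : L2on mu J w -> ip mu J gh w =
  (ip mu J (fun t => g (1, t)) w + ip mu J (fun t => g (-1, t)) w) +
  (ip mu J (fun t => g (t, 1)) w + ip mu J (fun t => g (t, -1)) w).
Proof.
move=> lw; have l12 := L2onD mJ lg1 lg2; have l34 := L2onD mJ lg3 lg4.
rewrite (ipDl mJ l12 l34 lw) (ipDl mJ lg1 lg2 lw) (ipDl mJ lg3 lg4 lw).
by [].
Qed.

Lemma boundary_integralE (u : R * R -> R) : boundary_integral u =
  (\int[mu]_(t in J) u (1, t) + \int[mu]_(t in J) u (-1, t)) +
  (\int[mu]_(t in J) u (t, 1) + \int[mu]_(t in J) u (t, -1)).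
Proof.
rewrite /boundary_integral !big_ord_recl big_ord0 /side /= addr0 !addrA.
by [].
Qed.

Lemma boundary_integral_side_sum (u : R * R -> R) (w : R -> R) : L2on mu J w ->
  (forall t, [/\ u (1, t) = w t, u (-1, t) = w t, u (t, 1) = w t & u (t, -1) = w t]) ->
  boundary_integral (fun p => g p * u p) = ip mu J gh w.
Proof.
move=> lw H; rewrite boundary_integralE ip_side_sum//.
by congr ((_ + _) + (_ + _)); apply: intJ_eq => t _; have [e1 e2 e3 e4] := H t; rewrite ?e1 ?e2 ?e3 ?e4.
Qed.

(* [17 / 3] is just above [sqrt 32]: Cauchy-Schwarz over the four sides gives 4, the factor [1 / 8] in
   the boundary norm gives 8. *)
Lemma side_sum_norm : Num.sqrt (ip mu J gh gh) <= 17 / 3 * boundary_norm g.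
Proof.
have G1 (x y : R) : 0 <= x -> x <= 4 * y -> x <= (17 / 3) ^+ 2 * (8^-1 * y).
  by rewrite expr2 => *; lra.
have l12 := L2onD mJ lg1 lg2; have l34 := L2onD mJ lg3 lg4.
have b0 : ip mu J gh gh <= 4 * boundary_integral (fun p => g p * g p).
  rewrite boundary_integralE; have h0 := ip_add_le l12 l34.
  have h1 := ip_add_le lg1 lg2; have h2 := ip_add_le lg3 lg4.
  have G (x y z a b c d : R) : x <= 2 * (y + z) -> y <= 2 * (a + b) -> z <= 2 * (c + d) ->
    x <= 4 * ((a + b) + (c + d)) by lra.
  exact: G h0 h1 h2.
have n0 := ip_ge0 mu J gh.
have le := G1 _ _ n0 b0.
have -> : 17 / 3 * boundary_norm g =
    Num.sqrt ((17 / 3) ^+ 2 * (8^-1 * boundary_integral (fun p => g p * g p))).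
  by rewrite sqrtrM ?sqr_ge0// sqrtr_sqr ger0_norm.
by rewrite ler_sqrt// (le_trans n0).
Qed.

Variable P : R -> R.
Hypothesis lP : L2on mu J P.
Hypothesis XP : forall l, X P l = wt R l.

Lemma harmonic_center : smooth_value h (0, 0) = ip mu J gh P.
Proof.
pose a1 := X (fun t => g (1, t)); pose a2 := X (fun t => g (-1, t)).
pose b1 := X (fun t => g (t, 1)); pose b2 := X (fun t => g (t, -1)).
pose n1 := ip mu J (fun t => g (1, t)) (fun t => g (1, t)).
pose n2 := ip mu J (fun t => g (-1, t)) (fun t => g (-1, t)).
pose n3 := ip mu J (fun t => g (t, 1)) (fun t => g (t, 1)).
pose n4 := ip mu J (fun t => g (t, -1)) (fun t => g (t, -1)).
have p1 : 0 <= n1 by exact: ip_ge0.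
have p2 : 0 <= n2 by exact: ip_ge0.
have p3 : 0 <= n3 by exact: ip_ge0.
have p4 : 0 <= n4 by exact: ip_ge0.
pose K := n1 + n2 + n3 + n4.
have B1 n : \sum_(l < n) a1 l ^+ 2 <= n1 by exact: X_bessel.
have B2 n : \sum_(l < n) a2 l ^+ 2 <= n2 by exact: X_bessel.
have B3 n : \sum_(l < n) b1 l ^+ 2 <= n3 by exact: X_bessel.
have B4 n : \sum_(l < n) b2 l ^+ 2 <= n4 by exact: X_bessel.
have [K1 K2 K3 K4] : [/\ n1 <= K, n2 <= K, n3 <= K & n4 <= K].
  rewrite /K; move: n1 n2 n3 n4 p1 p2 p3 p4 {B1 B2 B3 B4 K} => x1 x2 x3 x4 *; split; lra.
have S1 n := le_trans (B1 n) K1.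
have S2 n := le_trans (B2 n) K2.
have S3 n := le_trans (B3 n) K3.
have S4 n := le_trans (B4 n) K4.
have lh : L1on mu2 Q h.
  have [hx [hy [[lh _ _ _] _]]] := Hh; exact: (L2on_L1 mQ muQ_lty lh).
have ae := poisson_ae S1 S2 S3 S4 lh (fun k m => harmonic_fourier k m Hh Hg).
have Q0 : @G1 R (0, 0) by apply/QP; split; apply/andP; split; lra.
rewrite (smooth_value_eq Q0 (poisson_smooth S1 S2 S3 S4) ae).
apply: cvg_eq (poisson_00 S1 S2 S3 S4) (ip_P_cvg lP XP side_sum_L2) _ => n.
rewrite /series /=; apply: eq_bigr => l _; rewrite -/(wt R l); congr (_ * _).
by rewrite /X ip_side_sum ?addrA//; exact: cont_L2 (@sn_cont R l).
Qed.

(** One factor [N] comes from the boundary values of [s1 j + s2 j], a second from [s1 j (0, 0) = N].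
    In [N^2 = 8 / I1] the 8 cancels the length of the boundary. *)
Lemma steklov_term j : (0 < j)%N ->
  boundary_inner g (fun p => s1 j p + s2 j p) * s1 j (0, 0) =
  ip mu J P (es j) * ip mu J gh (es j).
Proof.
move=> j0; rewrite (ip_P_es lP XP j0 side_sum_L2) /boundary_inner.
set N := Num.sqrt (8 / I1 (nu R j)); set v := nu R j in N *.
have ev : v = rt R j by exact: nu_rt.
rewrite (@boundary_integral_side_sum _ (fun t => N * phiv v t)); first last.
- by move=> t; rewrite /s1 /s2 -/v -/N /phiv /= !mulr1 !mulrN1 coshN cosN; split; ring.
- by apply: L2onZ => //; exact: lphi.
rewrite ipZr//; last exact: side_sum_L2.
have -> : s1 j (0, 0) = N by rewrite /s1 -/v -/N /= !mulr0 cosh0 cos0 !mulr1.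
have [v0 D0 e p0] := rt_facts R j0.
have I0 : 0 < I1 v by rewrite ev I1_root// -e mulr_gt0.
have s2 : N ^+ 2 = 8 / I1 v by rewrite sqr_sqrtr// divr_ge0// ltW.
rewrite -ev; move: (ip mu J gh (phiv v)) => A.
transitivity (8^-1 * N ^+ 2 * A); first by ring.
by rewrite s2; field; exact: lt0r_neq0.
Qed.

(** The term of index 0 is the boundary mean, which brings the count to [m.+1]. *)
Lemma steklov_sum m : trace h = g -> steklov_approx m h =
  series (fun i => ip mu J P (es i) * ip mu J gh (es i)) m.+1.
Proof.
move=> tg; rewrite /steklov_approx tg /series /= [in RHS]big_ltn//; congr (_ + _).
  rewrite (ip_P_es0 lP XP side_sum_L2) /boundary_mean /boundary_inner; congr (_ * _).
  by apply: boundary_integral_side_sum.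
by apply: eq_big_nat => j /andP[j0 _]; exact: steklov_term.
Qed.

Lemma steklov_error m : (0 < m)%N -> trace h = g ->
  `|smooth_value h (0, 0) - steklov_approx m h| <=
  81 / 200 * expR (- nu R m) * boundary_norm g.
Proof.
move=> m0 tg; rewrite harmonic_center (steklov_sum m tg) nu_rt//.
set f := fun i : nat => _; have c := es_parseval lP XP side_sum_L2; rewrite -/f in c.
have cn : `|series f n - series f m.+1| @[n --> \oo] --> `|ip mu J gh P - series f m.+1|.
  by apply: cvg_norm; exact: cvgB c (cvg_cst _).
apply: cvg_le_bound cn _; exists m.+1 => // n /= mn.
rewrite sub_series_geq//; apply: le_trans (ler_norm_sum _ _ _) _.
apply: (@le_trans _ _ (\sum_(m.+1 <= j < n) expR (- rt R j) * Num.sqrt (ip mu J gh gh))).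
  rewrite big_nat [leRHS]big_nat; apply: ler_sum => j /andP[mj _].
  by apply: (ip_P_es_bound lP XP _ side_sum_L2); exact: leq_ltn_trans mj.
rewrite -mulr_suml; apply: le_trans (ler_wpM2r (sqrtr_ge0 _) (tail_sum R n m0)) _.
have e0 := expR_ge0 (- rt R m); have b0 : 0 <= boundary_norm g by exact: sqrtr_ge0.
have -> : 81 / 200 * expR (- rt R m) * boundary_norm g =
  expR (- rt R m) * (81 / 200 * boundary_norm g) by ring.
(* The remaining inequality of constants is [16/225 * 17/3 = 272/675 < 81/200]. *)
rewrite -[leLHS]mulrA ler_wpM2l//; move: side_sum_norm b0; move: (Num.sqrt _) (boundary_norm g) => x y; lra.
Qed.

End Harmonic.

Theorem theorem5p2 (R : realType) (m : nat) (hm : (1 <= m)%N) :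
  exists C : R,
    [/\ 0 < C,
        ((3 <= m)%N -> C < 41 / 100)
      & forall h : R * R -> R, H1_harmonic h ->
          `| smooth_value h (0, 0) - steklov_approx m h |
            <= C * expR (- nu R m) * boundary_norm (trace h) ].
Proof.
exists (81 / 200); split; [lra|by move=> _; lra|move=> h Hh].
(* [trace h] is selected by [xget], so it is a trace as soon as one exists. *)
have tr : is_trace h (trace h).
  have [hx [hy [H _]]] := Hh.
  exact: xgetPex (trace_exists (ex_intro _ hx (ex_intro _ hy H))).
have [P lP XP] := kernel_exists R.
exact: (steklov_error Hh tr lP XP hm).
Qed.
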